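(* Let $\alpha\in(-1,1)$, $\lambda\in\mathbb{R}$, and $v(\theta)=\dfrac{2\lambda\cos(2\pi\theta)}{1-\alpha\cos(2\pi\theta)}$. Suppose $b\in\mathbb{T}$ is Diophantine and $\theta\in\mathbb{T}$ is non-resonant with respect to $b$. Then the spectrum of $H_{\alpha,\theta,b}$ in the region of positive Lyapunov exponent is purely pure point with exponentially decaying eigenfunctions (Anderson localization); that is, the restriction of the universal spectral measure $\mu_{\alpha,\theta,b}$ to $\{E\in\sigma(H_{\alpha,\theta,b}):L(E)>0\}$ is a pure point measure, and every eigenfunction of $H_{\alpha,\theta,b}$ with eigenvalue in this set decays exponentially.
   Context: $\mathbb{T}=\mathbb{R}/\mathbb{Z}$. $H_{\alpha,\theta,b}$ is the operator on $\ell^2(\mathbb{Z})$ given by $(H_{\alpha,\theta,b}u)_n=u_{n+1}+u_{n-1}+v(nb+\theta)u_n$, with spectrum $\sigma(H_{\alpha,\theta,b})$. For $z\in\mathbb{C}$ let $A(\theta,z)=\begin{pmatrix}z-v(\theta)&-1\\1&0\end{pmatrix}$ and $A_n(\theta,z)=A(\theta+(n-1)b,z)\cdots A(\theta,z)$ for $n\ge1$. The Lyapunov exponent is $L(z)=\lim_{n\to\infty}\int_{\mathbb{T}}\frac1n\log\|A_n(\theta,z)\|\,d\theta$. The universal spectral measure is $\mu_{\alpha,\theta,b}=\frac12(\mu_{\delta_0}+\mu_{\delta_1})$, where for $i=0,1$, $\mu_{\delta_i}$ is the spectral measure of $H_{\alpha,\theta,b}$ at the standard basis vector $\delta_i$,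 i.e. $\langle\delta_i,(H_{\alpha,\theta,b}-zI)^{-1}\delta_i\rangle=\int\frac{d\mu_{\delta_i}(t)}{t-z}$ for $\Im z>0$. A measure is pure point if it is supported on a countable set. An irrational $b\in\mathbb{T}$ is Diophantine if there are constants $c=c(b)>0$ and $r=r(b)>1$ such that $|\sin(2\pi nb)|>\frac{c}{|n|^r}$ for every $n\in\mathbb{Z}\setminus\{0\}$. Given such $b$ (with its $r=r(b)$), $\theta\in\mathbb{T}$ is resonant with respect to $b$ if $|\sin(2\pi(\theta+\frac n2 b))|<e^{-|n|^{1/(2r)}}$ holds for infinitely many $n\in\mathbb{Z}$; otherwise $\theta$ is non-resonant. An eigenfunction $u$ decays exponentially if there are $C,\kappa>0$ with $|u_n|\le Ce^{-\kappa|n|}$ for all $n\in\mathbb{Z}$. *)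

(* Defs.v *)
From HB Require Import structures.
From mathcomp Require Import all_boot all_order all_algebra.
From mathcomp Require Import complex.
From mathcomp Require Import all_classical all_reals all_analysis.
Set Implicit Arguments.
Unset Strict Implicit.
Unset Printing Implicit Defensive.
Import Order.TTheory GRing.Theory Num.Theory.
Import numFieldNormedType.Exports.
Import Normc.
Local Open Scope classical_set_scope.
Local Open Scope ring_scope.
Local Open Scope complex_scope.

(* Points of the circle R/Z are given by arbitrary real representatives: every
   notion below depends on b and theta only through their classes mod 1. *)

Section Sequences.
Variable R : realType.
Local Notation C := R[i].
Implicit Types (u w : int -> C) (T : (int -> C) -> int -> C).

Definition l2_sqnorm u : \bar R :=
  (\esum_(n in [set: int]) ((normc (u n)) ^+ 2)%:E)%E.

Definition l2 u : Prop := (l2_sqnorm u < +oo)%E.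

Definition l2_norm u : R := Num.sqrt (fine (l2_sqnorm u)).

Definition l2_partial_dot u w (N : nat) : C :=
  \sum_(k < N.*2.+1) (u (k%:Z - N%:Z))^* * w (k%:Z - N%:Z).

(* The series converges absolutely for u, w in l2, so symmetric partial sums
   may be used; the limit is taken on real and imaginary parts. *)
Definition l2_dot u w : C :=
  limn (fun N => complex.Re (l2_partial_dot u w N))
  +i* limn (fun N => complex.Im (l2_partial_dot u w N)).

Definition delta (i : int) : int -> C := fun n => (n == i)%:R.

(* T acts on all sequences, but only its restriction to l2 matters. *)
Definition l2_bounded_operator T : Prop :=
  [/\ forall u, l2 u -> l2 (T u),
      forall (a : C) u w, l2 u -> l2 w ->
        T (fun n => a * u n + w n) = (fun n => a * T u n + T w n)
    & exists M : R, forall u, l2 u -> l2_norm (T u) <= M * l2_norm u].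

(* S = (T - z I)^-1 as a bounded operator on l2. *)
Definition is_resolvent T (z : C) (S : (int -> C) -> int -> C) : Prop :=
  l2_bounded_operator S /\
  forall u, l2 u ->
    (fun n => T (S u) n - z * S u n) = u /\
    S (fun n => T u n - z * u n) = u.

Definition spectrum T : set C := [set z | ~ exists S, is_resolvent T z S].

Definition is_eigenfunction T (z : C) u : Prop :=
  [/\ l2 u, exists n, u n != 0 & forall n, T u n = z * u n].

Definition decays_exponentially u : Prop :=
  exists K kappa : R, [/\ 0 < K, 0 < kappa &
    forall n : int, normc (u n) <= K * expR (- (kappa * (`|n|%N)%:R))].

End Sequences.

Section Measures.
Variable R : realType.
Local Notation C := R[i].

Definition complex_integral (mu : {measure set (measurableTypeR R) -> \bar R})
    (f : R -> C) : C :=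
  Rintegral mu setT (fun t => complex.Re (f t))
  +i* Rintegral mu setT (fun t => complex.Im (f t)).

Definition is_spectral_measure (T : (int -> C) -> int -> C) (w : int -> C)
    (mu : {finite_measure set (measurableTypeR R) -> \bar R}) : Prop :=
  forall z : C, 0 < complex.Im z ->
    exists2 S, is_resolvent T z S &
      l2_dot w (S w) = complex_integral mu (fun t => (t%:C - z)^-1).

(* (mu0 + mu1) / 2 *)
Definition half_sum
    (mu0 mu1 : {finite_measure set (measurableTypeR R) -> \bar R}) :=
  mscale (2^-1)%:nng (measure_add mu0 mu1).

Definition pure_point (nu : set (measurableTypeR R) -> \bar R) : Prop :=
  exists D : set (measurableTypeR R), countable D /\ nu (~` D) = 0%E.

End Measures.

Section Model.
Variable R : realType.
Local Notation C := R[i].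
Implicit Types (v : R -> R) (b theta : R) (z : C).

Definition potential (alpha lambda theta : R) : R :=
  (2 * lambda * cos (2 * pi * theta)) / (1 - alpha * cos (2 * pi * theta)).

Definition hamiltonian v b theta (u : int -> C) : int -> C :=
  fun n => u (n + 1) + u (n - 1) + (v (n%:~R * b + theta))%:C * u n.

Definition transfer_matrix v theta z : 'M[C]_2 :=
  \matrix_(i < 2, j < 2)
    if i == 0 then (if j == 0 then z - (v theta)%:C else -1)
    else (if j == 0 then 1 else 0).

Fixpoint transfer_product v b (n : nat) theta z : 'M[C]_2 :=
  if n is m.+1
  then transfer_matrix v (theta + m%:R * b) z *m transfer_product v b m theta z
  else 1%:M.

Definition euclidean_norm (x : 'cV[C]_2) : R :=
  Num.sqrt (\sum_(i < 2) (normc (x i ord0)) ^+ 2).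

Definition operator_norm (A : 'M[C]_2) : R :=
  sup [set euclidean_norm (A *m x) | x in [set x | euclidean_norm x <= 1]].

Definition lyapunov v b z : R :=
  limn (fun n : nat => Rintegral (@lebesgue_measure R) `[0, 1]
    (fun theta => n%:R^-1 * ln (operator_norm (transfer_product v b n theta z)))).

Definition diophantine (c r b : R) : Prop :=
  [/\ irrational b, 0 < c, 1 < r &
    forall n : int, n != 0 ->
      c / ((`|n|%N)%:R `^ r) < `|sin (2 * pi * (n%:~R * b))|].

Definition resonant (r b theta : R) : Prop :=
  infinite_set [set n : int |
    `|sin (2 * pi * (theta + n%:~R / 2 * b))|
      < expR (- ((`|n|%N)%:R `^ (2 * r)^-1))].

(* {E in sigma(H) : L(E) > 0}, as a subset of the real line (H is self-adjoint) *)
Definition positive_lyapunov_spectrum v b theta : set (measurableTypeR R) :=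
  [set E : R | spectrum (hamiltonian v b theta) E%:C /\ 0 < lyapunov v b E%:C].

End Model.

(* Main.v *)
Require Import Defs.
From HB Require Import structures.
From mathcomp Require Import all_boot all_order all_algebra.
From mathcomp Require Import complex.
From mathcomp Require Import all_classical all_reals all_analysis.
From mathcomp Require Import ring lra zify.
Set Implicit Arguments.
Unset Strict Implicit.
Unset Printing Implicit Defensive.
Import Order.TTheory GRing.Theory Num.Theory.
Import numFieldNormedType.Exports.
Local Open Scope classical_set_scope.
Local Open Scope ring_scope.
Import Normc.
Local Open Scope complex_scope.

(** Idea of the proof.  Everything rests on one deterministic statement about solutions
    of u(n+1) + u(n-1) + v(nb+theta) u(n) = E u(n): if L(E) > 0, a solution of at most
    linear growth decays exponentially ([solution_decay]).  An l2 eigenfunction is bounded,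
    so this gives the decay of eigenfunctions.  For the pure point part, almost every
    energy with respect to the spectral measures has a nonzero solution of at most linear
    growth ([wild_null], [not_wild_solution]).  Almost every energy with L(E) > 0 is
    therefore an eigenvalue with a decaying eigenfunction; eigenfunctions of distinct
    eigenvalues are orthogonal, so there are countably many of them
    ([eigenvalue_level_finite]) and they carry the whole restricted measure.

    Decay of solutions.  Let P_k(x) be the determinant of the block of E - H on k
    consecutive sites whose first phase is x.  The value of a solution inside a block is
    the sum of its two end values, with coefficients P_l / P_k and P_m / P_k where l and m
    are the lengths of the two sides ([green_identity]).  With Lambda the exponential
    growth rate of the supremum over the phase of the transfer matrices ([growth_rate]),
    the numerators are at most exp((Lambda + eps) l) at every phase, and Lambda >= L(E).
    Hence u is exponentially small well inside any block whose determinant is nearly as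
    large as exp(Lambda k).  Some phase has such a determinant; it has to be found among
    the phases theta + nb with n in prescribed intervals.  For the potential at hand, P_k
    times a product of explicit denominators is a polynomial of degree at most k in the
    cosine of the central phase of the block ([block_det_poly]).  Interpolate it at k + 1
    phases of the orbit, taken from one interval placed just left of the origin and one
    placed before a far site y.  If P_k were small at all of them it would be small at
    every phase, provided that the Lagrange weights grow subexponentially
    ([node_product]).  So one of the nodes carries a large determinant ([large_node]).
    It cannot belong to the interval near the origin, since the corresponding block
    contains a fixed site p with u(p) <> 0 and would force u(p) to be arbitrarily small.
    It therefore belongs to the interval near y and makes u(y) small ([one_sided_decay]).

    The Lagrange weights.  A weight is a product of quotients of
    |cos 2 pi y - cos 2 pi t_l| = 2 |sin pi (t_l - y)| |sin pi (t_l + y)|.  Once the sine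
    is truncated from below at a small level d, its logarithm is Lipschitz, and Birkhoff
    sums of a Lipschitz function at two starting points differ by at most eps n + C
    ([birkhoff_sums_close]); so the truncated numerator and denominator cancel up to a
    subexponential factor.  What truncation costs in the denominator is controlled by
    counting close returns of the rotation ([count_near_zero]), with the Diophantine
    condition bounding the differences of nodes and the non-resonance of theta bounding
    their sums.

    Slowly growing solutions.  Let psi_k and d_k be the eigenvectors and eigenvalues of
    the restriction of H to the box |n| <= N.  The Poisson integrals of the spectral measure
    of delta_i are limits of those of the finite measures with mass |psi_k(i)|^2 at d_k
    ([poisson_limit]).  Suppose that near a set F of energies every solution satisfies
    K (u(0)^2 + u(1)^2) <= sum of u(n)^2 / ((1+|n|)(2+|n|)) over |n| <= M.  Summing over
    the eigenvectors with d_k near F and using that the psi_k are complete, their values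
    at 0 and 1 have total square at most 2 / K ([finite_volume_mass]).  Dominating the
    indicator of F by a grid of Poisson kernels gives mu(F) <= 48 / K
    ([coercive_measure_bound]).  Letting K grow, the energies for which no nonzero solution
    has a finite weighted sum form a null set.

    The set {E in sigma(H) : L(E) > 0} is measurable: the spectrum is closed by a Neumann
    series ([spectrum_closed]), and L is a pointwise limit
    of functions continuous in E ([positive_lyapunov_spectrum_measurable]). *)

(** * Rotations of the circle *)
Section Trig.
Context {R : realType}.
Implicit Types (x y z t b eta tau : R).

Lemma sin_cos_lipschitz x y :
  `|sin x - sin y| <= `|x - y| /\ `|cos x - cos y| <= `|x - y|.
Proof.
wlog xy : x y / x <= y.
  move=> H; case: (leP x y) => [|/ltW] xy; first exact: H.
  by rewrite distrC [X in _ /\ X <= _]distrC [`|x - y|]distrC; exact: H.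
rewrite (distrC (sin x)) (distrC (cos x)) (distrC x).
have [c _ ->] : exists2 c, c \in `[x, y] & sin y - sin x = cos c * (y - x).
  apply: MVT_segment => //.
  by apply: continuous_subspaceT; exact: continuous_sin.
have [d _ ->] : exists2 c, c \in `[x, y] & cos y - cos x = - sin c * (y - x).
  apply: MVT_segment => //.
  by apply: continuous_subspaceT; exact: continuous_cos.
by rewrite !normrM normrN; split; rewrite ler_piMl// (sin_max, cos_max).
Qed.

Lemma sinDint x (n : int) : `|sin (x + n%:~R * pi)| = `|sin x|.
Proof.
have H (m : nat) z : `|sin (z + m%:R * pi)| = `|sin z|.
  elim: m z => [|m IH] z; first by rewrite mul0r addr0.
  by rewrite -natr1 mulrDl mul1r addrA sinDpi normrN IH.
case: n => m; first by rewrite H.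
by rewrite NegzE mulrNz -[in RHS](subrK (m.+1%:R * pi) x) H mulNr.
Qed.

Lemma cosDint x (n : int) : cos (x + n%:~R * (2 * pi)) = cos x.
Proof.
have H (m : nat) z : cos (z + m%:R * (2 * pi)) = cos z.
  elim: m z => [|m IH] z; first by rewrite mul0r addr0.
  rewrite -natr1 mulrDl mul1r addrA.
  by have := cosD2pi (z + m%:R * (2 * pi)); rewrite -[pi *+ 2]mulr_natl IH.
case: n => m; first by rewrite H.
by rewrite NegzE mulrNz -[in RHS](subrK (m.+1%:R * (2 * pi)) x) H mulNr.
Qed.

(** When cos x <= 1/2 the sine exceeds 1/2, and otherwise the mean value theorem gives
    slope at least 1/2; both beat x / pi on this interval. *)
Lemma sin_ge_linear x : 0 <= x -> x <= pi / 2 -> x / pi <= sin x.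
Proof.
move=> x0 xpi2; have pi2 := @pi_ge2 R.
have pi0 : 0 < pi :> R by exact: pi_gt0.
have s0 : 0 <= sin x by apply: sin_ge0_pi; lra.
have c0 : 0 <= cos x by apply: cos_ge0_pihalf; lra.
have xle : x / pi <= 1 / 2 by rewrite ler_pdivrMr//; lra.
have [c2|c2] := leP (cos x) (1 / 2).
  by have := cos2Dsin2 x; nra.
have [c cin E] : exists2 c, c \in `[0, x] & sin x - sin 0 = cos c * (x - 0).
  apply: MVT_segment => //.
  by apply: continuous_subspaceT; exact: continuous_sin.
move: E; rewrite sin0 !subr0 => ->.
have : 1 / 2 <= cos c.
  move: cin; rewrite in_itv/= => /andP[c0' cx].
  apply: le_trans (ltW c2) _.
  have [->//|ne] := eqVneq c x.
  by apply/ltW; rewrite ltr_cos ?in_itv/= ?lt_neqAle ?ne//; lra.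
move=> H; rewrite mulrC ler_wpM2r //; apply: le_trans H.
by rewrite div1r lef_pV2 ?posrE.
Qed.

Lemma norm_sin_pi_ge z : `|z| <= 1 / 2 -> `|z| <= `|sin (pi * z)|.
Proof.
have pi0 : 0 < pi :> R by exact: pi_gt0.
wlog z0 : z / 0 <= z.
  move=> H; case: (leP 0 z) => [|/ltW] z0 zh; first exact: H.
  by rewrite -normrN -[X in _ <= X]normrN -sinN -mulrN; apply: H; rewrite ?normrN// oppr_ge0.
move=> zh; rewrite (ger0_norm z0) in zh *.
have H := @sin_ge_linear (pi * z).
have : pi * z / pi <= sin (pi * z) by apply: H; nra.
by rewrite mulrAC divff ?gt_eqF// mul1r => /le_trans -> //; rewrite ler_norm.
Qed.

Lemma norm_sin_pi_le z (m : int) : `|sin (pi * z)| <= pi * `|z - m%:~R|.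
Proof.
have -> : pi * z = pi * (z - m%:~R) + m%:~R * pi by lra.
rewrite sinDint.
have [] := sin_cos_lipschitz (pi * (z - m%:~R)) 0.
by rewrite sin0 !subr0 normrM (ger0_norm (@pi_ge0 R)).
Qed.

Definition nearint x : int := Num.floor (x + 1 / 2).

Lemma nearintP x : `|x - (nearint x)%:~R| <= 1 / 2.
Proof.
have /andP[] := real_floor_itv (num_real (x + 1 / 2)).
rewrite -/(nearint x) intrD => H1 H2.
by rewrite ler_norml; move: H1 H2; rewrite ?intrD /=; lra.
Qed.

Lemma norm_sin_nearint z : `|z - (nearint z)%:~R| <= `|sin (pi * z)|.
Proof.
apply: le_trans (norm_sin_pi_ge (nearintP z)) _.
have -> : pi * (z - (nearint z)%:~R) = pi * z + (- nearint z)%:~R * pi.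
  by rewrite mulrNz; lra.
by rewrite sinDint.
Qed.

(** Pigeonhole on the fractional parts of 0, b, ..., Qb; dividing the resulting fraction by
    its gcd keeps the bound. *)
Lemma dirichlet b (Q : nat) : (0 < Q)%N ->
  exists q : nat, exists p : int,
    [/\ (0 < q <= Q)%N, coprime q `|p|%N & `|q%:R * b - p%:~R| < Q%:R^-1].
Proof.
move=> Q0; have QR : 0 < Q%:R :> R by rewrite ltr0n.
pose fr (j : nat) : R := j%:R * b - (Num.floor (j%:R * b))%:~R.
have fr01 j : 0 <= fr j < 1.
  have /andP[] := real_floor_itv (num_real (j%:R * b)).
  by rewrite intrD /fr => H1 H2; apply/andP; split; lra.
have cellP j : (Num.truncn (fr j * Q%:R) < Q)%N.
  have /andP[f0 f1] := fr01 j.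
  rewrite -(ltr_nat R); apply: le_lt_trans (_ : fr j * Q%:R < _); last first.
    by rewrite -[ltRHS]mul1r ltr_pM2r.
  by rewrite truncn_le mulr_ge0// ltW.
pose f (j : 'I_Q.+1) : 'I_Q := Ordinal (cellP j).
have /injectivePn[i [j ij fij]] : ~~ injectiveb f.
  apply/negP => /injectiveP /leq_card; by rewrite !card_ord ltnn.
have [q0 [p0 [q0Q H0]]] : exists q : nat, exists p : int,
    (0 < q <= Q)%N /\ `|q%:R * b - p%:~R| < Q%:R^-1.
  wlog lij : i j ij fij / (i < j)%N.
    move=> H; move: (ij); rewrite -val_eqE /= neq_ltn => /orP[] l.
      exact: (H i j).
    by apply: (H j i) => //; rewrite eq_sym.
  exists (j - i)%N, (Num.floor (j%:R * b) - Num.floor (i%:R * b)); split.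
    by have := ltn_ord j; lia.
  rewrite natrB 1?ltnW// intrB.
  have -> : (j%:R - i%:R) * b - ((Num.floor (j%:R * b))%:~R - (Num.floor (i%:R * b))%:~R)
    = fr j - fr i by rewrite /fr; lra.
  have /(congr1 val) /= E := fij.
  have /andP[fi0 _] := fr01 i; have /andP[fj0 _] := fr01 j.
  have /andP[a1 a2] := truncn_itv (mulr_ge0 fi0 (ltW QR)).
  have /andP[b1 b2] := truncn_itv (mulr_ge0 fj0 (ltW QR)).
  move: b1 b2; rewrite -E => b1 b2.
  rewrite -natr1 in a2 b2.
  rewrite -(ltr_pM2r QR) mulVf ?gt_eqF// -[X in _ * X](gtr0_norm QR) -normrM.
  by rewrite ltr_norml; nra.
have g0 : (0 < gcdn q0 `|p0|)%N by rewrite gcdn_gt0; case/andP: q0Q => ->.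
pose g := gcdn q0 `|p0|.
have gq : (g %| q0)%N by exact: dvdn_gcdl.
have gp : (g %| `|p0|)%N by exact: dvdn_gcdr.
exists (q0 %/ g)%N, (p0 %/ g)%Z; split.
- case/andP: q0Q => q01 q02; rewrite divn_gt0// dvdn_leq//=.
  by apply: leq_trans q02; exact: leq_div.
- have -> : `|(p0 %/ g)%Z|%N = (`|p0| %/ g)%N.
    apply/eqP; rewrite -(eqn_pmul2r g0) divnK//.
    by rewrite -[X in (_ * X)%N]/(`|g%:Z|%N) -abszM divzK.
  rewrite /coprime -(eqn_pmul2r g0) mul1n muln_gcdl !divnK//.
- have gR : 1 <= g%:R :> R by rewrite ler1n.
  have qE : q0%:R = (q0 %/ g)%:R * g%:R :> R by rewrite -natrM divnK.
  have pE : p0%:~R = (p0 %/ g)%Z%:~R * g%:R :> R.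
    by rewrite -[g%:R]/((g%:Z)%:~R) -intrM divzK.
  apply: le_lt_trans H0.
  rewrite qE pE; set x := _%:R * b; set y := _%:~R.
  have -> : (q0 %/ g)%:R * g%:R * b - (p0 %/ g)%Z%:~R * g%:R
     = ((q0 %/ g)%:R * b - (p0 %/ g)%Z%:~R) * g%:R by lra.
  by rewrite normrM (ger0_norm (ler0n _ _)) ler_peMr.
Qed.

(** As p/q is reduced and d < q, the fraction d p / q stays at distance 1/q from the
    integers; replacing p/q by b moves it by at most d / (q Q) <= 1 / (2q). *)
Lemma separation b (Q q : nat) (p : int) (d : nat) (m : int) :
  (0 < q <= Q)%N -> coprime q `|p|%N -> `|q%:R * b - p%:~R| < Q%:R^-1 ->
  (0 < d)%N -> (d.*2 <= q)%N -> (2 * q%:R)^-1 <= `|d%:R * b - m%:~R|.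
Proof.
move=> /andP[q0 qQ] cop Hb d0 dq.
have QR : 0 < Q%:R :> R by rewrite ltr0n; lia.
have qR : 0 < q%:R :> R by rewrite ltr0n.
have nz : d%:Z * p - m * q%:Z != 0.
  apply/negP; rewrite subr_eq0 => /eqP E.
  have : (q %| d * `|p|)%N.
    have /(congr1 absz) := E; rewrite !abszM /= => ->.
    by rewrite dvdn_mull.
  rewrite Gauss_dvdl// => /dvdn_leq; lia.
have ge1 : 1 <= `|(d%:Z * p - m * q%:Z)%:~R| :> R.
  by rewrite -intr_norm -[1]/(1%:~R) ler_int; lia.
have dQ : d%:R * Q%:R^-1 <= 1 / 2 :> R.
  rewrite ler_pdivrMr//.
  have : (d.*2%:R <= Q%:R :> R) by rewrite ler_nat; lia.
  rewrite -mul2n natrM; lra.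
rewrite -(ler_pM2r qR) invfM -mulrA mulVf ?gt_eqF// mulr1.
rewrite -[X in _ * X](gtr0_norm qR) -normrM.
have -> : (d%:R * b - m%:~R) * q%:R =
   (d%:Z * p - m * q%:Z)%:~R - d%:R * (p%:~R - q%:R * b).
  rewrite intrB !intrM -![_%:Z%:~R]/(_%:R); lra.
have := lerB_dist (d%:Z * p - m * q%:Z)%:~R (d%:R * (p%:~R - q%:R * b)).
rewrite [X in _ - X]normrM (ger0_norm (ler0n _ _)) (distrC p%:~R).
have : d%:R * `|q%:R * b - p%:~R| <= d%:R * Q%:R^-1.
  by apply: ler_wpM2l => //; exact: ltW.
lra.
Qed.

(** A Dirichlet step s = qb - p with 0 < |s| <= eta visits every point of the circle up to
    eta within 1/|s| multiples, which makes the return time uniform in x. *)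
Lemma rotation_dense b eta :
  (forall (q : nat) (p : int), (0 < q)%N -> q%:R * b != p%:~R) -> 0 < eta ->
  exists N : nat, forall x, exists n : nat, exists m : int,
    (n <= N)%N /\ `|x - n%:R * b - m%:~R| <= eta.
Proof.
move=> irr eta0.
have [Q Q0 HQ] : exists2 Q : nat, (0 < Q)%N & Q%:R^-1 <= eta.
  exists (Num.truncn eta^-1).+1 => //.
  rewrite invf_ple ?posrE ?invr_gt0// ?ltr0n//.
  by apply/ltW; exact: truncnS_gt.
have [q [p [/andP[q0 _] _ Hb]]] := dirichlet b Q0.
set s : R := q%:R * b - p%:~R in Hb.
have s0 : s != 0 by rewrite subr_eq0 irr.
have ns0 : 0 < `|s| by rewrite normr_gt0.
pose N := Num.truncn `|s|^-1.
exists (N * q)%N => x.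
pose z : R := if 0 < s then x - (Num.floor x)%:~R
              else x - (Num.floor x + 1)%:~R.
pose fl : int := if 0 < s then Num.floor x else Num.floor x + 1.
have zE : z = x - fl%:~R by rewrite /z /fl; case: ifP.
have /andP[fx1 fx2] := real_floor_itv (num_real x).
have /andP[zs0 zs1] : 0 <= z / s <= `|s|^-1.
  have [sp|sn] := ltP 0 s.
    rewrite gtr0_norm// divr_ge0 ?ler_pdivrMr ?mulVf//; rewrite ?(ltW sp)// zE /fl sp;
    move: fx1 fx2; rewrite intrD; lra.
  have sn' : s < 0 by rewrite lt_neqAle s0.
  rewrite ltr0_norm// invrN -[z / s]opprK -mulNr -mulrN -invrN.
  rewrite divr_ge0 ?ler_pdivrMr ?mulVf//; rewrite ?oppr_gt0 ?oppr_ge0 ?oppr_eq0 //;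
   rewrite zE /fl ltNge sn /=; move: fx1 fx2; rewrite intrD; lra.
pose j := Num.truncn (z / s).
have /andP[j1 j2] := truncn_itv zs0.
exists (j * q)%N, (fl - j%:Z * p); split.
  rewrite leq_mul2r; apply/orP; right; exact: le_truncn.
have -> : x - (j * q)%:R * b - (fl - j%:Z * p)%:~R = (z / s - j%:R) * s.
  rewrite mulrBl divfK// zE natrM intrB intrM -[j%:~R]/(j%:R) /s; lra.
rewrite normrM; apply: le_trans (_ : 1 * `|s| <= _).
  rewrite ler_pM2r// -/j in j1 j2 *; rewrite ler_norml; move: j2; rewrite -/j -natr1; lra.
by rewrite mul1r; apply: le_trans (ltW Hb) _.
Qed.

(** An elementary substitute for unique ergodicity.  The orbit of y comes within eps / (M + 1)
    of x after a bounded number of steps; comparing term by term from there costs eps n, and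
    dropping the first steps costs a constant. *)
Lemma birkhoff_sums_close (g : R -> R) M b :
  (forall x y, `|g x - g y| <= M * `|x - y|) ->
  (forall x (m : int), g (x + m%:~R) = g x) ->
  (forall (q : nat) (p : int), (0 < q)%N -> q%:R * b != p%:~R) ->
  forall eps, 0 < eps -> exists C, forall (n : nat) x y,
    \sum_(j < n) g (x + j%:R * b) - \sum_(j < n) g (y + j%:R * b) <= eps * n%:R + C.
Proof.
move=> lip per irr eps eps0.
have M0 : 0 <= M.
  by have := lip 1 0; rewrite subr0 normr1 mulr1; apply: le_trans.
have osc x y : g x - g y <= M.
  have -> : g x = g (x + (- Num.floor (x - y))%:~R) by rewrite per.
  apply: le_trans (ler_norm _) _; apply: le_trans (lip _ _) _.
  rewrite ler_piMr//.
  have /andP[] := real_floor_itv (num_real (x - y)).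
  rewrite intrD => h1 h2; rewrite ler_norml rmorphN /=; lra.
have [N HN] := rotation_dense irr (divr_gt0 eps0 (ltr_wpDl M0 ltr01)).
exists (N%:R * M) => n x y.
have [s [m [sN Hs]]] := HN (x - y).
have shift (t : nat) : \sum_(j < n) g (y + (t + j)%:R * b) - \sum_(j < n) g (y + j%:R * b)
    <= t%:R * M.
  elim: t => [|t IH].
    by rewrite mul0r subr_le0; apply: ler_sum => i _; rewrite add0n.
  have : \sum_(j < n) g (y + (t.+1 + j)%:R * b) - \sum_(j < n) g (y + (t + j)%:R * b) <= M.
    rewrite -sumrB.
    rewrite (eq_bigr (fun i : 'I_n => g (y + (t + i.+1)%:R * b) - g (y + (t + i)%:R * b)));
      last by move=> i _; rewrite addSnnS.
    rewrite -(big_mkord xpredT (fun i => g (y + (t + i.+1)%:R * b) - g (y + (t + i)%:R * b))).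
    by rewrite (telescope_sumr (fun i => g (y + (t + i)%:R * b))).
  rewrite -natr1; lra.
have : \sum_(j < n) g (x + j%:R * b) - \sum_(j < n) g (y + (s + j)%:R * b) <= eps * n%:R.
  rewrite -sumrB; apply: le_trans (_ : \sum_(j < n) eps <= _); last first.
    by rewrite sumr_const card_ord mulr_natr.
  apply: ler_sum => j _; rewrite -(per (y + _) m).
  apply: le_trans (ler_norm _) _; apply: le_trans (lip _ _) _.
  have -> : x + j%:R * b - (y + (s + j)%:R * b + m%:~R) = x - y - s%:R * b - m%:~R.
    rewrite natrD; lra.
  apply: le_trans (ler_wpM2l M0 Hs) _.
  rewrite mulrCA ler_piMr ?(ltW eps0)// ler_pdivrMr; lra.
have := shift s.
have : s%:R * M <= N%:R * M by rewrite ler_wpM2r// ler_nat.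
lra.
Qed.

(** Orbit points at times less than q/2 apart are 1/(2q)-separated by [separation].  So
    a point is determined by its block of times of length q/2 and by the cell of length
    1/(2q) of the interval of radius tau that contains it. *)
Lemma count_near_zero b (Q q : nat) (p : int) (len : nat) x tau :
  (1 < q <= Q)%N -> coprime q `|p|%N -> `|q%:R * b - p%:~R| < Q%:R^-1 -> 0 <= tau ->
  (\sum_(j < len) (`|sin (pi * (x + j%:R * b))| < tau)%R
    <= (len %/ q./2).+1 * (Num.truncn (4 * q%:R * tau)).+1)%N.
Proof.
move=> /andP[q1 qQ] cop Hb tau0.
have qR : 0 < q%:R :> R by rewrite ltr0n; lia.
pose z (j : nat) : R := x + j%:R * b - (nearint (x + j%:R * b))%:~R.
pose P (j : 'I_len) := `|sin (pi * (x + j%:R * b))| < tau.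
have zP j : P j -> `|z j| < tau.
  by move=> Pj; apply: le_lt_trans Pj; exact: norm_sin_nearint.
pose f (j : 'I_len) : 'I_(len %/ q./2).+1 * 'I_(Num.truncn (4 * q%:R * tau)).+1 :=
  (inord (j %/ q./2), inord (Num.truncn (2 * q%:R * (z j + tau)))).
rewrite -(@big_mkcond _ _ _ _ _ P (fun=> 1%N)) /= sum1dep_card.
rewrite -[leqRHS](_ : #|{: 'I_(len %/ q./2).+1 * 'I_(Num.truncn (4 * q%:R * tau)).+1}| = _);
  last by rewrite card_prod !card_ord.
rewrite -cardsE -(card_in_imset (f := f)); first exact: max_card.
move=> i j; rewrite !inE => Pi Pj [/(congr1 val) + /(congr1 val)].
have zr (k : 'I_len) : P k -> 0 <= 2 * q%:R * (z k + tau) <= 4 * q%:R * tau.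
  by move=> /zP; rewrite ltr_norml => /andP[z1 z2]; apply/andP; split; nra.
have kb (k : 'I_len) : (k %/ q./2 < (len %/ q./2).+1)%N.
  by rewrite ltnS leq_div2r// ltnW.
have zb (k : 'I_len) : P k ->
   (Num.truncn (2 * q%:R * (z k + tau)) < (Num.truncn (4 * q%:R * tau)).+1)%N.
  by move=> /zr /andP[_ H]; rewrite ltnS; exact: le_truncn.
rewrite /= !inordK ?kb ?zb// => E1 E2.
have /andP[i1 i2] := truncn_itv (proj1 (andP (zr _ Pi))).
have /andP[j1 j2] := truncn_itv (proj1 (andP (zr _ Pj))).
rewrite -E2 in j1 j2.
have H : `|z j - z i| < (2 * q%:R)^-1.
  rewrite -[ltRHS]mul1r ltr_pdivlMr ?mulr_gt0//.
  rewrite -[X in _ * X]gtr0_norm ?mulr_gt0// -normrM ltr_norml.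
  by move: i2 j2; rewrite -[X in _ < X -> _]natr1 -[X in _ -> _ < X -> _]natr1; nra.
have h0 : (0 < q./2)%N by rewrite half_gt0.
apply/val_inj/eqP; apply/negPn/negP => ne.
wlog lij : i j ne E1 H {Pi Pj E2 i1 i2 j1 j2} / (i < j)%N.
  move=> W; move: (ne); rewrite neq_ltn => /orP[] l; first exact: (W i j).
  by apply: (W j i) => //; rewrite 1?eq_sym// distrC.
have d0 : (0 < j - i)%N by rewrite subn_gt0.
have dq : ((j - i).*2 <= q)%N.
  have := divn_eq i q./2; have := divn_eq j q./2; rewrite -E1.
  have := ltn_pmod i h0; have := ltn_pmod j h0.
  have := odd_double_half q; lia.
have := separation (nearint (x + j%:R * b) - nearint (x + i%:R * b)) _ cop Hb d0 dq.
rewrite qQ (ltnW q1) => /(_ isT); rewrite leNgt => /negP; apply.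
have -> : (j - i)%:R * b - (nearint (x + j%:R * b) - nearint (x + i%:R * b))%:~R
  = z j - z i by rewrite natrB 1?ltnW// intrB /z; lra.
exact: H.
Qed.

End Trig.

(** * Lagrange weights at points of the circle *)
Section Nodes.
Context {R : realType}.
Implicit Types (x y z t b eta tau : R).

(** The truncation makes the logarithm Lipschitz, so that [birkhoff_sums_close] applies. *)
Definition clip (d x : R) : R := Num.max `|sin (pi * x)| d.

Lemma clip_itv d x : d <= 1 -> d <= clip d x <= 1.
Proof. by move=> d1; rewrite /clip le_max lexx orbT ge_max sin_max. Qed.

Lemma clip_gt0 d x : 0 < d -> 0 < clip d x.
Proof. by move=> d0; rewrite /clip lt_max d0 orbT. Qed.

Lemma ln_lipschitz d x y : 0 < d -> d <= x -> d <= y -> `|ln x - ln y| <= `|x - y| / d.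
Proof.
move=> d0; wlog xy : x y / y <= x.
  move=> H; case: (leP y x) => [|/ltW] xy dx dy; first exact: H.
  by rewrite distrC [`|x - y|]distrC; apply: H.
move=> dx dy; have x0 : 0 < x by exact: lt_le_trans dx.
have y0 : 0 < y by exact: lt_le_trans dy.
rewrite !ger0_norm ?subr_ge0 ?ler_ln//.
rewrite -ln_div//; apply: le_trans (_ : (x - y) / y <= _); last first.
  by apply: ler_wpM2l; rewrite ?subr_ge0// lef_pV2.
have -> : x / y = 1 + (x - y) / y by field; rewrite gt_eqF.
by apply: le_ln1Dx; apply: lt_le_trans (_ : 0 <= _) => //; rewrite divr_ge0 ?subr_ge0// ltW.
Qed.

Lemma ln_clip_lipschitz d x y : 0 < d ->
  `|ln (clip d x) - ln (clip d y)| <= (pi / d) * `|x - y|.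
Proof.
move=> d0; apply: le_trans (ln_lipschitz d0 _ _) _; rewrite ?le_max ?lexx ?orbT//.
rewrite mulrAC ler_pM2r ?invr_gt0//.
have [+ _] := sin_cos_lipschitz (pi * x) (pi * y).
rewrite -mulrBr normrM ger0_norm ?pi_ge0//; apply: le_trans.
apply: le_trans (ler_dist_dist _ _).
rewrite /clip; set a := `|sin _|; set c := `|sin _|.
by rewrite !maxEle; do 2?case: ifPn; rewrite -?ltNge => h1 h2;
  rewrite ?subrr ?normr0//; rewrite ler_norml; apply/andP; split; have := ler_norm (a - c);
  have := ler_norm (c - a); rewrite (distrC c); lra.
Qed.

Lemma clip_period d x (m : int) : clip d (x + m%:~R) = clip d x.
Proof. by rewrite /clip mulrDr [pi * m%:~R]mulrC sinDint. Qed.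

(** Binary logarithm, rounded up, of the factor by which |sin pi x| lies below d, capped at I.
    Writing it as a sum of indicators lets its orbit sums be counted level by level. *)
Definition excess (d : R) (I : nat) (x : R) : nat :=
  (\sum_(i < I) (`|sin (pi * x)| < d / 2 ^+ i)%R)%N.

Lemma excessP d I x : 0 < d -> d / 2 ^+ I <= `|sin (pi * x)| ->
  clip d x <= `|sin (pi * x)| * 2 ^+ excess d I x.
Proof.
move=> d0; rewrite /clip /excess; set s := `|_|.
have s0 : 0 <= s by exact: normr_ge0.
elim: I => [|I IH].
  by rewrite expr0 divr1 => ds; rewrite big_ord0 expr0 mulr1 ge_max lexx.
have [H _|H Hs] := leP (d / 2 ^+ I) s.
  apply: le_trans (IH H) _; rewrite big_ord_recr /= exprD mulrA.
  by rewrite ler_peMr ?mulr_ge0 ?exprn_ge0// exprn_ege1// ler1n.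
have -> : (\sum_(i < I.+1) (s < d / 2 ^+ i)%R = I.+1)%N.
  rewrite -[RHS]muln1 -[in RHS](card_ord I.+1) -sum_nat_const.
  apply: eq_bigr => i _; apply/eqP; rewrite eqb1.
  apply: lt_le_trans H _; rewrite ler_pM2l// lef_pV2 ?posrE ?exprn_gt0//.
  by rewrite ler_weXn2l ?ler1n// -ltnS.
rewrite ge_max; apply/andP; split.
  by rewrite ler_peMr// exprn_ege1// ler1n.
by move: Hs; rewrite ler_pdivrMr ?exprn_gt0.
Qed.

Lemma sum_pow_half (I : nat) : \sum_(i < I) (2 ^+ i)^-1 <= 2 :> R.
Proof.
suff : \sum_(i < I) (2 ^+ i)^-1 = 2 - 2 / 2 ^+ I :> R.
  by move=> ->; rewrite gerBl divr_ge0// exprn_ge0.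
elim: I => [|I IH]; first by rewrite big_ord0 expr0; lra.
rewrite big_ord_recr /= IH exprS invfM; set y := (2 ^+ I)^-1; lra.
Qed.

(** Level i contributes at most 1 + 4 q d / 2^i points per block of length q/2, by
    [count_near_zero]; the sum over i is geometric. *)
Lemma sum_excess b (Q q : nat) (p : int) (len I : nat) x d :
  (1 < q <= Q)%N -> coprime q `|p|%N -> `|q%:R * b - p%:~R| < Q%:R^-1 -> 0 < d ->
  (\sum_(j < len) excess d I (x + j%:R * b))%:R
    <= (len %/ q./2).+1%:R * (I%:R + 8 * q%:R * d).
Proof.
move=> qQ cop Hb d0; rewrite /excess exchange_big /= natr_sum.
apply: le_trans (_ : \sum_(i < I) (len %/ q./2).+1%:R * (1 + 4 * q%:R * (d / 2 ^+ i)) <= _).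
  apply: ler_sum => i _.
  have t0 : 0 <= d / 2 ^+ i by rewrite divr_ge0 ?exprn_ge0// ltW.
  apply: le_trans (_ : ((len %/ q./2).+1 * (Num.truncn (4 * q%:R * (d / 2 ^+ i))).+1)%:R <= _).
    by rewrite ler_nat; apply: count_near_zero qQ cop Hb t0.
  rewrite natrM ler_wpM2l// -natr1 addrC lerD2l.
  by rewrite truncn_le mulr_ge0// mulr_ge0.
rewrite -mulr_sumr ler_wpM2l// big_split /= sumr_const card_ord lerD2l.
rewrite (eq_bigr (fun i : 'I_I => (4 * q%:R * d) * (2 ^+ i)^-1)); last by move=> i _; rewrite mulrA.
rewrite -mulr_sumr; have := sum_pow_half I.
have : 0 <= 4 * q%:R * d by rewrite !mulr_ge0// ltW.
nra.
Qed.

Lemma cos2piB x y :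
  `|cos (2 * pi * x) - cos (2 * pi * y)| = 2 * (`|sin (pi * (y - x))| * `|sin (pi * (y + x))|).
Proof.
have -> : 2 * pi * x = pi * (y + x) - pi * (y - x) by lra.
have -> : 2 * pi * y = pi * (y + x) + pi * (y - x) by lra.
rewrite cosB cosD; set s := sin _; set s' := sin _; set c := cos _; set c' := cos _.
have -> : c * c' + s * s' - (c * c' - s * s') = 2 * (s' * s) by lra.
by rewrite !normrM ger0_norm.
Qed.

(** By [cos2piB] both sides split into sines.  Above, truncation only increases them; below,
    [excessP] says how much the truncation lost. *)
Lemma lagrange_factor d I (y ti tl : R) : 0 < d ->
  d / 2 ^+ I <= `|sin (pi * (tl - ti))| -> d / 2 ^+ I <= `|sin (pi * (tl + ti))| ->
  `|cos (2 * pi * y) - cos (2 * pi * tl)| <=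
  `|cos (2 * pi * ti) - cos (2 * pi * tl)| *
   expR ((ln (clip d (tl - y)) - ln (clip d (tl - ti)))
       + (ln (clip d (tl + y)) - ln (clip d (tl + ti)))
       + ln 2 * (excess d I (tl - ti) + excess d I (tl + ti))%:R).
Proof.
move=> d0 H1 H2; rewrite !cos2piB -mulrA ler_pM2l//.
have c0 x : 0 < clip d x by exact: clip_gt0.
rewrite !expRD !expRN !lnK ?posrE//.
rewrite expRM lnK ?posrE// powR_mulrn// exprD.
have E1 := excessP d0 H1; have E2 := excessP d0 H2.
set A := `|sin (pi * (tl - y))|; set B := `|sin (pi * (tl + y))|.
have HA : A <= clip d (tl - y) by rewrite /clip le_max lexx.
have HB : B <= clip d (tl + y) by rewrite /clip le_max lexx.
set u := clip d (tl - ti) in E1 *; set w := clip d (tl + ti) in E2 *.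
have u0 : 0 < u := c0 _; have w0 : 0 < w := c0 _.
set e1 := excess _ _ _ in E1 *; set e2 := excess _ _ _ in E2 *.
set s1 := `|sin (pi * (tl - ti))| in E1 *; set s2 := `|sin (pi * (tl + ti))| in E2 *.
apply: (@le_trans _ _ (clip d (tl - y) * clip d (tl + y))).
  by rewrite ler_pM// ?normr_ge0.
rewrite [leRHS](_ : _ = (clip d (tl - y) * clip d (tl + y)) *
    ((s1 * 2 ^+ e1 / u) * (s2 * 2 ^+ e2 / w))); last by field; rewrite !gt_eqF.
rewrite ler_peMr//; first by rewrite mulr_ge0// ltW.
by rewrite mulr_ege1// ler_pdivlMr// mul1r.
Qed.

(** The sums on the right run over all l, so that they are full orbit sums; the four terms
    l = i that this adds account for the term - 2 ln d. *)
Lemma lagrange_product (n : nat) (t : 'I_n -> R) (d : R) I (i : 'I_n) y :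
  0 < d -> d <= 1 ->
  (forall l, l != i -> d / 2 ^+ I <= `|sin (pi * (t l - t i))|) ->
  (forall l, l != i -> d / 2 ^+ I <= `|sin (pi * (t l + t i))|) ->
  \prod_(l < n | l != i) `|cos (2 * pi * y) - cos (2 * pi * t l)| <=
  \prod_(l < n | l != i) `|cos (2 * pi * t i) - cos (2 * pi * t l)| *
   expR ((\sum_(l < n) ln (clip d (t l - y)) - \sum_(l < n) ln (clip d (t l - t i)))
       + (\sum_(l < n) ln (clip d (t l + y)) - \sum_(l < n) ln (clip d (t l + t i)))
       - 2 * ln d
       + ln 2 * ((\sum_(l < n) excess d I (t l - t i))%N%:R
             + (\sum_(l < n) excess d I (t l + t i))%N%:R)).
Proof.
move=> d0 d1 H1 H2.
have lnc x : ln d <= ln (clip d x) <= 0.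
  have /andP[c1 c2] := clip_itv x d1.
  by rewrite ler_ln ?posrE ?clip_gt0// c1 ln_le0.
apply: (@le_trans _ _ (\prod_(l < n | l != i) (`|cos (2 * pi * t i) - cos (2 * pi * t l)| *
   expR ((ln (clip d (t l - y)) - ln (clip d (t l - t i)))
       + (ln (clip d (t l + y)) - ln (clip d (t l + t i)))
       + ln 2 * (excess d I (t l - t i) + excess d I (t l + t i))%:R)))).
  apply: ler_prod => l li; rewrite normr_ge0 /=.
  exact: (lagrange_factor y d0 (H1 _ li) (H2 _ li)).
rewrite big_split /=; apply: ler_wpM2l; first by apply: prodr_ge0.
rewrite -expR_sum ler_expR !big_split /= -!mulr_sumr.
rewrite !sumrN -natr_sum [in leRHS](bigD1 i)//= [X in _ - X + _ - _ + _](bigD1 i)//=.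
rewrite [X in _ + (X - _) - _ + _](bigD1 i)//= [X in _ + (_ - X) - _ + _](bigD1 i)//=.
have /andP[a1 a2] := lnc (t i - y); have /andP[b1 b2] := lnc (t i + y).
have /andP[c1 c2] := lnc (t i - t i); have /andP[e1 e2] := lnc (t i + t i).
have : (\sum_(l < n | l != i) (excess d I (t l - t i) + excess d I (t l + t i)))%N%:R <=
  (\sum_(l < n) excess d I (t l - t i))%N%:R
             + (\sum_(l < n) excess d I (t l + t i))%N%:R :> R.
  rewrite -natrD ler_nat -big_split /= [leqRHS](bigD1 i)//= leq_addl//.
have : 0 <= ln 2 :> R by rewrite ln_ge0// ler1n.
move=> l2 XY; have := ler_wpM2l l2 XY.
lra.
Qed.

Lemma lagrange_interpolation (n : nat) (P : {poly R}) (x : 'I_n -> R) y :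
  (size P <= n)%N -> injective x ->
  P.[y] = \sum_(i < n) P.[x i] * \prod_(l < n | l != i) ((y - x l) / (x i - x l)).
Proof.
move=> sP inj.
pose L i := \prod_(l < n | l != i) ((x i - x l)^-1 *: ('X - (x l)%:P)).
pose S := \sum_(i < n) P.[x i] *: L i.
have LE i z : (L i).[z] = \prod_(l < n | l != i) ((z - x l) / (x i - x l)).
  by rewrite horner_prod; apply: eq_bigr => l _; rewrite hornerZ !hornerE mulrC.
have Lii i : (L i).[x i] = 1.
  rewrite LE; apply: big1 => l li; rewrite divff// subr_eq0.
  by apply: contraNneq li => /inj ->.
have Lij i j : j != i -> (L i).[x j] = 0.
  by move=> ji; rewrite LE (bigD1 j)//= subrr mul0r mul0r.
have sL i : (size (L i) <= n)%N.
  rewrite /L scaler_prod; apply: leq_trans (size_scale_leq _ _) _.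
  rewrite size_prod; last by move=> l _; rewrite -size_poly_eq0 size_XsubC.
  rewrite (eq_bigr (fun=> 2%N)); last by move=> l _; rewrite size_XsubC.
  have -> : #|(fun l : 'I_n => l != i)| = n.-1.
    by rewrite -[in RHS](card_ord n) -(cardC1 i); apply: eq_card.
  have -> : (\sum_(l < n | l != i) 2 = n.-1 * 2)%N.
    by rewrite -[in RHS](card_ord n) -(cardC1 i) -sum_nat_const; apply: eq_bigl.
  have := ltn_ord i; lia.
suff E : P = S.
  by rewrite {1}E /S horner_sum; apply: eq_bigr => i _; rewrite hornerZ LE.
apply/eqP; rewrite -subr_eq0; apply/negPn/negP => nz.
have rts : all (root (P - S)) (map x (enum 'I_n)).
  apply/allP => _ /mapP[j _ ->]; rewrite rootE hornerD hornerN horner_sum.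
  rewrite (bigD1 j)//= hornerZ Lii mulr1 big1 ?addr0 ?subrr//.
  by move=> i ij; rewrite hornerZ Lij 1?eq_sym// mulr0.
have := max_poly_roots nz rts; rewrite map_inj_uniq// enum_uniq => /(_ isT).
rewrite size_map size_enum_ord ltnNge; apply/negP/negPn.
rewrite (leq_trans (size_polyD _ _))// geq_max sP size_polyN.
by rewrite (leq_trans (size_sum _ _ _))//; apply/bigmax_leqP => i _;
  rewrite (leq_trans (size_scale_leq _ _)).
Qed.

End Nodes.

(** * Interpolation nodes along a Diophantine rotation *)
Section Diophantine.
Context {R : realType}.
Variables (c r b : R).
Hypothesis D : diophantine c r b.

Lemma diophantine_gt0 : 0 < c. Proof. by case: D. Qed.
Lemma diophantine_gt1 : 1 < r. Proof. by case: D. Qed.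

Lemma diophantine_irr (q : nat) (p : int) : (0 < q)%N -> q%:R * b != p%:~R.
Proof.
move=> q0; case: D => _ c0 r1 /(_ q%:Z); rewrite -lt0n q0 => /(_ isT) H.
apply/negP => /eqP E; move: H; rewrite -[q%:~R]/(q%:R) E.
have := norm_sin_pi_le (2 * p%:~R : R) (p + p).
have -> : 2 * p%:~R - (p + p)%:~R = 0 :> R by rewrite intrD; lra.
rewrite normr0 mulr0 [pi * _]mulrCA mulrA => h1 h2; have := lt_le_trans h2 h1.
by rewrite ltNge divr_ge0 ?powR_ge0// ltW.
Qed.

(** Dirichlet gives a denominator q <= w, and the Diophantine condition forbids it to be
    much smaller than w^(1/r). *)
Lemma good_denominator : exists2 C : R, 0 < C & forall w : nat, (0 < w)%N ->
  exists q : nat, exists p : int,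
  [/\ (0 < q <= w)%N, coprime q `|p|%N, `|q%:R * b - p%:~R| < w%:R^-1 &
     (60 * w%:R) `^ r^-1 <= C * q%:R].
Proof.
case: D => _ c0 r1 H.
have r0 : 0 < r by apply: lt_trans r1.
have pi0 : 0 < pi :> R by exact: pi_gt0.
exists (((12 * 10) * pi / c) `^ r^-1); first by rewrite powR_gt0 // divr_gt0// mulr_gt0.
move=> w w0; have [q [p [qw cop Hb]]] := dirichlet b w0.
exists q, p; split => //.
have q0 : (0 < q)%N by case/andP: qw.
have qR : 0 < q%:R :> R by rewrite ltr0n.
have wR : 0 < w%:R :> R by rewrite ltr0n.
have P0 : 0 < q%:R `^ r :> R by rewrite powR_gt0.
suff key : 60 * w%:R <= (12 * 10) * pi / c * q%:R `^ r.
  have K0 : 0 <= (12 * 10) * pi / c by rewrite ltW// divr_gt0// mulr_gt0.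
  have -> : q%:R = (q%:R `^ r) `^ r^-1 :> R.
    by rewrite -powRrM divff ?gt_eqF// powRr1.
  rewrite -powRM ?powR_ge0//.
  apply: ge0_ler_powR => //; first by rewrite invr_ge0 ltW.
    by rewrite nnegrE mulr_ge0.
  by rewrite nnegrE mulr_ge0// powR_ge0.
(* The Diophantine condition at n = q, where |sin 2 pi q b| < 2 pi / w. *)
have := H q%:Z; rewrite -lt0n q0 => /(_ isT).
have := norm_sin_pi_le (2 * (q%:R * b)) (p + p).
have -> : 2 * (q%:R * b) - (p + p)%:~R = 2 * (q%:R * b - p%:~R) by rewrite intrD; lra.
have -> : pi * (2 * (q%:R * b)) = 2 * pi * (q%:R * b) by ring.
rewrite normrM [`|2|]ger0_norm// -[`|q|%N%:R]/(q%:R) -[q%:~R]/(q%:R : R).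
set s := `|sin _|; set Y := _ `^ r in P0 * => Hs1.
rewrite ltr_pdivrMr// => Hs2.
have Hs3 : s * w%:R < 2 * pi.
  have : w%:R * `|q%:R * b - p%:~R| < 1 by rewrite mulrC -ltr_pdivlMr// div1r.
  nra.
rewrite mulrAC ler_pdivlMr//.
nra.
Qed.

Lemma half_ge_third (q : nat) : (1 < q)%N -> (q <= 3 * q./2)%N.
Proof. by have := odd_double_half q; lia. Qed.

Definition block_angle (l1 : nat) (t1 t2 : R) (l : nat) : R :=
  if (l < l1)%N then t1 + l%:R * b else t2 + (l - l1)%:R * b.

Lemma sum_block_angle (V : nmodType) (F : R -> V) l1 l2 t1 t2 :
  \sum_(l < l1 + l2) F (block_angle l1 t1 t2 l) =
  \sum_(l < l1) F (t1 + l%:R * b) + \sum_(l < l2) F (t2 + l%:R * b).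
Proof.
rewrite big_split_ord /=; congr (_ + _); apply: eq_bigr => i _.
  by rewrite /block_angle ltn_ord.
by rewrite /block_angle ltnNge leq_addr /= addKn.
Qed.

(** Subexponential growth of the Lagrange weights.  By [lagrange_product] the logarithm of
    the ratio is made of differences of Birkhoff sums of ln (clip d), which
    [birkhoff_sums_close] bounds, and of total excesses.  The latter are at most of order
    (w / q) (I + q d) for a denominator q <= w; with X = (60 w)^(1/(2r)), the separation
    exp(-X) allows I of order X, while q is at least of order X^2 by [good_denominator],
    so that w I / q and w d are both small compared with w. *)
Lemma node_product eps : 0 < eps -> exists w0 : nat, forall w l1 l2 : nat,
  (w0 <= w)%N -> (l1 + l2 <= 20 * w + 1)%N ->
  forall (t1 t2 y : R) (i : 'I_(l1 + l2)),
  let t := block_angle l1 t1 t2 in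
  let s := expR (- (60 * w%:R) `^ (2 * r)^-1) in
  (forall l : 'I_(l1 + l2), l != i -> s <= `|sin (pi * (t l - t i))|) ->
  (forall l : 'I_(l1 + l2), l != i -> s <= `|sin (pi * (t l + t i))|) ->
  \prod_(l < l1 + l2 | l != i) `|cos (2 * pi * y) - cos (2 * pi * t l)| <=
  \prod_(l < l1 + l2 | l != i) `|cos (2 * pi * t i) - cos (2 * pi * t l)| * expR (eps * w%:R).
Proof.
move=> eps0; have r1 := diophantine_gt1.
have r0 : 0 < r by apply: lt_trans r1.
have [C C0 HC] := good_denominator.
pose d := Num.min 1 (eps / (20 * 20 * 20)).
have d0 : 0 < d by rewrite /d lt_min; lra.
have d1 : d <= 1 by rewrite /d ge_min lexx.
have d2 : d <= eps / (20 * 20 * 20) by rewrite /d ge_min lexx orbT.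
have e1 : 0 < eps / (20 * 10) by lra.
have [C1 HC1] := @birkhoff_sums_close R (fun x => ln (clip d x)) (pi / d) b
   (fun x y => ln_clip_lipschitz x y d0) (fun x m => congr1 (@ln R) (clip_period d x m))
   diophantine_irr _ e1.
(* With X >= Y0, the denominator q >= X^2 / C satisfies 2 <= q and I <= 4 X <= eps q / 1000. *)
pose Y0 := Num.max (Num.max 1 (2 * C)) ((20 * 20 * 10) * C / eps).
have Y01 : 1 <= Y0 by rewrite /Y0 !le_max lexx.
have Y02 : 2 * C <= Y0 by rewrite /Y0 !le_max lexx orbT.
have Y03 : (20 * 20 * 10) * C / eps <= Y0 by rewrite /Y0 !le_max lexx orbT.
exists (maxn 1 (maxn (Num.truncn (Y0 `^ (2 * r))).+1
   (Num.truncn (4 * (4 * C1 - 2 * ln d) / eps)).+1)) => w l1 l2.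
rewrite !geq_max => /and3P[w1 w2 w3] lw t1 t2 y i t s H1 H2.
have wR : 1 <= w%:R :> R by rewrite ler1n.
have w0 : 0 < w%:R :> R by apply: lt_le_trans wR.
set X := (60 * w%:R) `^ (2 * r)^-1 in s H1 H2 *.
have XY : Y0 <= X.
  have -> : Y0 = (Y0 `^ (2 * r)) `^ (2 * r)^-1.
    by rewrite -powRrM divff ?powRr1 ?mulf_neq0 ?gt_eqF//; lra.
  apply: ge0_ler_powR; rewrite ?nnegrE ?invr_ge0 ?powR_ge0 ?mulr_ge0 ?(ltW r0)//.
  have := truncnS_gt (Y0 `^ (2 * r)).
  have : (Num.truncn (Y0 `^ (2 * r))).+1%:R <= w%:R :> R by rewrite ler_nat.
  lra.
have Cw : 4 * C1 - 2 * ln d <= eps * w%:R / 4.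
  have := truncnS_gt (4 * (4 * C1 - 2 * ln d) / eps).
  have : (Num.truncn (4 * (4 * C1 - 2 * ln d) / eps)).+1%:R <= w%:R :> R by rewrite ler_nat.
  move=> a1 a2; have := lt_le_trans a2 a1; rewrite ltr_pdivrMr//; lra.
have [q [p [/andP[q0 qw] cop Hb]]] := HC w w1.
have -> : (60 * w%:R) `^ r^-1 = X ^+ 2.
  rewrite -powR_mulrn ?powR_ge0// -powRrM; congr (_ `^ _).
  by field; rewrite gt_eqF.
move=> Xq.
have X1 : 1 <= X by apply: le_trans XY.
have q2 : (1 < q)%N.
  rewrite -(ltr_nat R) -(ltr_pM2l C0); apply: lt_le_trans Xq; nra.
have qR : 0 < q%:R :> R by rewrite ltr0n.
(* I is chosen so that d / 2^I <= exp(-X): the two hypotheses then exclude sines below the last level. *)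
pose I := (2 * (Num.truncn X).+1)%N.
have ln2 : 1 / 2 <= ln 2 :> R.
  have := @le_ln1Dx R (- (1 / 2)) (ltac:(lra)).
  have -> : 1 - 1 / 2 = 2^-1 :> R by lra.
  rewrite lnV ?posrE//; lra.
have ln2' : ln 2 <= 1 :> R by have := @le_ln1Dx R 1 (ltac:(lra)); rewrite [1+1]/2.
have I1 : 2 * X <= I%:R.
  by rewrite /I natrM ler_pM2l//; apply/ltW; exact: truncnS_gt.
have I2 : I%:R <= 4 * X.
  rewrite /I natrM -natr1; have : (Num.truncn X)%:R <= X by rewrite truncn_le; lra.
  lra.
have Is : d / 2 ^+ I <= s.
  apply: le_trans (_ : (2 ^+ I)^-1 <= _); first by rewrite ler_piMl// invr_ge0 exprn_ge0.
  have -> : 2 ^+ I = expR (ln 2 * I%:R) :> R by rewrite expRM_natr lnK// posrE.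
  by rewrite -expRN ler_expR; nra.
have IH1 l : l != i -> d / 2 ^+ I <= `|sin (pi * (t l - t i))|.
  by move=> li; apply: le_trans Is _; exact: H1.
have IH2 l : l != i -> d / 2 ^+ I <= `|sin (pi * (t l + t i))|.
  by move=> li; apply: le_trans Is _; exact: H2.
apply: le_trans (lagrange_product (t := fun l : 'I_(l1 + l2) => t l) y d0 d1 IH1 IH2) _.
apply: ler_wpM2l; first by apply: prodr_ge0.
rewrite ler_expR.
rewrite (sum_block_angle (fun x => ln (clip d (x - y)))).
rewrite (sum_block_angle (fun x => ln (clip d (x - t i)))).
rewrite (sum_block_angle (fun x => ln (clip d (x + y)))).
rewrite (sum_block_angle (fun x => ln (clip d (x + t i)))).
rewrite (sum_block_angle (fun x => excess d I (x - t i))).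
rewrite (sum_block_angle (fun x => excess d I (x + t i))).
have bk n u x z : \sum_(l < n) ln (clip d (u + l%:R * b + x)) -
    \sum_(l < n) ln (clip d (u + l%:R * b + z)) <= eps / (20 * 10) * n%:R + C1.
  have := HC1 n (u + x) (u + z).
  by under eq_bigr do rewrite addrAC; under [X in _ - X]eq_bigr do rewrite addrAC.
have qwR : q%:R <= w%:R :> R by rewrite ler_nat.
have hq : q%:R <= 3 * (q./2)%:R :> R.
  by rewrite -natrM ler_nat half_ge_third.
have hR : 0 < (q./2)%:R :> R by rewrite ltr0n half_gt0.
have lwR : l1%:R + l2%:R <= 21 * w%:R :> R.
  rewrite -natrD -natrM ler_nat; apply: leq_trans lw _; clear -w1; lia.
have cnt : ((l1 %/ q./2).+1 + (l2 %/ q./2).+1)%:R * q%:R <= 65 * w%:R :> R.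
  have : ((l1 %/ q./2) * q./2)%:R <= l1%:R :> R by rewrite ler_nat leq_divM.
  have : ((l2 %/ q./2) * q./2)%:R <= l2%:R :> R by rewrite ler_nat leq_divM.
  rewrite !natrM natrD -!natr1; set A := (_ %/ _)%:R; set B := (_ %/ _)%:R.
  have : 0 <= A by []. have : 0 <= B by [].
  move: hq hR lwR qwR qR; clear; nra.
have Iq : I%:R <= eps / (10 * 10 * 10) * q%:R.
  have h1 : (20 * 20 * 10) * C <= eps * X.
    by rewrite [eps * X]mulrC -ler_pdivrMr//; exact: le_trans Y03 XY.
  have h2 : (10 * 10 * 10) * C * I%:R <= eps * C * q%:R.
    apply: le_trans (_ : eps * X ^+ 2 <= _); last by rewrite -mulrA ler_pM2l.
    have C0' : 0 <= 10 * 10 * 10 * C by rewrite !mulr_ge0// ltW.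
    have := ler_wpM2l C0' I2; have := ler_wpM2r (le_trans ler01 X1) h1.
    by rewrite expr2; clear; lra.
  by rewrite -(ler_pM2l C0); move: h2; clear; lra.
have qq : (1 < q <= w)%N by rewrite q2 qw.
have se n u x : (\sum_(l < n) excess d I (u + l%:R * b + x))%:R
    <= (n %/ q./2).+1%:R * (I%:R + 8 * q%:R * d).
  have := sum_excess n I (u + x) qq cop Hb d0.
  by under eq_bigr do rewrite addrAC.
have ex x : ((\sum_(l < l1) excess d I (t1 + l%:R * b + x) + \sum_(l < l2) excess d I (t2 + l%:R * b + x))%R%:R <= eps * w%:R * (1/5) :> R).
  have e2 := se l1 t1 x; have e3 := se l2 t2 x.
  rewrite -[X in X%:R]/(addn _ _) natrD; apply: le_trans (lerD e2 e3) _.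
  rewrite -mulrDl -natrD; move: cnt; set N := _%:R => cnt.
  apply: le_trans (_ : N * (eps / (10 * 10 * 10) * q%:R + 8 * q%:R * (eps / (20 * 20 * 20))) <= _).
    by apply: ler_wpM2l => //; apply: lerD => //; rewrite ler_pM2l// mulr_gt0.
  have -> : N * (eps / (10 * 10 * 10) * q%:R + 8 * q%:R * (eps / (20 * 20 * 20))) = eps / (50 * 10) * (N * q%:R).
    by clear; lra.
  have e5 : 0 <= eps / (50 * 10) by rewrite divr_ge0 ?mulr_ge0// ltW.
  have e6 := mulr_ge0 (ltW eps0) (ltW w0).
  by have := ler_wpM2l e5 cnt; move: e6; clear; lra.
have a1 := bk l1 t1 (- y) (- t i); have a2 := bk l2 t2 (- y) (- t i).
have a3 := bk l1 t1 y (t i); have a4 := bk l2 t2 y (t i).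
have := ex (t i); set E1 := (X in X <= _) => Ex1.
have := ex (- t i); set E2 := (X in X <= _) => Ex2.
have E12 : ln 2 * (E2 + E1) <= E2 + E1 by rewrite ler_piMl// addr_ge0.
have e5 : 0 <= eps / (20 * 10) by rewrite divr_ge0 ?mulr_ge0// ltW.
have := ler_wpM2l e5 lwR.
have e6 := mulr_ge0 (ltW eps0) (ltW w0).
by move: a1 a2 a3 a4 Ex1 Ex2 E12 Cw e6; clear; lra.
Qed.

End Diophantine.

(** * Continuants and trigonometric polynomials *)
Section Continuant.
Context {R : realType}.
Implicit Types (a : nat -> R).

(** The pair of the determinants of sizes n and n - 1 of the tridiagonal matrix with
    diagonal a and off-diagonal entries 1. *)
Fixpoint continuant_pair a (n : nat) : R * R :=
  if n is m.+1 then
    (a m * (continuant_pair a m).1 - (continuant_pair a m).2, (continuant_pair a m).1)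
  else (1, 0).

Definition continuant a n := (continuant_pair a n).1.

Lemma continuantSS a n :
  continuant a n.+2 = a n.+1 * continuant a n.+1 - continuant a n.
Proof. by []. Qed.

Lemma continuant0 a : continuant a 0 = 1. Proof. by []. Qed.

Lemma continuant1 a : continuant a 1 = a 0.
Proof. by rewrite /continuant /= mulr1 subr0. Qed.

Lemma eq_continuant a a' n : (forall i, (i < n)%N -> a i = a' i) ->
  continuant a n = continuant a' n.
Proof.
move=> H; suff : forall m, (m <= n)%N -> continuant_pair a m = continuant_pair a' m.
  by move=> /(_ n (leqnn n)); rewrite /continuant => ->.
by elim=> [//|m IH] mn /=; rewrite IH 1?ltnW// H.
Qed.

Lemma continuant_left a n : continuant a n.+2 =
  a 0 * continuant (fun i => a i.+1) n.+1 - continuant (fun i => a i.+2) n.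
Proof.
suff H : (continuant a n.+2 =
  a 0 * continuant (fun i => a i.+1) n.+1 - continuant (fun i => a i.+2) n) /\
  (continuant a n.+3 =
  a 0 * continuant (fun i => a i.+1) n.+2 - continuant (fun i => a i.+2) n.+1) by case: H.
elim: n => [|n [IH1 IH2]].
  by rewrite !continuantSS !continuant1 !continuant0; split; ring.
split=> //; rewrite continuantSS IH1 IH2 !continuantSS; ring.
Qed.

(** Reversing the order of rows and columns of a tridiagonal matrix preserves its
    determinant. *)
Lemma continuant_rev a n : continuant (fun i => a (n.-1 - i)%N) n = continuant a n.
Proof.
suff H : (continuant (fun i => a (n.-1 - i)%N) n = continuant a n) /\
  (continuant (fun i => a (n - i)%N) n.+1 = continuant a n.+1) by case: H.
elim: n => [|n [IH1 IH2]]; first by rewrite /= !continuant0 !continuant1.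
split=> //; rewrite continuant_left subn0 continuantSS; congr (_ * _ - _).
  by rewrite -IH2; apply: eq_continuant => i _; rewrite subSS.
rewrite -IH1; apply: eq_continuant => i il.
by congr a; move: il; case: n {IH1 IH2} => //= n; lia.
Qed.

(** Cramer's rule for the block of length m + l + 1 starting at x, cleared of
    denominators. *)
Lemma green_identity (a : int -> R) (u : int -> R) (x : int) (m l : nat) :
  (forall n, u (n + 1) + u (n - 1) = a n * u n) ->
  continuant (fun i => a (x + i%:Z)) (m + l).+1 * u (x + m%:Z) =
  continuant (fun i => a (x + m%:Z + 1 + i%:Z)) l * u (x - 1)
  + continuant (fun i => a (x + i%:Z)) m * u (x + m%:Z + l%:Z + 1).
Proof.
move=> rec; set K := continuant (fun i => a (x + i%:Z)).
have rec' n : u (n + 1) = a n * u n - u (n - 1) by rewrite -rec addrK.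
have KSS n : K n.+2 = a (x + n.+1%:Z) * K n.+1 - K n by [].
have base : K m.+1 * u (x + m%:Z) = u (x - 1) + K m * u (x + m%:Z + 1).
  elim: m => [|m IH].
    rewrite /K continuant1 continuant0 mul1r addr0 addrC rec; congr (a _ * u _); lia.
  rewrite KSS rec'.
  have -> : x + m.+1%:Z - 1 = x + m%:Z by lia.
  have -> : x + m.+1%:Z = x + m%:Z + 1 by lia.
  by move: IH; clear; lra.
set K' := continuant (fun i => a (x + m%:Z + 1 + i%:Z)).
have K'SS n : K' n.+2 = a (x + m%:Z + 1 + n.+1%:Z) * K' n.+1 - K' n by [].
suff H : (K (m + l).+1 * u (x + m%:Z) = K' l * u (x - 1) + K m * u (x + m%:Z + l%:Z + 1)) /\
  (K (m + l).+2 * u (x + m%:Z) = K' l.+1 * u (x - 1) + K m * u (x + m%:Z + l.+1%:Z + 1))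
  by case: H.
elim: l => [|l [IH1 IH2]].
  rewrite addn0 !addr0 /K' continuant0 continuant1 mul1r -/K; split=> //.
  rewrite KSS mulrBl -mulrA base.
  have -> : x + m%:Z + 1%:Z + 1 = (x + m%:Z + 1) + 1 by lia.
  rewrite [u (x + m%:Z + 1 + 1)]rec' addr0.
  have -> : x + m%:Z + 1 - 1 = x + m%:Z by lia.
  have -> : x + m.+1%:Z = x + m%:Z + 1 by lia.
  ring.
rewrite addnS; split=> //.
rewrite KSS mulrBl -mulrA IH2 IH1 K'SS.
rewrite [u (x + m%:Z + l.+2%:Z + 1)]rec'.
have -> : x + m%:Z + l.+2%:Z - 1 = x + m%:Z + l.+1%:Z by lia.
have -> : x + m%:Z + l.+2%:Z = x + m%:Z + l.+1%:Z + 1 by lia.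
have -> : x + (m + l).+2%:Z = x + m%:Z + l.+1%:Z + 1 by lia.
have -> : x + m%:Z + 1 + l.+1%:Z = x + m%:Z + l.+1%:Z + 1 by lia.
have -> : x + m%:Z + l.+1%:Z = x + m%:Z + l%:Z + 1 by lia.
ring.
Qed.

(** Trigonometric polynomials of degree at most n, in the normal form
    p(cos t) + sin t q(cos t). *)
Definition trigpoly (n : nat) (f : R -> R) : Prop :=
  exists p q : {poly R}, [/\ (size p <= n.+1)%N, (size q <= n)%N &
    forall t, f t = p.[cos t] + sin t * q.[cos t]].

Lemma trigpolyB n f g : trigpoly n f -> trigpoly n g -> trigpoly n (fun t => f t - g t).
Proof.
move=> [p [q [sp sq H]]] [p' [q' [sp' sq' H']]]; exists (p - p'), (q - q'); split.
- by rewrite (leq_trans (size_polyD _ _))// size_polyN geq_max sp sp'.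
- by rewrite (leq_trans (size_polyD _ _))// size_polyN geq_max sq sq'.
- by move=> t; rewrite H H' !hornerE; ring.
Qed.

Lemma trigpoly_mul n f A C phi : trigpoly n f ->
  trigpoly n.+1 (fun t => (A * cos (t + phi) + C) * f t).
Proof.
move=> [p [q [sp sq H]]].
pose a := A * cos phi; pose b := - (A * sin phi).
have sX (c d : R) : (size (c *: 'X + d%:P)%R <= 2)%N.
  rewrite (leq_trans (size_polyD _ _))// geq_max.
  rewrite (leq_trans (size_scale_leq _ _)) ?size_polyX//=.
  by rewrite (leq_trans (size_polyC_leq1 _)).
have sX2 : (size (b *: (1 - 'X^2))%R <= 3)%N.
  rewrite (leq_trans (size_scale_leq _ _))// (leq_trans (size_polyD _ _))// geq_max.
  by rewrite size_polyN size_polyXn size_poly1.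
have sM (P Q : {poly R}) d e : (size P <= d.+1)%N -> (size Q <= e)%N -> (size (P * Q)%R <= d + e)%N.
  move=> h1 h2; have [->|P0] := eqVneq P 0; first by rewrite mul0r size_poly0.
  have [->|Q0] := eqVneq Q 0; first by rewrite mulr0 size_poly0.
  by rewrite size_mul// -subn1 leq_subLR add1n -addSn leq_add.
exists (p * (a *: 'X + C%:P) + b *: (1 - 'X^2) * q), ((a *: 'X + C%:P) * q + b *: p); split.
- rewrite (leq_trans (size_polyD _ _))// geq_max mulrC.
  by rewrite (sM _ _ 1%N)// (sM _ _ 2%N).
- rewrite (leq_trans (size_polyD _ _))// geq_max (sM _ _ 1%N)//=.
  by rewrite (leq_trans (size_scale_leq _ _)).
- move=> t; rewrite H !hornerE cosD /a /b.
  have := cos2Dsin2 t; set c := cos t; set s := sin t => E.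
  have -> : 1 - c ^+ 2 = s ^+ 2 by rewrite -E; ring.
  set P := p.[c]; set Q := q.[c]; ring.
Qed.

(** Evenness kills the sine part. *)
Lemma trigpoly_even n f : trigpoly n f -> (forall t, f (- t) = f t) ->
  exists p : {poly R}, (size p <= n.+1)%N /\ forall t, f t = p.[cos t].
Proof.
move=> [p [q [sp sq H]]] ev; exists p; split=> // t.
have := ev t; rewrite !H cosN sinN; set s := sin t * _.
have -> : - sin t * q.[cos t] = - s by rewrite mulNr.
lra.
Qed.

End Continuant.

(** * Determinants of finite blocks *)
Definition dirichlet_det {R : realType} (v : R -> R) (b E : R) (n : nat) (x : R) : R :=
  continuant (fun i => E - v (x + i%:R * b)) n.

Section Model.
Context {R : realType}.
Variables (alpha lambda b : R).
Hypotheses (am : -1 < alpha) (a1 : alpha < 1).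

Local Notation v := (potential alpha lambda).

Definition den (x : R) : R := 1 - alpha * cos (2 * pi * x).

Lemma den_bounds x : 0 < 1 - `|alpha| /\ 1 - `|alpha| <= den x <= 2.
Proof.
have na : `|alpha| < 1 by rewrite ltr_norml am a1.
have : `|alpha * cos (2 * pi * x)| <= `|alpha|.
  by rewrite normrM ler_piMr// cos_max.
rewrite ler_norml /den => /andP[]; lra.
Qed.

Lemma den_gt0 x : 0 < den x.
Proof. by have [h /andP[h1 _]] := den_bounds x; apply: lt_le_trans h h1. Qed.

Lemma potentialN x : v (- x) = v x.
Proof. by rewrite /potential mulrN cosN. Qed.

Lemma potential_bounded : exists2 M, 0 <= M & forall x, `|v x| <= M.
Proof.
have [d0 _] := den_bounds 0.
exists (2 * `|lambda| / (1 - `|alpha|)); first by rewrite divr_ge0 ?mulr_ge0// ltW.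
move=> x; have [_ /andP[h _]] := den_bounds x.
rewrite /potential -/(den x) normrM normfV (gtr0_norm (den_gt0 x)).
apply: ler_pM; rewrite ?normr_ge0 ?invr_ge0 ?(ltW (den_gt0 x))//; last first.
  by rewrite lef_pV2// posrE den_gt0.
by rewrite normrM normrM ger0_norm// ler_piMr ?mulr_ge0// cos_max.
Qed.

Lemma potential_lipschitz : exists2 M, 0 <= M & forall x y, `|v x - v y| <= M * `|x - y|.
Proof.
have [d0 _] := den_bounds 0; set m := 1 - `|alpha| in d0.
exists (2 * `|lambda| / m ^+ 2 * (2 * pi)).
  by rewrite !mulr_ge0 ?invr_ge0 ?exprn_ge0 ?pi_ge0// ltW.
move=> x y; have [_ /andP[hx _]] := den_bounds x; have [_ /andP[hy _]] := den_bounds y.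
have dx := den_gt0 x; have dy := den_gt0 y.
have -> : v x - v y = 2 * lambda / (den x * den y) * (cos (2 * pi * x) - cos (2 * pi * y)).
  rewrite /potential -/(den x) -/(den y).
  apply: (mulIf (_ : den x * den y != 0)); first by rewrite mulf_neq0// gt_eqF.
  by rewrite /den; field; rewrite -/(den x) -/(den y) !gt_eqF.
rewrite normrM -[X in _ <= X]mulrA; apply: ler_pM; rewrite ?normr_ge0//.
  rewrite normrM normfV [`|den x * _|]normrM !(gtr0_norm dx, gtr0_norm dy) normrM [`|2|]ger0_norm//.
  rewrite ler_wpM2l ?mulr_ge0// lef_pV2 ?posrE ?mulr_gt0 ?exprn_gt0// expr2.
  by apply: ler_pM; rewrite // ltW.
have [_] := sin_cos_lipschitz (2 * pi * x) (2 * pi * y).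
by rewrite -mulrBr normrM (ger0_norm (_ : 0 <= 2 * pi))// mulr_ge0// pi_ge0.
Qed.

Lemma ln_den_lipschitz : exists M, forall x y, `|ln (den x) - ln (den y)| <= M * `|x - y|.
Proof.
have [d0 _] := den_bounds 0.
exists (2 * pi / (1 - `|alpha|)) => x y.
have [_ /andP[hx _]] := den_bounds x; have [_ /andP[hy _]] := den_bounds y.
apply: le_trans (ln_lipschitz d0 hx hy) _.
rewrite mulrAC ler_pM2r ?invr_gt0//.
have -> : den x - den y = - (alpha * (cos (2 * pi * x) - cos (2 * pi * y))).
  by rewrite /den; ring.
rewrite normrN normrM.
have [_] := sin_cos_lipschitz (2 * pi * x) (2 * pi * y).
rewrite -mulrBr normrM (ger0_norm (_ : 0 <= 2 * pi)) ?mulr_ge0 ?pi_ge0//.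
apply: le_trans; rewrite ler_piMl//; have := d0; lra.
Qed.

Lemma den_period x (m : int) : den (x + m%:~R) = den x.
Proof.
rewrite /den; congr (1 - alpha * _).
have -> : 2 * pi * (x + m%:~R) = 2 * pi * x + m%:~R * (2 * pi) by ring.
exact: cosDint.
Qed.

Local Notation block_det := (dirichlet_det v b).

(** Each diagonal entry E - v times its denominator is A cos(t + phi) + C, so the
    three-term recursion of continuants raises the degree by one at each step. *)
Lemma block_det_trigpoly E n s : trigpoly n
  (fun t => block_det E n (t / (2 * pi) + s) * \prod_(j < n) den (t / (2 * pi) + s + j%:R * b)).
Proof.
have pi0 : pi != 0 :> R by rewrite gt_eqF// pi_gt0.
pose phi (j : nat) := 2 * pi * (s + j%:R * b).
have phiE t j : 2 * pi * (t / (2 * pi) + s + j%:R * b) = t + phi j.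
  by rewrite /phi; move: (pi : R) pi0 => p p0; field.
have denE t j : den (t / (2 * pi) + s + j%:R * b) = (- alpha) * cos (t + phi j) + 1.
  by rewrite /den phiE; ring.
pose W k := fun t => block_det E k (t / (2 * pi) + s) * \prod_(j < k) den (t / (2 * pi) + s + j%:R * b).
have lead t j : (E - v (t / (2 * pi) + s + j%:R * b)) * den (t / (2 * pi) + s + j%:R * b)
  = (- (E * alpha) - 2 * lambda) * cos (t + phi j) + E.
  rewrite mulrBl /potential -/(den _) divfK ?gt_eqF ?den_gt0// denE phiE; ring.
suff [] : trigpoly n (W n) /\ trigpoly n.+1 (W n.+1) by [].
elim: n => [|n [IH1 IH2]].
  split.
    exists 1, 0; split; rewrite ?size_poly1 ?size_poly0// => t.
    by rewrite /W /dirichlet_det continuant0 big_ord0 !hornerE.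
  have [p [q [sp sq H]]] : trigpoly 1 (fun t => ((- (E * alpha) - 2 * lambda) * cos (t + phi 0%N) + E) * 1).
    apply: trigpoly_mul; exists 1, 0; split; rewrite ?size_poly1 ?size_poly0// => t.
    by rewrite !hornerE.
  exists p, q; split=> // t; rewrite -H /W /dirichlet_det continuant1 big_ord1 -lead mulr1.
  by [].
split=> //.
have [p [q [sp sq H]]] := trigpolyB (trigpoly_mul (- (E * alpha) - 2 * lambda) E (phi n.+1) IH2)
   (trigpoly_mul (- alpha) 1 (phi n.+1) (trigpoly_mul (- alpha) 1 (phi n) IH1)).
exists p, q; split=> // t; rewrite -H -lead -!denE /W /dirichlet_det continuantSS.
rewrite !big_ord_recr /=; ring.
Qed.

(** Centering the block at its middle phase makes the determinant even, by [continuant_rev]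
    and since v is even; the polynomial in the cosine then comes from [trigpoly_even]. *)
Lemma block_det_poly E n : (0 < n)%N -> exists P : {poly R}, (size P <= n.+1)%N /\
  forall x, block_det E n x * \prod_(j < n) den (x + j%:R * b)
     = P.[cos (2 * pi * (x + (n.-1)%:R / 2 * b))].
Proof.
move=> n0; have pi0 : pi != 0 :> R by rewrite gt_eqF// pi_gt0.
pose s : R := - ((n.-1)%:R / 2 * b).
have refl t (j : nat) : (j < n)%N ->
   - t / (2 * pi) + s + j%:R * b = - (t / (2 * pi) + s + (n.-1 - j)%:R * b).
  move=> jn; rewrite natrB; last by rewrite -ltnS prednK.
  by rewrite /s; move: (pi : R) pi0 => p p0; field.
have [|P [sP HP]] := trigpoly_even (block_det_trigpoly E n s).
  move=> t; congr (_ * _).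
    rewrite /dirichlet_det -[RHS]continuant_rev; apply: eq_continuant => i il.
    by rewrite refl// potentialN.
  rewrite [RHS](reindex_inj rev_ord_inj) /=; apply: eq_bigr => i _.
  rewrite refl// /den mulrN cosN; congr (1 - _ * cos (_ * (_ + _%:R * _))).
  by case: n n0 i {s refl} => // n _ i /=; rewrite subSS.
exists P; split=> // x; have := HP (2 * pi * (x - s)).
have -> : 2 * pi * (x - s) / (2 * pi) + s = x by move: (pi : R) pi0 => p p0; field.
by move=> ->; rewrite /s opprK.
Qed.

End Model.

(** * Operator norms of real 2 x 2 matrices *)

Section MatrixNorms.
Context {R : realType}.
Local Notation C := R[i].
Implicit Types (A B : 'M[R]_2) (x : 'cV[C]_2).

Definition rc (t : R) : C := t%:C%C.

Lemma normc_ge0 (z : C) : 0 <= normc z.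
Proof. by case: z => a d; rewrite /normc sqrtr_ge0. Qed.

Lemma normc_rc (t : R) : normc (rc t) = `|t|.
Proof. by rewrite /normc /= expr0n /= addr0 sqrtr_sqr. Qed.

Lemma normc0_eq : normc (0 : C) = 0. Proof. by rewrite /normc /= expr0n/= addr0 sqrtr0. Qed.

Definition entry_norm A : R := \sum_(i < 2) \sum_(j < 2) `|A i j|.

Lemma entry_normE A : entry_norm A = `|A 0 0| + `|A 0 1| + (`|A 1 0| + `|A 1 1|).
Proof.
rewrite /entry_norm !big_ord_recl !big_ord0 !addr0.
by congr (`|A _ _| + `|A _ _| + (`|A _ _| + `|A _ _|)); apply: val_inj.
Qed.

Lemma det_mx2 A : \det A = A 0 0 * A 1 1 - A 0 1 * A 1 0.
Proof.
rewrite (expand_det_row _ ord0) !big_ord_recl big_ord0 addr0 /cofactor !det_mx11 !mxE /=.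
rewrite expr0 mul1r expr1 mulN1r mulrN.
by congr (A _ _ * A _ _ - A _ _ * A _ _); apply: val_inj.
Qed.

Lemma entry_norm_ge0 A : 0 <= entry_norm A.
Proof. by apply: sumr_ge0 => i _; apply: sumr_ge0. Qed.

Lemma le_entry_norm A i j : `|A i j| <= entry_norm A.
Proof.
rewrite /entry_norm (bigD1 i)//= (bigD1 j)//= -addrA ler_wpDr//.
by rewrite addr_ge0 ?sumr_ge0// => k _; rewrite sumr_ge0.
Qed.

Lemma entry_normD A B : entry_norm (A + B) <= entry_norm A + entry_norm B.
Proof.
rewrite /entry_norm -big_split; apply: ler_sum => i _; rewrite -big_split.
by apply: ler_sum => j _; rewrite mxE ler_normD.
Qed.

Lemma entry_normM A B : entry_norm (A *m B) <= entry_norm A * entry_norm B.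
Proof.
have E := entry_normE.
have P i j : `|(A *m B) i j| <= `|A i 0| * `|B 0 j| + `|A i 1| * `|B 1 j|.
  rewrite mxE !big_ord_recl big_ord0 addr0; apply: le_trans (ler_normD _ _) _.
  rewrite !normrM; apply: lerD => //.
  by rewrite (_ : lift ord0 ord0 = 1)//; apply: val_inj.
rewrite !E; have := P 0 0; have := P 0 1; have := P 1 0; have := P 1 1.
have := normr_ge0 (A 0 0); have := normr_ge0 (A 0 1); have := normr_ge0 (A 1 0); have := normr_ge0 (A 1 1).
have := normr_ge0 (B 0 0); have := normr_ge0 (B 0 1); have := normr_ge0 (B 1 0); have := normr_ge0 (B 1 1).
move: `|A 0 0| `|A 0 1| `|A 1 0| `|A 1 1| `|B 0 0| `|B 0 1| `|B 1 0| `|B 1 1|.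
move=> a b c d e f g h h0 g0 f0 e0 d0 c0 b0 a0.
move: `|_| `|_| `|_| `|_| => p q r s.
have := mulr_ge0 a0 g0; have := mulr_ge0 a0 h0; have := mulr_ge0 b0 e0; have := mulr_ge0 b0 f0.
have := mulr_ge0 c0 g0; have := mulr_ge0 c0 h0; have := mulr_ge0 d0 e0; have := mulr_ge0 d0 f0.
lra.
Qed.

Lemma euclidE x : euclidean_norm x = Num.sqrt (normc (x 0 0) ^+ 2 + normc (x 1 0) ^+ 2).
Proof.
rewrite /euclidean_norm !big_ord_recl big_ord0 addr0; congr (Num.sqrt (_ + normc (x _ _) ^+ 2)).
exact: val_inj.
Qed.

Lemma coord_le_euclid x i : normc (x i 0) <= euclidean_norm x.
Proof.
rewrite /euclidean_norm -[leLHS]ger0_norm ?normc_ge0// -sqrtr_sqr ler_wsqrtr//.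
by rewrite (bigD1 i)//= ler_wpDr// sumr_ge0// => k _; rewrite sqr_ge0.
Qed.

Lemma euclid_le_sum x : euclidean_norm x <= normc (x 0 0) + normc (x 1 0).
Proof.
rewrite euclidE; have := normc_ge0 (x 0 0); have := normc_ge0 (x 1 0).
move: (normc _) (normc _) => p q p0 q0.
rewrite -[leRHS]ger0_norm ?addr_ge0// -sqrtr_sqr ler_wsqrtr//; nra.
Qed.

Lemma minkowski2 (a b c d : R) : 0 <= a -> 0 <= b -> 0 <= c -> 0 <= d ->
  Num.sqrt ((a + c) ^+ 2 + (b + d) ^+ 2) <= Num.sqrt (a ^+ 2 + b ^+ 2) + Num.sqrt (c ^+ 2 + d ^+ 2).
Proof.
move=> a0 b0 c0 d0; set s := Num.sqrt (a ^+ 2 + b ^+ 2); set t := Num.sqrt (c ^+ 2 + d ^+ 2).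
have s0 : 0 <= s by exact: sqrtr_ge0. have t0 : 0 <= t by exact: sqrtr_ge0.
have s2 : s ^+ 2 = a ^+ 2 + b ^+ 2 by rewrite sqr_sqrtr// addr_ge0 ?sqr_ge0.
have t2 : t ^+ 2 = c ^+ 2 + d ^+ 2 by rewrite sqr_sqrtr// addr_ge0 ?sqr_ge0.
have st : a * c + b * d <= s * t.
  rewrite -(@ler_pXn2r _ 2)// ?nnegrE ?addr_ge0 ?mulr_ge0// exprMn s2 t2.
  have := sqr_ge0 (a * d - b * c); rewrite !expr2; lra.
rewrite -[leRHS]ger0_norm ?addr_ge0// -sqrtr_sqr ler_wsqrtr//.
rewrite [leRHS]sqrrD s2 t2; move: st; rewrite !expr2; lra.
Qed.

Lemma euclidD x y : euclidean_norm (x + y) <= euclidean_norm x + euclidean_norm y.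
Proof.
rewrite !euclidE; apply: le_trans (minkowski2 _ _ _ _); rewrite ?normc_ge0//.
by rewrite ler_wsqrtr// lerD// ler_pXn2r ?nnegrE ?addr_ge0 ?normc_ge0// mxE le_normcD.
Qed.

Definition cmx A : 'M[C]_2 := map_mx rc A.

Lemma euclid_mul_le A x : euclidean_norm x <= 1 -> euclidean_norm (cmx A *m x) <= entry_norm A.
Proof.
move=> x1; apply: le_trans (euclid_le_sum _) _.
have E := entry_normE.
have P i : normc ((cmx A *m x) i 0) <= `|A i 0| + `|A i 1|.
  rewrite mxE !big_ord_recl big_ord0 addr0; apply: le_trans (le_normcD _ _) _.
  rewrite (_ : lift ord0 ord0 = 1); last exact: val_inj.
  rewrite !normcM !mxE !normc_rc; apply: lerD; rewrite ler_piMr//;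
    exact: le_trans (coord_le_euclid _ _) x1.
by rewrite E lerD.
Qed.

Lemma opnorm_has_sup A : has_sup [set euclidean_norm (cmx A *m x) | x in [set x | euclidean_norm x <= 1]].
Proof.
split.
  exists (euclidean_norm (cmx A *m 0)), 0 => //=.
  by rewrite euclidE !mxE normc0_eq expr0n addr0 sqrtr0.
by exists (entry_norm A) => _ [x x1 <-]; exact: euclid_mul_le.
Qed.

Lemma opnorm_ub A x : euclidean_norm x <= 1 -> euclidean_norm (cmx A *m x) <= operator_norm (cmx A).
Proof. by move=> x1; apply: ub_le_sup; [case: (opnorm_has_sup A) | exists x]. Qed.

Lemma opnorm_le A (c : R) : (forall x, euclidean_norm x <= 1 -> euclidean_norm (cmx A *m x) <= c) ->
  operator_norm (cmx A) <= c.
Proof.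
move=> H; apply: ge_sup; first by case: (opnorm_has_sup A).
by move=> _ [x x1 <-]; exact: H.
Qed.

Lemma opnorm_le_entry A : operator_norm (cmx A) <= entry_norm A.
Proof. by apply: opnorm_le => x; exact: euclid_mul_le. Qed.

(** Test on the basis vectors. *)
Lemma entry_le_opnorm A i j : `|A i j| <= operator_norm (cmx A).
Proof.
pose x : 'cV[C]_2 := delta_mx j 0.
have x1 : euclidean_norm x <= 1.
  rewrite /euclidean_norm (bigD1 j)//= big1 ?addr0; last first.
    by move=> k kj; rewrite !mxE (negbTE kj) normc0_eq expr0n.
  have -> : x j ord0 = rc 1 by rewrite mxE !eqxx.
  by rewrite normc_rc normr1 expr1n sqrtr1.
apply: le_trans (opnorm_ub A x1); apply: le_trans (coord_le_euclid _ i).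
by rewrite -colE !mxE normc_rc.
Qed.

Lemma opnorm_dist A B : `|operator_norm (cmx A) - operator_norm (cmx B)| <= entry_norm (A - B).
Proof.
have H M N : operator_norm (cmx M) <= operator_norm (cmx N) + entry_norm (M - N).
  apply: opnorm_le => x x1.
  have -> : cmx M = cmx N + cmx (M - N).
    by apply/matrixP => i j; rewrite !mxE /rc -rmorphD /= [N i j + _]addrC subrK.
  by rewrite mulmxDl (le_trans (euclidD _ _))// lerD ?opnorm_ub// euclid_mul_le.
have S : entry_norm (B - A) = entry_norm (A - B).
  by apply: eq_bigr => i _; apply: eq_bigr => j _; rewrite !mxE distrC.
rewrite ler_norml; have := H A B; have := H B A; rewrite S.
move: (operator_norm _) (operator_norm _) (entry_norm _) => o1 o2 e; lra.
Qed.

Lemma entry_norm_ge1 A : \det A = 1 -> 1 <= entry_norm A.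
Proof.
move=> d1; have := le_entry_norm A.
have E := entry_normE.
move: d1; rewrite det_mx2 E => d1 _.
have : 1 <= `|A 0 0| * `|A 1 1| + `|A 0 1| * `|A 1 0|.
  by rewrite -[leLHS]normr1 -d1 -!normrM; exact: ler_normB.
have := normr_ge0 (A 0 0); have := normr_ge0 (A 0 1); have := normr_ge0 (A 1 0); have := normr_ge0 (A 1 1).
move: `|_| `|_| `|_| `|_| => a b c d a0 b0 c0 d0; nra.
Qed.

(** The determinant being 1, some entry is at least 1/2 in absolute value.  This keeps the
    logarithm of the norm Lipschitz. *)
Lemma opnorm_ge_half A : \det A = 1 -> 1 / 2 <= operator_norm (cmx A).
Proof.
move=> d1; have := entry_le_opnorm A; move: (operator_norm _) => o H.
have : 1 <= `|A 0 0| * `|A 1 1| + `|A 0 1| * `|A 1 0|.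
  by rewrite -[leLHS]normr1 -d1 det_mx2 -!normrM; exact: ler_normB.
have := H 0 0; have := H 0 1; have := H 1 0; have := H 1 1.
have := normr_ge0 (A 0 0); have := normr_ge0 (A 0 1); have := normr_ge0 (A 1 0); have := normr_ge0 (A 1 1).
move: `|_| `|_| `|_| `|_| => a b c d a0 b0 c0 d0 ao bo co do_ M.
have o0 : 0 <= o by apply: le_trans ao.
have := ler_pM a0 b0 ao bo; have := ler_pM a0 d0 ao do_; have := ler_pM b0 c0 bo co.
have := ler_pM c0 d0 co do_; have := ler_pM a0 c0 ao co; have := ler_pM b0 d0 bo do_.
move=> *; nra.
Qed.

End MatrixNorms.

(** * Transfer matrices and their growth rate *)

Lemma lip_continuous {R : realType} (f : R -> R) (K : R) :
  (forall x y, `|f x - f y| <= K * `|x - y|) -> continuous f.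
Proof.
move=> H x; apply/cvgrPdist_le => e e0.
have K0 : 0 <= K by have := H 1 0; rewrite subr0 normr1 mulr1; apply: le_trans.
have K1 : 0 < K + 1 by exact: ltr_wpDl.
apply/nbhs_ballP; exists (e / (K + 1)); first exact: divr_gt0.
move=> y /ltW; rewrite ler_pdivlMr// => xy.
apply: le_trans (H x y) _; apply: le_trans xy.
by rewrite mulrC ler_wpM2l// lerDl.
Qed.

Section Transfer.
Context {R : realType}.
Variables (v : R -> R) (b Mv Lv : R).
Hypotheses (Mv0 : 0 <= Mv) (vM : forall x, `|v x| <= Mv).
Hypotheses (Lv0 : 0 <= Lv) (vL : forall x y, `|v x - v y| <= Lv * `|x - y|).

Definition tmat (E x : R) : 'M[R]_2 :=
  \matrix_(i < 2, j < 2)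
    if i == 0 then (if j == 0 then E - v x else -1)
    else (if j == 0 then 1 else 0).

Fixpoint tprod (n : nat) (E x : R) : 'M[R]_2 :=
  if n is m.+1 then tmat E (x + m%:R * b) *m tprod m E x else 1%:M.

Lemma transfer_productE n E x : transfer_product v b n x (rc E) = cmx (tprod n E x).
Proof.
elim: n => [|n IH] /=; first by rewrite /cmx (map_mx1 (real_complex R)).
rewrite IH /cmx (map_mxM (real_complex R)); congr (_ *m _).
apply/matrixP => i j; rewrite !mxE.
by case: (i == 0); case: (j == 0) => //=; rewrite ?rmorphB ?rmorphN ?rmorph1 ?rmorph0.
Qed.

Lemma det_tprod n E x : \det (tprod n E x) = 1.
Proof.
elim: n => [|n IH] /=; first by rewrite det1.
by rewrite det_mulmx IH det_mx2 !mxE /=; ring.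
Qed.

Lemma tprodD m n E x : tprod (m + n) E x = tprod n E (x + m%:R * b) *m tprod m E x.
Proof.
elim: n => [|n IH]; first by rewrite addn0 /= mul1mx.
rewrite addnS /= IH mulmxA; congr (tmat _ _ *m _ *m _).
rewrite natrD; ring.
Qed.

Lemma mx2_mulE (A B : 'M[R]_2) i j : (A *m B) i j = A i 0 * B 0 j + A i 1 * B 1 j.
Proof.
rewrite mxE !big_ord_recl big_ord0 addr0; congr (_ + A _ _ * B _ _); exact: val_inj.
Qed.

(** Together with [tprod_col1], the entries of the transfer matrix are the block
    determinants of lengths n, n - 1 and n - 2. *)
Lemma tprod_col0 n E x :
  (tprod n E x 0 0, tprod n E x 1 0) = continuant_pair (fun i => E - v (x + i%:R * b)) n.
Proof.
elim: n => [|n IH]; first by rewrite /= !mxE.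
rewrite /= !mx2_mulE !mxE /= -IH /=; congr (_, _); ring.
Qed.

Lemma tprod_col1 n E x :
  (- tprod n.+1 E x 0 1, - tprod n.+1 E x 1 1) =
  continuant_pair (fun i => E - v (x + b + i%:R * b)) n.
Proof.
elim: n => [|n IH].
  by rewrite /= !mx2_mulE !mxE /=; congr (_, _); ring.
have E1 : x + b + n%:R * b = x + n.+1%:R * b by rewrite -natr1; ring.
have -> : tprod n.+2 E x = tmat E (x + n.+1%:R * b) *m tprod n.+1 E x by [].
move: IH; move: (tprod n.+1 E x) => A IH.
by rewrite !mx2_mulE !mxE /= -IH /= E1; congr (_, _); ring.
Qed.

Local Notation block := (dirichlet_det v b).

Lemma block_le_entry n E x : `|block E n x| <= entry_norm (tprod n E x).
Proof. by rewrite /dirichlet_det /continuant -tprod_col0; exact: le_entry_norm. Qed.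

Lemma entry_le_block n E x : entry_norm (tprod n.+2 E x) <=
  `|block E n.+2 x| + `|block E n.+1 x| + `|block E n.+1 (x + b)| + `|block E n (x + b)|.
Proof.
have := tprod_col0 n.+2 E x; have := tprod_col1 n.+1 E x.
set A := tprod n.+2 E x => h1 h2.
rewrite entry_normE.
have -> : A 0 0 = block E n.+2 x by have /(congr1 fst) := h2.
have -> : A 1 0 = block E n.+1 x by have /(congr1 snd) := h2.
have -> : A 0 1 = - block E n.+1 (x + b).
  by have /(congr1 fst) := h1; rewrite [LHS]/= /dirichlet_det /continuant => <-; rewrite opprK.
have -> : A 1 1 = - block E n (x + b).
  by have /(congr1 snd) := h1; rewrite [LHS]/= /dirichlet_det /continuant => /= <-; rewrite opprK.
rewrite !normrN; lra.
Qed.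

Lemma entry_norm_tmat E x : entry_norm (tmat E x) <= `|E| + Mv + 2.
Proof.
rewrite entry_normE !mxE /= normrN normr1 normr0.
have := ler_normB E (v x); have := vM x; lra.
Qed.

Lemma entry_norm_tprod n E x : entry_norm (tprod n E x) <= 2 * (`|E| + Mv + 2) ^+ n.
Proof.
elim: n => [|n IH] /=.
  by rewrite entry_normE !mxE /= normr1 normr0 expr0; lra.
apply: le_trans (entry_normM _ _) _; rewrite exprS mulrCA.
by apply: ler_pM; rewrite ?entry_norm_ge0 ?entry_norm_tmat.
Qed.

Lemma tprod_lipschitz n M : 0 <= M -> exists2 K, 0 <= K &
  forall E E' x x', `|E| <= M -> `|E'| <= M ->
  entry_norm (tprod n E x - tprod n E' x') <= K * (`|E - E'| + `|x - x'|).
Proof.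
move=> M0; elim: n => [|n [K K0 IH]].
  exists 0 => // E E' x x' _ _; rewrite /= subrr mul0r.
  by rewrite entry_normE !mxE normr0 !addr0.
have B0 : 0 <= M + Mv + 2 by rewrite !addr_ge0.
exists ((M + Mv + 2) * K + (1 + Lv) * (2 * (M + Mv + 2) ^+ n)).
  by rewrite addr_ge0 ?mulr_ge0 ?exprn_ge0 ?addr_ge0.
move=> E E' x x' EM EM' /=.
set d := `|E - E'| + `|x - x'|.
have -> : tmat E (x + n%:R * b) *m tprod n E x - tmat E' (x' + n%:R * b) *m tprod n E' x' =
  tmat E (x + n%:R * b) *m (tprod n E x - tprod n E' x') +
  (tmat E (x + n%:R * b) - tmat E' (x' + n%:R * b)) *m tprod n E' x'.
  by rewrite mulmxBr mulmxBl addrA subrK.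
apply: le_trans (entry_normD _ _) _; rewrite mulrDl; apply: lerD.
  apply: le_trans (entry_normM _ _) _; rewrite -mulrA; apply: ler_pM;
    rewrite ?entry_norm_ge0 ?IH//.
  by apply: le_trans (entry_norm_tmat _ _) _; rewrite !lerD2r.
apply: le_trans (entry_normM _ _) _; rewrite mulrAC; apply: ler_pM;
    rewrite ?entry_norm_ge0//.
  rewrite entry_normE !mxE /= !subrr normr0 !addr0.
  have -> : E - v (x + n%:R * b) - (E' - v (x' + n%:R * b)) =
    (E - E') - (v (x + n%:R * b) - v (x' + n%:R * b)) by ring.
  apply: le_trans (ler_normB _ _) _.
  have := vL (x + n%:R * b) (x' + n%:R * b).
  have -> : x + n%:R * b - (x' + n%:R * b) = x - x' by ring.
  have := mulr_ge0 Lv0 (normr_ge0 (E - E')); have := normr_ge0 (x - x').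
  rewrite /d; move: `|v _ - _| `|E - E'| `|x - x'| => p q r; lra.
apply: le_trans (entry_norm_tprod _ _ _) _; rewrite ler_wpM2l//.
have E0 : 0 <= `|E'| by [].
by rewrite lerXn2r ?nnegrE ?addr_ge0// !lerD2r.
Qed.

Definition log_norm (n : nat) (E x : R) : R :=
  n%:R^-1 * ln (operator_norm (transfer_product v b n x (rc E))).

Lemma log_norm_lipschitz n M : 0 <= M -> exists2 K, 0 <= K &
  forall E E' x x', `|E| <= M -> `|E'| <= M ->
  `|log_norm n E x - log_norm n E' x'| <= K * (`|E - E'| + `|x - x'|).
Proof.
move=> M0; have [K K0 HK] := tprod_lipschitz n M0.
exists (n%:R^-1 * (2 * K)); first by rewrite !mulr_ge0 ?invr_ge0.
move=> E E' x x' EM EM'; rewrite /log_norm !transfer_productE -mulrBr normrM.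
rewrite ger0_norm ?invr_ge0// -mulrA ler_wpM2l ?invr_ge0//.
have := ln_lipschitz (_ : 0 < 1 / 2) (opnorm_ge_half (det_tprod n E x)) (opnorm_ge_half (det_tprod n E' x')).
move=> /(_ ltac:(by [])) H; apply: le_trans H _.
rewrite div1r invrK mulrC -mulrA ler_wpM2l//.
by apply: le_trans (opnorm_dist _ _) _; exact: HK.
Qed.

Lemma lip_integrable01 (f : R -> R) (K : R) :
  (forall x y, `|f x - f y| <= K * `|x - y|) ->
  (@lebesgue_measure R).-integrable `[0, 1] (EFin \o f).
Proof.
move=> H; apply: continuous_compact_integrable; first exact: segment_compact.
by apply: continuous_subspaceT; exact: lip_continuous H.
Qed.

Lemma log_norm_integrable n E :
  (@lebesgue_measure R).-integrable `[0, 1] (EFin \o log_norm n E).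
Proof.
have [K K0 HK] := log_norm_lipschitz n (normr_ge0 E).
apply: (lip_integrable01 (K := K)) => x y.
by apply: le_trans (HK E E x y _ _) _ => //; rewrite subrr normr0 add0r.
Qed.

Definition lyap_seq (E : R) (n : nat) : R :=
  Rintegral (@lebesgue_measure R) `[0, 1] (log_norm n E).

Lemma lyapunovE E : lyapunov v b (rc E) = limn (lyap_seq E).
Proof. by []. Qed.

Lemma Rintegral01_cst (c : R) : Rintegral (@lebesgue_measure R) `[0, 1] (fun=> c) = c.
Proof.
have -> : c = c * fine (@lebesgue_measure R `[(0:R), 1%R]%classic).
  by rewrite lebesgue_measure_itv /= lte_fin ltr01 oppr0 adde0 mulr1.
rewrite Rintegral_cst//; congr (_ * _).
by rewrite lebesgue_measure_itv /= lte_fin ltr01 oppr0 adde0 mulr1.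
Qed.

Lemma cst_integrable01 (c : R) :
  (@lebesgue_measure R).-integrable `[0, 1] (EFin \o (fun=> c)).
Proof.
by apply: (lip_integrable01 (K := 0)) => x y; rewrite subrr normr0 mul0r.
Qed.

Lemma lyap_seq_le n E c : (forall x, log_norm n E x <= c) -> lyap_seq E n <= c.
Proof.
move=> H; rewrite /lyap_seq -[leRHS]Rintegral01_cst; apply: le_Rintegral => //.
- exact: log_norm_integrable.
- exact: cst_integrable01.
- by move=> x _; exact: H.
Qed.

Lemma lyap_seq_lipschitz n M : 0 <= M -> exists2 K, 0 <= K &
  forall E E', `|E| <= M -> `|E'| <= M -> `|lyap_seq E n - lyap_seq E' n| <= K * `|E - E'|.
Proof.
move=> M0; have [K K0 HK] := log_norm_lipschitz n M0; exists K => //.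
have H E E' : `|E| <= M -> `|E'| <= M -> lyap_seq E n - lyap_seq E' n <= K * `|E - E'|.
  move=> EM EM'.
  have HK0 F x y : `|F| <= M -> `|log_norm n F x - log_norm n F y| <= K * `|x - y|.
    by move=> FM; have := HK F F x y FM FM; rewrite (subrr F) normr0 add0r.
  rewrite /lyap_seq -RintegralB//; try exact: log_norm_integrable.
  rewrite -[leRHS]Rintegral01_cst; apply: le_Rintegral => //.
  - apply: (lip_integrable01 (f := fun x => log_norm n E x - log_norm n E' x) (K := K + K)) => x y.
    have E4 (p q s t : R) : p - q - (s - t) = (p - s) - (q - t) by ring.
    rewrite E4.
    apply: le_trans (ler_normB _ _) _.
    by rewrite mulrDl; apply: lerD; exact: HK0.
  - exact: cst_integrable01.
  - move=> x _; apply: le_trans (ler_norm _) _; apply: le_trans (HK _ _ x x EM EM') _.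
    by rewrite (subrr x) normr0 addr0.
move=> E E' EM EM'; rewrite ler_norml.
have := H E E' EM EM'; have := H E' E EM' EM; rewrite (distrC E').
by move: (lyap_seq E n) (lyap_seq E' n) (K * _) => p q k; lra.
Qed.

Section Growth.
Variable E : R.

Definition sup_norm (n : nat) : R := sup (range (fun x => entry_norm (tprod n E x))).

Lemma sup_norm_has n : has_sup (range (fun x => entry_norm (tprod n E x))).
Proof.
split; first by exists (entry_norm (tprod n E 0)), 0.
by exists (2 * (`|E| + Mv + 2) ^+ n) => _ [x _ <-]; exact: entry_norm_tprod.
Qed.

Lemma le_sup_norm n x : entry_norm (tprod n E x) <= sup_norm n.
Proof. by apply: ub_le_sup; [case: (sup_norm_has n) | exists x]. Qed.

Lemma sup_norm_ge1 n : 1 <= sup_norm n.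
Proof. by apply: le_trans (le_sup_norm n 0); apply: entry_norm_ge1; exact: det_tprod. Qed.

Lemma sup_norm_attain n : exists x, sup_norm n / 2 <= entry_norm (tprod n E x).
Proof.
have s0 : 0 < sup_norm n / 2 by rewrite divr_gt0//; apply: lt_le_trans (sup_norm_ge1 n).
have [_ [x _ <-] H] := sup_adherent s0 (sup_norm_has n).
by exists x; move: H; rewrite -/(sup_norm n) => /ltW; lra.
Qed.

Lemma sup_normM m n : sup_norm (m + n) <= sup_norm m * sup_norm n.
Proof.
apply: ge_sup; first by case: (sup_norm_has (m + n)).
move=> _ [x _ <-]; rewrite tprodD [leRHS]mulrC; apply: le_trans (entry_normM _ _) _.
by apply: ler_pM; rewrite ?entry_norm_ge0 ?le_sup_norm.
Qed.

(** The infimum of a subadditive sequence divided by n, which is its limit.  Working with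
    the supremum over the phase instead of the integral makes the upper bounds on transfer
    matrices uniform in the phase. *)
Definition growth_rate : R := inf [set ln (sup_norm n.+1) / n.+1%:R | n in [set: nat]].

Lemma growth_has_inf : has_inf [set ln (sup_norm n.+1) / n.+1%:R | n in [set: nat]].
Proof.
split; first by exists (ln (sup_norm 1) / 1%:R), 0%N.
by exists 0 => _ [n _ <-]; rewrite divr_ge0// ln_ge0// sup_norm_ge1.
Qed.

Lemma sup_norm_lower n : expR (growth_rate * n%:R) <= sup_norm n.
Proof.
case: n => [|n]; first by rewrite mulr0 expR0 sup_norm_ge1.
have s0 : 0 < sup_norm n.+1 by apply: lt_le_trans (sup_norm_ge1 _).
rewrite -[leRHS]lnK ?posrE// ler_expR -ler_pdivlMr ?ltr0n//.
by apply: ge_inf; [case: growth_has_inf | exists n].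
Qed.

(** Fekete's argument: write n = q m + s for an m that nearly attains the infimum. *)
Lemma sup_norm_upper eps : 0 < eps -> exists2 K, 0 < K &
  forall n, sup_norm n <= K * expR ((growth_rate + eps) * n%:R).
Proof.
move=> e0; have [_ [m _ <-] Hm] := inf_adherent e0 growth_has_inf.
rewrite -/growth_rate in Hm; set L := growth_rate + eps in Hm *.
have sn0 n : 0 < sup_norm n by apply: lt_le_trans (sup_norm_ge1 _).
have L0 : 0 <= L.
  by apply: le_trans (ltW Hm); rewrite divr_ge0// ln_ge0// sup_norm_ge1.
have Hm' : sup_norm m.+1 <= expR (L * m.+1%:R).
  by rewrite -[leLHS]lnK ?posrE// ler_expR -ler_pdivrMr ?ltr0n// ltW.
have Hq q : sup_norm (q * m.+1) <= sup_norm 0 * expR (L * (q * m.+1)%:R).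
  elim: q => [|q IH]; first by rewrite mul0n mulr0 expR0 mulr1.
  rewrite mulSn addnC; apply: le_trans (sup_normM _ _) _.
  rewrite natrD mulrDr expRD mulrA; apply: ler_pM => //; exact/ltW/sn0.
exists (\sum_(s < m.+1) sup_norm s * sup_norm 0).
  by rewrite big_ord_recl ltr_pwDl ?mulr_gt0// sumr_ge0// => i _; rewrite ltW// mulr_gt0.
move=> n; rewrite {1}(divn_eq n m.+1); apply: le_trans (sup_normM _ _) _.
rewrite mulrC; apply: le_trans (_ : sup_norm (n %% m.+1) * (sup_norm 0 * expR (L * n%:R)) <= _).
  apply: ler_wpM2l; first exact/ltW/sn0.
  apply: le_trans (Hq _) _; rewrite ler_wpM2l ?(ltW (sn0 _))// ler_expR ler_wpM2l//.
  by rewrite ler_nat leq_divM.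
rewrite mulrA ler_wpM2r ?expR_ge0//.
have lm : (n %% m.+1 < m.+1)%N by rewrite ltn_pmod.
rewrite (bigD1 (Ordinal lm))//= lerDl sumr_ge0// => i _.
by rewrite ltW// mulr_gt0.
Qed.

(** If the sequence did not converge, its limit would be the default value 0, against the
    hypothesis; otherwise the average over the phase is at most the supremum. *)
Lemma lyapunov_le_growth : 0 < lyapunov v b (rc E) -> lyapunov v b (rc E) <= growth_rate.
Proof.
rewrite lyapunovE => L0.
have cv : cvgn (lyap_seq E).
  by apply: contrapT => /dvgP H; move: L0; rewrite H ltxx.
apply/ler_addgt0Pr => e e0.
have [K K0 HK] := sup_norm_upper (divr_gt0 e0 (ltr0Sn R 1)).
apply: limr_le => //; near=> n.
have n0 : (0 < n)%N by near: n; exists 1%N.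
have nR : 0 < n%:R :> R by rewrite ltr0n.
have Kn : ln K <= e / 2 * n%:R.
  rewrite mulrC -ler_pdivrMr ?divr_gt0//; near: n.
  exists (Num.truncn (ln K / (e / 2))).+1 => // n /=; rewrite -(ler_nat R).
  by apply: le_trans; apply/ltW; exact: truncnS_gt.
apply: lyap_seq_le => x.
rewrite /log_norm mulrC ler_pdivrMr// transfer_productE.
apply: (@le_trans _ _ (ln (K * expR ((growth_rate + e / 2) * n%:R)))).
  rewrite ler_ln ?posrE ?mulr_gt0 ?expR_gt0//.
    by apply: le_trans (opnorm_le_entry _) _; apply: le_trans (le_sup_norm _ _) (HK n).
  by apply: lt_le_trans (opnorm_ge_half (det_tprod n E x)).
rewrite lnM ?posrE ?expR_gt0// expRK.
apply: le_trans (lerD Kn (lexx _)) _; rewrite -mulrDl ler_pM2r//; lra.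
Unshelve. all: by end_near. Qed.

End Growth.
End Transfer.

(** * Exponential decay of slowly growing solutions *)
Section SmallDivisors.
Context {R : realType}.

Lemma exp_dominates (K : R) (m : nat) : exists2 X0 : R, 1 <= X0 &
  forall X, X0 <= X -> K * X ^+ m <= expR X.
Proof.
exists (Num.max 1 (K * m.+1`!%:R)); first by rewrite le_max lexx.
move=> X; rewrite ge_max => /andP[X1 KX].
have X0 : 0 <= X by apply: le_trans X1.
apply: le_trans (_ : X ^+ m.+1 / m.+1`!%:R <= _); last first.
  by apply: le_trans (expR_ge1Dxn m X0); rewrite lerDr.
rewrite ler_pdivlMr ?ltr0n ?fact_gt0// exprSr mulrAC [leRHS]mulrC.
by rewrite ler_wpM2r// exprn_ge0.
Qed.

Lemma norm_sin_double (x : R) : `|sin (2 * pi * x)| <= 2 * `|sin (pi * x)|.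
Proof.
have -> : sin (2 * pi * x) = 2 * (cos (pi * x) * sin (pi * x)).
  by rewrite [RHS]mulr_natl -sin_mulr2n -[in RHS]mulr_natl mulrA.
by rewrite normrM ger0_norm// ler_wpM2l// normrM ler_piMl// cos_max.
Qed.

Variables (c r b : R).
Hypothesis D : diophantine c r b.

(** A power of w is beaten by exp(w^(1/(2r))). *)
Lemma small_divisors : exists w0 : nat, forall w : nat, (w0 <= w)%N ->
  forall N : int, N != 0 -> (`|N| <= 60 * w)%N ->
  expR (- (60 * w%:R) `^ (2 * r)^-1) <= `|sin (pi * (N%:~R * b))|.
Proof.
have r1 := diophantine_gt1 D; have c0 := diophantine_gt0 D.
have r0 : 0 < r by apply: lt_trans r1.
pose m := (Num.truncn (2 * r * r)).+1.
have [X0 X01 HX] := exp_dominates (2 / c) m.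
exists (maxn 1 (Num.truncn (X0 `^ (2 * r))).+1) => w.
rewrite geq_max => /andP[w1 w2] N N0 Nw.
have wR : 1 <= w%:R :> R by rewrite ler1n.
have W0 : 0 <= 60 * w%:R :> R by rewrite mulr_ge0.
set X := (60 * w%:R) `^ (2 * r)^-1.
have rr : (2 * r) * (2 * r)^-1 = 1 by rewrite divff// mulf_neq0// gt_eqF.
have XX0 : X0 <= X.
  have -> : X0 = (X0 `^ (2 * r)) `^ (2 * r)^-1.
    by rewrite -powRrM rr powRr1//; lra.
  apply: ge0_ler_powR; rewrite ?nnegrE ?invr_ge0 ?powR_ge0 ?mulr_ge0 ?(ltW r0)//.
  have := truncnS_gt (X0 `^ (2 * r)).
  have : (Num.truncn (X0 `^ (2 * r))).+1%:R <= w%:R :> R by rewrite ler_nat.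
  lra.
have X1 : 1 <= X by apply: le_trans XX0.
have HW : (60 * w%:R) `^ r = X `^ (2 * r * r).
  by rewrite /X -powRrM mulrA [_^-1 * _]mulrC rr mul1r.
have H1 : (60 * w%:R) `^ r <= X ^+ m.
  rewrite HW -powR_mulrn ?(le_trans ler01)//; apply: ler_powR => //.
  by apply/ltW; exact: truncnS_gt.
case: D => _ _ _ /(_ N N0) H2.
have Npos : 0 < (`|N|%N)%:R :> R by rewrite ltr0n absz_gt0.
have H3 : (`|N|%N)%:R `^ r <= X ^+ m.
  apply: le_trans H1; apply: ge0_ler_powR; rewrite ?nnegrE ?(ltW r0)//.
  by rewrite -natrM ler_nat.
have Xm : 0 < X ^+ m by rewrite exprn_gt0// (lt_le_trans ltr01).
have H4 : c / X ^+ m <= 2 * `|sin (pi * (N%:~R * b))|.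
  apply: le_trans (norm_sin_double _); apply: le_trans (ltW H2).
  by rewrite ler_wpM2l ?(ltW c0)// lef_pV2 ?posrE ?powR_gt0.
rewrite expRN; apply: le_trans (_ : c / X ^+ m / 2 <= _); last first.
  by rewrite ler_pdivrMr// mulrC mulrC [leRHS]mulrC.
have := HX _ XX0; set e := expR X => H5.
have e0 : 0 < e by exact: expR_gt0.
have -> : c / X ^+ m / 2 = (2 / c * X ^+ m)^-1.
  by field; rewrite !gt_eqF.
by rewrite lef_pV2// posrE mulr_gt0// divr_gt0.
Qed.

Variable theta : R.
Hypothesis nres : ~ resonant r b theta.

(** Only finitely many integers M violate the bound, and those are excluded by
    M >= 2 w - 3 for large w.  In [large_node], M is the sum of two first sites and of k - 1. *)
Lemma nonresonance : exists w0 : nat, forall w : nat, (w0 <= w)%N ->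
  forall M : int, (2 * w)%:Z - 3 <= M -> M <= (60 * w)%:Z ->
  expR (- (60 * w%:R) `^ (2 * r)^-1) <= `|sin (pi * (2 * theta + M%:~R * b))|.
Proof.
have r1 := diophantine_gt1 D; have r0 : 0 < r by apply: lt_trans r1.
have /finite_seqP[s Hs] : finite_set [set n : int |
    `|sin (2 * pi * (theta + n%:~R / 2 * b))|
      < expR (- ((`|n|%N)%:R `^ (2 * r)^-1))] by exact: contrapT nres.
pose n0 := (\sum_(x <- s) `|x|)%N.
exists (n0 + 2)%N => w wn M M1 M2.
have MN : M \notin s.
  apply/negP => Ms; have : (`|M| <= n0)%N by rewrite /n0 (big_rem M)//= leq_addr.
  lia.
have : ~ [set` s] M by rewrite /= (negbTE MN).
rewrite -Hs /= => /negP; rewrite -leNgt.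
have -> : 2 * pi * (theta + M%:~R / 2 * b) = pi * (2 * theta + M%:~R * b) by field.
apply: le_trans; rewrite ler_expR lerN2; apply: ge0_ler_powR; rewrite ?nnegrE ?mulr_ge0//.
  by rewrite invr_ge0 mulr_ge0// ltW.
by rewrite -natrM ler_nat; lia.
Qed.

End SmallDivisors.

Lemma divn20_bounds (y : nat) : (20 * (y %/ 20) <= y < 20 * (y %/ 20) + 20)%N.
Proof. by have := divn_eq y 20; have := ltn_pmod y (isT : (0 < 20)%N); lia. Qed.

Section Core.
Context {R : realType}.
Variables (alpha lambda c r b theta E : R).
Hypotheses (am : -1 < alpha) (a1 : alpha < 1).
Hypothesis D : diophantine c r b.
Hypothesis nres : ~ resonant r b theta.
Local Notation v := (potential alpha lambda).
Hypothesis lyap_gt0 : 0 < lyapunov v b (rc E).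
Local Notation blk := (dirichlet_det v b E).
Let L := growth_rate v b E.

Lemma growth_gt0 : 0 < L.
Proof.
have [Mv Mv0 vM] := potential_bounded lambda am a1.
have [Lv Lv0 vL] := potential_lipschitz lambda am a1.
by apply: lt_le_trans lyap_gt0 _; exact: (lyapunov_le_growth Mv0 vM Lv0 vL).
Qed.

Lemma block_upper eps : 0 < eps -> exists2 K, 0 < K &
  forall n x, `|blk n x| <= K * expR ((L + eps) * n%:R).
Proof.
move=> e0; have [Mv Mv0 vM] := potential_bounded lambda am a1.
have [K K0 HK] := sup_norm_upper b vM E e0; exists K => // n x.
apply: le_trans (block_le_entry _ _ _ _ _) _; apply: le_trans (HK n).
exact: (le_sup_norm b vM).
Qed.

(** The four entries of the transfer matrix of length 20 w are block determinants of
    lengths 20 w, 20 w - 1, 20 w - 1 and 20 w - 2, and one of them is comparable to the norm.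
    The length k is therefore only known up to 2. *)
Lemma block_lower w : (0 < w)%N -> exists k : nat, exists x : R,
  (20 * w - 2 <= k <= 20 * w)%N /\ expR (L * k%:R) / 8 <= `|blk k x|.
Proof.
move=> w0; have [Mv Mv0 vM] := potential_bounded lambda am a1.
have [n En] : exists n, (20 * w = n.+2)%N by exists (20 * w - 2)%N; lia.
have [x Hx] := sup_norm_attain b vM E (20 * w).
have := sup_norm_lower b vM E (20 * w); rewrite -/L => H1.
have := entry_le_block v b n E x; rewrite -En => H2.
have key k : (k <= 20 * w)%N -> expR (L * k%:R) <= expR (L * (20 * w)%:R).
  by move=> kw; rewrite ler_expR ler_pM2l ?growth_gt0// ler_nat.
have k1 : (n.+1 <= 20 * w)%N by lia.
have k2 : (n <= 20 * w)%N by lia.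
have b0 : (20 * w - 2 <= 20 * w <= 20 * w)%N by lia.
have b1 : (20 * w - 2 <= n.+1 <= 20 * w)%N by lia.
have b2 : (20 * w - 2 <= n <= 20 * w)%N by lia.
move: (key _ k1) (key _ k2) Hx H1 H2; set e := expR (L * (20 * w)%:R).
set q := sup_norm _ _ _ _; set q' := entry_norm _ => h1 h2 h3 h4 h5.
have := leP (e / 8) `|blk (20 * w) x|; case=> [g|g1].
  by exists (20 * w)%N, x; split; [exact: b0 | exact: g].
have := leP (e / 8) `|blk n.+1 x|; case=> [g|g2].
  by exists n.+1, x; split; [exact: b1 | apply: le_trans g; rewrite ler_pM2r].
have := leP (e / 8) `|blk n.+1 (x + b)|; case=> [g|g3].
  by exists n.+1, (x + b); split; [exact: b1 | apply: le_trans g; rewrite ler_pM2r].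
have := leP (e / 8) `|blk n (x + b)|; case=> [g|g4].
  by exists n, (x + b); split; [exact: b2 | apply: le_trans g; rewrite ler_pM2r].
exfalso; move: g1 g2 g3 g4 h3 h4 h5; move: `|_| `|_| `|_| `|_| => p1 p2 p3 p4.
move: q q' e {h1 h2 key} => q q' e; lra.
Qed.

(** The product of denominators, which turns a determinant into a polynomial, varies
    subexponentially with the phase, so that it cancels in the interpolation. *)
Lemma den_ratio eps : 0 < eps -> exists K : R, forall (k : nat) x y,
  \prod_(j < k) den alpha (x + j%:R * b) <=
  \prod_(j < k) den alpha (y + j%:R * b) * expR (eps * k%:R + K).
Proof.
move=> e0; have [M HM] := ln_den_lipschitz am a1.
have [K HK] := birkhoff_sums_close HM
  (fun x m => congr1 (@ln R) (den_period alpha x m)) (diophantine_irr D) e0.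
exists K => k x y.
have H z : \prod_(j < k) den alpha (z + j%:R * b) = expR (\sum_(j < k) ln (den alpha (z + j%:R * b))).
  by rewrite expR_sum; apply: eq_bigr => j _; rewrite lnK// posrE den_gt0.
by rewrite !H -expRD ler_expR -lerBlDl; exact: HK.
Qed.

(** First sites of the blocks: 8 w of them, from -9 w on, for blocks of length about 20 w
    that contain the origin, then as many as needed from y - 16 w on, for blocks that contain
    y.  Both intervals leave a margin of order w between the site and the ends of the block,
    and the sum of two first sites exceeds the resonant index 1 - k by about 2 w at least. *)
Definition node_pos (w y l : nat) : int :=
  if (l < 8 * w)%N then l%:Z - (9 * w)%:Z else y%:Z - (16 * w)%:Z + (l - 8 * w)%N%:Z.

Lemma block_angle_node (w y k l : nat) :
  block_angle b (8 * w) (theta + (- (9 * w)%:Z%:~R + (k.-1)%:R / 2) * b)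
     (theta + ((y%:Z - (16 * w)%:Z)%:~R + (k.-1)%:R / 2) * b) l
  = theta + ((node_pos w y l)%:~R + (k.-1)%:R / 2) * b.
Proof.
rewrite /block_angle /node_pos; case: ifP => _.
  by rewrite intrB -[l%:Z%:~R]/(l%:R); ring.
by rewrite [X in _ = _ + (X + _) * _]intrD -[((l - 8 * w)%N%:Z)%:~R]/((l - 8 * w)%:R : R); ring.
Qed.

(** If all determinants at the nodes were below exp((L - eps) k), Lagrange interpolation
    with the weights of [node_product] would bound the determinant at every phase by
    k exp((L - eps / 2) k), up to a constant, contradicting [block_lower]. *)
Lemma large_node eps : 0 < eps -> exists w0 : nat, forall w y : nat, (w0 <= w)%N ->
  (20 * w <= y < 20 * w + 20)%N ->
  exists k : nat, exists n : int, [/\ (20 * w - 2 <= k <= 20 * w)%N,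
    expR ((L - eps) * k%:R) <= `|blk k (theta + n%:~R * b)| &
    (- (9 * w)%:Z <= n /\ n < - w%:Z) \/
    (y%:Z - (16 * w)%:Z <= n /\ n <= y%:Z - (4 * w)%:Z)].
Proof.
move=> e0.
have [w1 H1] := small_divisors D.
have [w2 H2] := nonresonance D nres.
have [w3 H3] := node_product D e0.
have [K HK] := den_ratio (divr_gt0 e0 (ltr0Sn R 3)).
have [X0 X01 HX] := exp_dominates (64 * expR K / eps) 1.
exists (maxn (maxn w1 w2) (maxn w3 (maxn 5 (Num.truncn (X0 / eps)).+1))) => w y.
rewrite !geq_max => /andP[/andP[ww1 ww2] /and3P[ww3 w5 wX]] /andP[y1 y2].
have w0 : (0 < w)%N by lia.
have [k [x [/andP[k1 k2] Hx]]] := block_lower w0.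
have k0 : (0 < k)%N by lia.
have [P [sP HP]] := block_det_poly lambda b am a1 E k0.
pose l2 := (k.+1 - 8 * w)%N; have Hn : (8 * w + l2 = k.+1)%N by rewrite /l2; lia.
pose t1 := theta + (- (9 * w)%:Z%:~R + (k.-1)%:R / 2) * b.
pose t2 := theta + ((y%:Z - (16 * w)%:Z)%:~R + (k.-1)%:R / 2) * b.
pose t := block_angle b (8 * w) t1 t2; pose N := node_pos w y.
have tE l : t l = theta + (N l)%:~R * b + (k.-1)%:R / 2 * b.
  by rewrite /t block_angle_node; ring.
have tB l i : t l - t i = (N l - N i)%:~R * b by rewrite !tE intrB; ring.
have tD l i : t l + t i = 2 * theta + (N l + N i + (k.-1)%:Z)%:~R * b.
  by rewrite !tE !intrD -[(k.-1)%:Z%:~R]/((k.-1)%:R : R); field.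
have NI l : (l < 8 * w + l2)%N -> (- (9 * w)%:Z <= N l /\ N l < - w%:Z) \/
    (y%:Z - (16 * w)%:Z <= N l /\ N l <= y%:Z - (4 * w)%:Z).
  clear -Hn k1 k2 y1 y2 w5; rewrite Hn /N /node_pos => lk.
  by case: ifPn; [left|right]; lia.
have Ninj l i : (l < 8 * w + l2)%N -> (i < 8 * w + l2)%N -> l != i -> N l - N i != 0.
  clear -Hn k1 k2 y1 y2 w5; rewrite Hn /N /node_pos => lk ik li.
  by case: ifPn; case: ifPn; lia.
have S1 (i l : 'I_(8 * w + l2)) : l != i ->
   expR (- (60 * w%:R) `^ (2 * r)^-1) <= `|sin (pi * (t l - t i))|.
  move=> li; rewrite tB; apply: H1 => //; first exact: Ninj.
  have := NI l (ltn_ord l); have := NI i (ltn_ord i).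
  move: (N l) (N i) => p q; clear -y1 y2 w5; lia.
have S2 (i l : 'I_(8 * w + l2)) : l != i ->
   expR (- (60 * w%:R) `^ (2 * r)^-1) <= `|sin (pi * (t l + t i))|.
  move=> li; rewrite tD.
  have := NI l (ltn_ord l); have := NI i (ltn_ord i).
  move: (N l) (N i) => p q h1 h2; apply: H2 => //;
    clear -y1 y2 w5 h1 h2 k1 k2; lia.
have lk : (8 * w + l2 <= 20 * w + 1)%N by rewrite Hn; clear -k2; lia.
have prd z (i : 'I_(8 * w + l2)) := H3 w (8 * w)%N l2 ww3 lk t1 t2 z i (S1 i) (S2 i).
pose X (l : 'I_(8 * w + l2)) : R := cos (2 * pi * t l).
have Xd l i : l != i -> 0 < `|X i - X l|.
  move=> li; rewrite cos2piB !mulr_gt0//.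
    by apply: lt_le_trans (S1 _ _ li); exact: expR_gt0.
  by apply: lt_le_trans (S2 _ _ li); exact: expR_gt0.
have Xinj : injective X.
  move=> l i XE; apply/eqP/negPn/negP => li.
  by have := Xd _ _ li; rewrite XE subrr normr0 ltxx.
(* From here on, all nodes are assumed to carry a small determinant. *)
apply: contrapT => Hno.
have small (l : 'I_(8 * w + l2)) : `|blk k (theta + (N l)%:~R * b)| <= expR ((L - eps) * k%:R).
  rewrite leNgt; apply/negP => /ltW big; apply: Hno; exists k, (N l); split=> //.
    by rewrite k1 k2.
  exact: NI.
pose xs := x + (k.-1)%:R / 2 * b.
pose Dx := \prod_(j < k) den alpha (x + j%:R * b).
have Dx0 : 0 < Dx by apply: prodr_gt0 => j _; exact: den_gt0.
have sP' : (size P <= 8 * w + l2)%N by rewrite Hn.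
have := lagrange_interpolation (cos (2 * pi * xs)) sP' Xinj.
rewrite -HP -/Dx => /(congr1 (fun z => `|z|)) Hlag.
have up : `|blk k x| * Dx <= k.+1%:R * (expR ((L - eps) * k%:R) * (Dx * expR (eps / 4 * k%:R + K)) * expR (eps * w%:R)).
  rewrite -[X in _ * X <= _](gtr0_norm Dx0) -normrM Hlag.
  apply: le_trans (ler_norm_sum _ _ _) _.
  set Z := (Z in _ <= _ * Z).
  have -> : k.+1%:R * Z = \sum_(i < 8 * w + l2) Z.
    by rewrite sumr_const card_ord Hn mulr_natl.
  rewrite /Z; apply: ler_sum => i _; rewrite normrM; apply: ler_pM; rewrite ?normr_ge0//.
    rewrite /X tE -HP normrM; apply: ler_pM; rewrite ?normr_ge0 ?small//.
    by rewrite ger0_norm ?HK// prodr_ge0// => j _; rewrite ltW// den_gt0.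
  rewrite normr_prod (eq_bigr (fun l => `|cos (2 * pi * xs) - X l| / `|X i - X l|)); last first.
    by move=> l _; rewrite normrM normfV.
  rewrite prodf_div ler_pdivrMr; last by apply: prodr_gt0 => l li; exact: Xd.
  by rewrite [leRHS]mulrC; exact: prd.
have Hx' : expR (L * k%:R) / 8 * Dx <= `|blk k x| * Dx by rewrite ler_pM2r.
have := le_trans Hx' up; clear up Hx' Hlag.
have -> : k.+1%:R * (expR ((L - eps) * k%:R) * (Dx * expR (eps / 4 * k%:R + K)) * expR (eps * w%:R))
  = (k.+1%:R * (expR ((L - eps) * k%:R) * expR (eps / 4 * k%:R + K) * expR (eps * w%:R))) * Dx by ring.
rewrite ler_pM2r// -!expRD => Hfin.
have kR : 4 * w%:R <= k%:R :> R by rewrite -natrM ler_nat; clear -k1 w5; lia.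
have k1R : 1 <= k%:R :> R by rewrite ler1n.
(* Cancelling the common factor exp(L k) leaves an exponential bounded by a linear function of k. *)
have e2 : expR (eps / 2 * k%:R) <= 8 * k.+1%:R * expR K.
  have : expR (L * k%:R) <= 8 * k.+1%:R * (expR K * expR (L * k%:R - eps / 2 * k%:R)).
    apply: le_trans (_ : 8 * (k.+1%:R * expR ((L - eps) * k%:R + (eps / 4 * k%:R + K) + eps * w%:R)) <= _).
      by rewrite [leRHS]mulrC -ler_pdivrMr.
    rewrite -[leRHS]mulrA ler_pM2l// ler_pM2l ?ltr0n// -expRD ler_expR.
    have := ler_wpM2l (ltW e0) kR; lra.
  rewrite expRB; set A := expR (L * _); set ee := expR (eps / 2 * _) => h.
  have A0 : 0 < A / ee by rewrite divr_gt0 ?expR_gt0.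
  rewrite -(ler_pM2r A0).
  have -> : ee * (A / ee) = A by rewrite mulrCA divff ?mulr1// gt_eqF// expR_gt0.
  by rewrite -[leRHS]mulrA.
have XX : X0 <= eps / 2 * k%:R.
  have := truncnS_gt (X0 / eps).
  have : (Num.truncn (X0 / eps)).+1%:R <= w%:R :> R by rewrite ler_nat.
  move=> h1 h2; have := lt_le_trans h2 h1; rewrite ltr_pdivrMr// => h3.
  have := ler_wpM2l (ltW e0) kR; lra.
have := le_trans (HX _ XX) e2; rewrite expr1.
have -> : 64 * expR K / eps * (eps / 2 * k%:R) = 32 * k%:R * expR K by field; rewrite gt_eqF.
rewrite ler_pM2r ?expR_gt0// -natr1; lra.
Qed.

Variable u : int -> R.
Hypothesis rec : forall n : int, u (n + 1) + u (n - 1) = (E - v (n%:~R * b + theta)) * u n.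

Lemma block_shift (x : int) m : continuant (fun i => E - v ((x + i%:Z)%:~R * b + theta)) m
  = blk m (theta + x%:~R * b).
Proof.
apply: eq_continuant => i _; congr (_ - v _); rewrite intrD -[i%:Z%:~R]/(i%:R : R); ring.
Qed.

(** In [green_identity], the determinants of the two sides are bounded by [block_upper]
    and the large determinant of the whole block is divided out. *)
Lemma green_bound eps : 0 < eps -> exists2 K, 0 < K & forall (x : int) (m l : nat),
  expR ((L - eps) * (m + l).+1%:R) <= `|blk (m + l).+1 (theta + x%:~R * b)| ->
  `|u (x + m%:Z)| <= K * expR (2 * eps * (m + l).+1%:R) *
    (expR (- (L * m.+1%:R)) * `|u (x - 1)| + expR (- (L * l.+1%:R)) * `|u (x + m%:Z + l%:Z + 1)|).
Proof.
move=> e0; have [K K0 HK] := block_upper e0; exists K => // x m l.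
set k := (m + l).+1 => Hb.
have := @green_identity R (fun n => E - v (n%:~R * b + theta)) u x m l rec.
rewrite !block_shift -/k => /(congr1 (fun z => `|z|)); rewrite normrM => HG.
set z := u (x + m%:Z) in HG *; set um := u (x - 1) in HG *; set up := u (_ + 1) in HG *.
have kE : k%:R = m%:R + l%:R + 1 :> R by rewrite /k -natr1 natrD.
have h1 : `|z| * expR ((L - eps) * k%:R) <= K * expR ((L + eps) * l%:R) * `|um| + K * expR ((L + eps) * m%:R) * `|up|.
  apply: le_trans (_ : `|blk k (theta + x%:~R * b)| * `|z| <= _).
    by rewrite mulrC ler_wpM2r.
  rewrite HG; apply: le_trans (ler_normD _ _) _; rewrite !normrM.
  by apply: lerD; rewrite ler_wpM2r.
have m0 : 0 <= eps * m%:R by rewrite mulr_ge0// ltW.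
have l0 : 0 <= eps * l%:R by rewrite mulr_ge0// ltW.
have E1 : expR ((L + eps) * l%:R) <= expR ((L - eps) * k%:R) * (expR (2 * eps * k%:R) * expR (- (L * m.+1%:R))).
  rewrite -!expRD ler_expR kE -natr1; lra.
have E2 : expR ((L + eps) * m%:R) <= expR ((L - eps) * k%:R) * (expR (2 * eps * k%:R) * expR (- (L * l.+1%:R))).
  rewrite -!expRD ler_expR kE -natr1; lra.
rewrite -(ler_pM2r (expR_gt0 ((L - eps) * k%:R))); apply: le_trans h1 _.
apply: le_trans (_ : K * (expR ((L - eps) * k%:R) * (expR (2 * eps * k%:R) * expR (- (L * m.+1%:R)))) * `|um|
   + K * (expR ((L - eps) * k%:R) * (expR (2 * eps * k%:R) * expR (- (L * l.+1%:R)))) * `|up| <= _).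
  by apply: lerD; rewrite ler_wpM2r// ler_pM2l.
by rewrite le_eqVlt; apply/orP; left; apply/eqP; ring.
Qed.

Variable Cu : R.
Hypothesis poly : forall n : int, `|u n| <= Cu * (1 + (`|n|%N)%:R).

Lemma Cu_ge0 : 0 <= Cu.
Proof. by have := poly 0; rewrite absz0 addr0 mulr1; apply: le_trans. Qed.

(** The site x + m is at least 9 w / 10 away from both ends of the block, which gives
    exp(- 9 L w / 10); the error terms of [green_bound] cost exp(2 L w / 5), and the linear
    growth of u is absorbed by exp(- L w / 10). *)
Lemma window_decay : exists2 K, 0 <= K & forall (w : nat) (x : int) (m l : nat),
  (0 < w)%N -> ((m + l).+1 <= 20 * w)%N -> (9 * w <= 10 * m.+1)%N -> (9 * w <= 10 * l.+1)%N ->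
  (absz (x - 1)%R <= 60 * w)%N -> (absz (x + m%:Z + l%:Z + 1)%R <= 60 * w)%N ->
  expR ((L - L / 100) * (m + l).+1%:R) <= `|blk (m + l).+1 (theta + x%:~R * b)| ->
  `|u (x + m%:Z)| <= K * expR (- (2 / 5 * L * w%:R)).
Proof.
have L0 := growth_gt0; have C0 := Cu_ge0.
have e0 : 0 < L / 100 by lra.
have [K K0 HK] := green_bound e0.
have q0 : 0 <= 10 / L by rewrite divr_ge0// ltW.
exists (K * (2 * Cu * (61 * (10 / L)))); first by apply: mulr_ge0; [exact: ltW | apply: mulr_ge0; exact: mulr_ge0].
move=> w x m l w0 kw mw lw xw xw' Hb.
apply: le_trans (HK x m l Hb) _; rewrite -[leLHS]mulrA -[leRHS]mulrA ler_pM2l//.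
have bnd n : (`|n| <= 60 * w)%N -> `|u n| <= Cu * (61 * w%:R).
  move=> nw; apply: le_trans (poly n) _; rewrite ler_wpM2l//.
  rewrite -natrM -[1]/(1%:R) -natrD ler_nat; clear -nw w0; lia.
have u1 := bnd _ xw; have u2 := bnd _ xw'.
have kR : (m + l).+1%:R <= 20 * w%:R :> R by rewrite -natrM ler_nat.
have mR : 9 * w%:R <= 10 * m.+1%:R :> R by rewrite -!natrM ler_nat.
have lR : 9 * w%:R <= 10 * l.+1%:R :> R by rewrite -!natrM ler_nat.
have eM : expR (- (L * m.+1%:R)) <= expR (- (9 / 10 * L * w%:R)).
  rewrite ler_expR lerN2; have := ler_wpM2l (ltW L0) mR; lra.
have eL : expR (- (L * l.+1%:R)) <= expR (- (9 / 10 * L * w%:R)).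
  rewrite ler_expR lerN2; have := ler_wpM2l (ltW L0) lR; lra.
have eK : expR (2 * (L / 100) * (m + l).+1%:R) <= expR (2 / 5 * L * w%:R).
  rewrite ler_expR; have := ler_wpM2l (ltW L0) kR; lra.
apply: le_trans (_ : expR (2 / 5 * L * w%:R) * (expR (- (9 / 10 * L * w%:R)) * (Cu * (61 * w%:R))
    + expR (- (9 / 10 * L * w%:R)) * (Cu * (61 * w%:R))) <= _).
  apply: ler_pM; rewrite ?expR_ge0 ?addr_ge0 ?mulr_ge0 ?expR_ge0// ?eK//.
  - by apply: lerD; apply: ler_pM; rewrite ?expR_ge0.
have w1 : w%:R * expR (- (1 / 10 * L * w%:R)) <= 10 / L.
  rewrite expRN ler_pdivrMr ?expR_gt0//.
  have h := expR_ge1Dx (1 / 10 * L * w%:R).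
  have h' : 1 / 10 * L * w%:R <= expR (1 / 10 * L * w%:R) by lra.
  rewrite mulrAC ler_pdivlMr//; lra.
have -> : expR (- (9 / 10 * L * w%:R)) =
   expR (- (2 / 5 * L * w%:R)) * expR (- (2 / 5 * L * w%:R)) * expR (- (1 / 10 * L * w%:R)).
  by rewrite -!expRD; congr expR; lra.
have ee : expR (2 / 5 * L * w%:R) * expR (- (2 / 5 * L * w%:R)) = 1 by rewrite expRxMexpNx_1.
set e1 := expR (2 / 5 * _ * _) in ee *; set e2 := expR (- (2 / 5 * _ * _)) in ee *.
set e3 := expR _ in w1 *.
have -> : e1 * (e2 * e2 * e3 * (Cu * (61 * w%:R)) + e2 * e2 * e3 * (Cu * (61 * w%:R))) =
   (e1 * e2) * (e2 * (2 * Cu * 61)) * (w%:R * e3) by ring.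
rewrite ee mul1r; have c0 : 0 <= e2 * (2 * Cu * 61) by rewrite !mulr_ge0 ?expR_ge0.
apply: le_trans (ler_wpM2l c0 w1) _.
rewrite le_eqVlt; apply/orP; left; apply/eqP; ring.
Qed.

(** Apply [large_node] with w = y / 20.  A large determinant near the origin gives, by
    [window_decay], a bound on |u p| that tends to 0 with w, which is absurd for large w; a
    large determinant near y gives the decay at y. *)
Lemma one_sided_decay (p : int) : u p != 0 -> exists2 K, 0 <= K & forall y : nat,
  `|u y%:Z| <= K * expR (- (L / 50 * y%:R)).
Proof.
move=> up0; have L0 := growth_gt0; have C0 := Cu_ge0.
have [K K0 HK] := window_decay.
have e0 : 0 < L / 100 by lra.
have [w1 H1] := large_node e0.
have up : 0 < `|u p| by rewrite normr_gt0.
pose w2 := maxn (maxn w1 5) (maxn (10 * `|p|) (Num.truncn (K / `|u p| / (2 / 5 * L))).+1).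
have big (y : nat) : (20 * w2 <= y)%N -> `|u y%:Z| <= K * expR (- (2 / 5 * L * (y %/ 20)%:R)).
  move=> yw; set w := (y %/ 20)%N.
  have ww2 : (w2 <= w)%N by rewrite /w leq_divRL// mulnC.
  have [ww1 w5 wp wX] : [/\ (w1 <= w)%N, (5 <= w)%N, (10 * `|p| <= w)%N &
      ((Num.truncn (K / `|u p| / (2 / 5 * L))).+1 <= w)%N].
    by move: ww2; rewrite /w2 !geq_max => /andP[/andP[-> ->] /andP[-> ->]].
  have y12 : (20 * w <= y < 20 * w + 20)%N.
    exact: divn20_bounds.
  have [k [n [/andP[k1 k2] Hb]]] := H1 w y ww1 y12.
  case=> [[n1 n2]|[n1 n2]].
  (* The large determinant is near the origin: this contradicts u p != 0. *)
  - pose m := absz (p - n); pose l := (k - m.+1)%N.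
    have pn : p = n + m%:Z by rewrite /m; clear -n2 wp w5; lia.
    have kE : k = (m + l).+1 by rewrite /l /m; clear -n1 n2 k1 k2 wp w5; lia.
    rewrite kE in Hb.
    have := HK w n m l; rewrite -pn.
    have -> : (0 < w)%N by clear -w5; lia.
    have -> : ((m + l).+1 <= 20 * w)%N by rewrite -kE.
    have -> : (9 * w <= 10 * m.+1)%N by rewrite /m; clear -n1 n2 wp w5; lia.
    have -> : (9 * w <= 10 * l.+1)%N by rewrite /l /m; clear -n1 n2 k1 k2 wp w5; lia.
    have -> : (absz (n - 1)%R <= 60 * w)%N by clear -n1 n2 wp w5; lia.
    have -> : (absz (p + l%:Z + 1)%R <= 60 * w)%N by rewrite /l /m; clear -n1 n2 k1 k2 wp w5; lia.
    move=> /(_ isT isT isT isT isT isT Hb) Hup; exfalso.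
    move: Hup; rewrite expRN ler_pdivlMr ?expR_gt0// -ler_pdivlMl//.
    have h := expR_ge1Dx (2 / 5 * L * w%:R).
    have h1 := truncnS_gt (K / `|u p| / (2 / 5 * L)).
    have h2 : (Num.truncn (K / `|u p| / (2 / 5 * L))).+1%:R <= w%:R :> R by rewrite ler_nat.
    have := lt_le_trans h1 h2; rewrite ltr_pdivrMr; last lra.
    rewrite [_^-1 * _]mulrC => h3; lra.
  - pose m := absz (y%:Z - n); pose l := (k - m.+1)%N.
    have pn : y%:Z = n + m%:Z by rewrite /m; clear -n2 w5; lia.
    have kE : k = (m + l).+1 by rewrite /l /m; clear -n1 n2 k1 k2 w5; lia.
    rewrite kE in Hb.
    have := HK w n m l; rewrite -pn; apply.
    + by clear -w5; lia.
    + by rewrite -kE.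
    + by rewrite /m; clear -n1 n2 w5; lia.
    + by rewrite /l /m; clear -n1 n2 k1 k2 w5; lia.
    + by clear -n1 n2 w5 y12; lia.
    + by rewrite /l /m; clear -n1 n2 k1 k2 w5 y12; lia.
    + exact: Hb.
pose B := Cu * (1 + (20 * w2)%:R) * expR (L / 50 * (20 * w2)%:R).
have B0 : 0 <= B by rewrite !mulr_ge0 ?expR_ge0 ?addr_ge0.
exists (K * expR (2 / 5 * L) + B); first by rewrite addr_ge0 ?mulr_ge0 ?expR_ge0.
move=> y; rewrite mulrDl; case: (leqP (20 * w2) y) => yw.
  rewrite -[leLHS]addr0; apply: lerD; last by rewrite mulr_ge0 ?expR_ge0.
  apply: le_trans (big y yw) _; rewrite -[leRHS]mulrA ler_wpM2l// -expRD ler_expR.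
  have : y%:R <= 20 * ((y %/ 20)%:R + 1) :> R.
    rewrite natr1 -natrM ler_nat mulnS addnC.
    by case/andP: (divn20_bounds y) => _ /ltnW.
  move=> h; have := ler_wpM2l (ltW L0) h; lra.
rewrite -[leLHS]add0r; apply: lerD; first by rewrite !mulr_ge0 ?expR_ge0.
apply: le_trans (poly _) _; rewrite /B -[leRHS]mulrA.
apply: (@le_trans _ _ (Cu * (1 + (20 * w2)%:R))).
  by rewrite ler_wpM2l// lerD2l ler_nat absz_nat ltnW.
rewrite ler_peMr ?mulr_ge0 ?addr_ge0// -expRD.
apply: le_trans (expR_ge1Dx _); rewrite lerDl subr_ge0 ler_wpM2l//.
  by lra.
by rewrite ler_nat ltnW.
Qed.

End Core.

Section TwoSided.
Context {R : realType}.
Variables (alpha lambda c r b theta E : R).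
Hypotheses (am : -1 < alpha) (a1 : alpha < 1).
Hypothesis D : diophantine c r b.
Local Notation v := (potential alpha lambda).
Hypothesis lyap_gt0 : 0 < lyapunov v b (rc E).

(** The resonance condition at -t for n is the one at t for -n. *)
Lemma resonantN (t : R) : resonant r b (- t) -> resonant r b t.
Proof.
move=> H fin; apply: H.
apply: (sub_finite_set _ (finite_image (fun n : int => - n) fin)).
move=> n /= H; exists (- n); rewrite ?opprK//= abszN.
have -> : 2 * pi * (t + (- n)%:~R / 2 * b) = - (2 * pi * (- t + n%:~R / 2 * b)).
  by rewrite rmorphN /=; ring.
by rewrite sinN normrN.
Qed.

(** The left half-line follows from the right one by reflection: n |-> u(-n) is a solution
    for the phase - theta, because v is even. *)
Lemma solution_decay (u : int -> R) (Cu : R) : ~ resonant r b theta ->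
  (forall n : int, u (n + 1) + u (n - 1) = (E - v (n%:~R * b + theta)) * u n) ->
  (forall n : int, `|u n| <= Cu * (1 + (`|n|%N)%:R)) ->
  exists K kappa : R, [/\ 0 <= K, 0 < kappa &
    forall n : int, `|u n| <= K * expR (- (kappa * (`|n|%N)%:R))].
Proof.
move=> nres rec poly.
have L0 := growth_gt0 am a1 lyap_gt0.
case: (pselect (exists p, u p != 0)) => [[p up]|no]; last first.
  exists 0, 1; split=> // n; rewrite mul0r normr_le0.
  by apply/negPn/negP => un; apply: no; exists n.
have [K K0 HK] := one_sided_decay am a1 D nres lyap_gt0 rec poly up.
have nres' : ~ resonant r b (- theta) by move/resonantN.
have rec' (n : int) : u (- (n + 1)) + u (- (n - 1)) = (E - v (n%:~R * b + - theta)) * u (- n).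
  have := rec (- n); rewrite -(potentialN _ _ (n%:~R * b + - theta)).
  have -> : - (n%:~R * b + - theta) = (- n)%:~R * b + theta by rewrite rmorphN /=; ring.
  by move=> <-; rewrite addrC; congr (u _ + u _); lia.
have poly' (n : int) : `|u (- n)| <= Cu * (1 + (`|n|%N)%:R).
  by have := poly (- n); rewrite abszN.
have up' : u (- - p) != 0 by rewrite opprK.
have [K' K0' HK'] := one_sided_decay (u := fun n => u (- n)) am a1 D nres' lyap_gt0 rec' poly' up'.
exists (K + K'), (growth_rate v b E / 50); split; [exact: addr_ge0 | lra |].
case=> n; rewrite ?NegzE ?abszN ?absz_nat mulrDl.
  by apply: le_trans (HK n) _; rewrite lerDl mulr_ge0 ?expR_ge0.
by apply: le_trans (HK' n.+1) _; rewrite lerDr mulr_ge0 ?expR_ge0.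
Qed.

End TwoSided.

(** * Finite-volume eigenvectors *)

Section FiniteVolume.
Context {R : realType}.
Local Notation C := R[i].

Lemma normc_sum (I : Type) (s : seq I) (P : pred I) (F : I -> C) :
  normc (\sum_(i <- s | P i) F i) <= \sum_(i <- s | P i) normc (F i).
Proof.
elim/big_ind2: _ => [|x1 x2 y1 y2 h1 h2|//]; first by rewrite normc0_eq.
by apply: le_trans (le_normcD _ _) _; exact: lerD.
Qed.

Lemma conjc_mul_self (z : C) : z^* * z = (normc z ^+ 2)%:C.
Proof.
case: z => a d; rewrite /normc sqr_sqrtr ?addr_ge0 ?sqr_ge0//.
by apply/eqP; rewrite eq_complex /= ?expr2; apply/andP; split; apply/eqP; ring.
Qed.

Lemma normc_conj (z : C) : normc z^* = normc z.
Proof. by case: z => a d; rewrite /normc /= sqrrN. Qed.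

Lemma abs_Im_le_normc (z : C) : `|complex.Im z| <= normc z.
Proof.
case: z => a d; rewrite /normc /= -sqrtr_sqr ler_wsqrtr// lerDr sqr_ge0 //.
Qed.

Lemma abs_Re_le_normc (z : C) : `|complex.Re z| <= normc z.
Proof.
case: z => a d; rewrite /normc /= -sqrtr_sqr ler_wsqrtr// lerDl sqr_ge0 //.
Qed.

(** The second property is the completeness of the eigenvectors, which lets values of a
    sequence be recovered from its coefficients. *)
Lemma symmetric_spectral n (A : 'M[R]_n) : A^T = A ->
  exists (d : 'I_n -> R) (f : 'I_n -> 'I_n -> C),
  (forall k l, \sum_j f k j * (A j l)%:C = (d k)%:C * f k l) /\
  (forall i j, \sum_k (f k i)^* * f k j = (i == j)%:R).
Proof.
move=> AT; pose B : 'M[C]_n := map_mx (fun t => t%:C) A.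
have Bherm : B \is hermsymmx.
  apply: realsym_hermsym.
    apply/is_hermitianmxP; rewrite expr0 scale1r; apply/matrixP => i j; rewrite !mxE.
    by rewrite -[in RHS]AT mxE.
  apply/mxOverP => i j; rewrite mxE; apply/complex_realP; by exists (A i j).
have /hermitian_normalmx/orthomx_spectralP BE := Bherm.
have U := spectral_unitarymx B; have Uu := spectral_unit B.
set P := spectralmx B in BE U Uu; set D := spectral_diag B in BE.
have PB : P *m B = diag_mx D *m P by rewrite {1}BE !mulmxA mulmxV// mul1mx.
have Dreal k : exists t : R, D 0 k = t%:C.
  have /mxOverP/(_ 0 k)/complex_realP[t tE] := hermitian_spectral_diag_real Bherm.
  by exists t.
exists (fun k => complex.Re (D 0 k)), (fun k j => P k j); split.
  move=> k l; have /matrixP/(_ k l) := PB; rewrite !mxE => H.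
  transitivity ((P *m B) k l).
    by rewrite mxE; apply: eq_bigr => j _; rewrite !mxE.
  rewrite PB mul_diag_mx mxE; have [t ->] := Dreal k; by [].
move=> i j; have := mulVmx Uu; rewrite invmx_unitary// => /matrixP/(_ i j); rewrite !mxE => <-.
by apply: eq_bigr => k _; rewrite !mxE.
Qed.

Definition finite_volume_data (V : int -> R) (N : nat)
    (d : 'I_N.*2.+1 -> R) (psi : 'I_N.*2.+1 -> int -> C) :=
  [/\ forall k (m : int), (`|m| <= N)%N ->
        psi k (m + 1) + psi k (m - 1) + (V m)%:C * psi k m = (d k)%:C * psi k m,
      forall k (m : int), (N < `|m|)%N -> psi k m = 0
    & forall i j : int, (`|i| <= N)%N -> (`|j| <= N)%N ->
        \sum_k (psi k i)^* * psi k j = (i == j)%:R].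

Lemma finite_volume (V : int -> R) (N : nat) :
  exists (d : 'I_N.*2.+1 -> R) (psi : 'I_N.*2.+1 -> int -> C), finite_volume_data V d psi.
Proof.
have aux (p : nat) : (p < N.*2.+1)%N -> (absz (p%:Z - N%:Z)%R <= N)%N by lia.
have aux2 (p : nat) : absz (p%:Z - N%:Z + N%:Z)%R = p by lia.
set n := N.*2.+1.
pose A : 'M[R]_n := \matrix_(i, j) ((i == j)%:R * V (i%:Z - N%:Z) + (i == j.+1 :> nat)%:R + (j == i.+1 :> nat)%:R).
have AT : A^T = A.
  apply/matrixP => i j; rewrite !mxE eq_sym addrAC; congr (_ + _ + _).
  by have [->|] := eqVneq i j; rewrite ?mul0r.
have [d [f [H1 H2]]] := symmetric_spectral AT.
pose psi k (m : int) : C := if (`|m| <= N)%N then f k (inord (absz (m + N%:Z)%R)) else 0.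
have psiE k (i : 'I_n) : psi k (i%:Z - N%:Z) = f k i.
  rewrite /psi; have := ltn_ord i; rewrite /n => il.
  by rewrite aux// aux2 inord_val.
have sumE k (m : nat) : \sum_(j < n) f k j * (j == m :> nat)%:R = psi k (m%:Z - N%:Z).
  have [mn|nm] := ltnP m n.
    rewrite (bigD1 (Ordinal mn))//= eqxx mulr1 big1 ?addr0; last first.
      by move=> j; rewrite -val_eqE /= => /negbTE ->; rewrite mulr0.
    by rewrite -(psiE k (Ordinal mn)).
  rewrite big1; last first.
    by move=> j _; case: eqP => [jm|]; rewrite ?mulr0//; have := ltn_ord j; lia.
  by rewrite /psi; case: ifP => //; rewrite /n in nm; lia.
exists d, psi; split.
- move=> k m mN.
  pose l : 'I_n := inord (absz (m + N%:Z)%R).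
  have lE : (l : nat) = absz (m + N%:Z) by rewrite /l inordK//; rewrite /n; lia.
  have mE : m = l%:Z - N%:Z by rewrite lE; lia.
  have -> : psi k m = f k l by rewrite mE psiE.
  rewrite -H1.
  have -> : \sum_j f k j * (A j l)%:C = \sum_(j < n) f k j * (j == l :> nat)%:R * (V m)%:C
      + \sum_(j < n) f k j * (j == l.+1 :> nat)%:R + \sum_(j < n) f k j * (l == j.+1 :> nat)%:R.
    rewrite -!big_split /=; apply: eq_bigr => j _; rewrite mxE !rmorphD rmorphM !rmorph_nat /=.
    rewrite mE; case: (eqVneq j l) => [->|jl]; first by rewrite eqxx; ring.
    rewrite (_ : (j == l :> nat) = false); last exact/negbTE.
    by rewrite !(mulr0n, mul0r, mulr0, add0r) mulrDr.
  rewrite -mulr_suml !sumE [(l.+1)%:Z - _](_ : _ = m + 1); last by lia.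
  rewrite -mE.
  have -> : \sum_(j < n) f k j * (l == j.+1 :> nat)%:R = psi k (m - 1).
    case El : (nat_of_ord l) => [|l'].
      rewrite big1; first by rewrite /psi; case: ifP => //; lia.
      by move=> j _; rewrite mulr0.
    under eq_bigr do rewrite eqSS eq_sym.
    by rewrite sumE; congr psi; lia.
  have -> : psi k m = f k l by rewrite mE psiE.
  ring.
- by move=> k m mN; rewrite /psi leqNgt mN.
- move=> i j iN jN; rewrite /psi iN jN H2; congr (_%:R : C).
  congr nat_of_bool; apply/eqP/eqP => [/(congr1 val)|->//].
  by rewrite /= !inordK ?/n; lia.
Qed.

Lemma box_delta (N : nat) (i : int) (F : int -> C) : (`|i| <= N)%N ->
  \sum_(j < N.*2.+1) F (j%:Z - N%:Z) * (i == j%:Z - N%:Z)%:R = F i.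
Proof.
move=> iN; have lt : (absz (i + N%:Z)%R < N.*2.+1)%N by lia.
rewrite (bigD1 (Ordinal lt))//= big1 ?addr0; last first.
  move=> j; rewrite -val_eqE /= => jl; rewrite (_ : (i == _) = false) ?mulr0//.
  by apply/negbTE; apply: contra jl => /eqP ->; apply/eqP; lia.
have -> : (absz (i + N%:Z)%R)%:Z - N%:Z = i by lia.
by rewrite eqxx mulr1.
Qed.

Lemma box_telescope (Z : zmodType) (N : nat) (T : int -> Z) :
  \sum_(j < N.*2.+1) (T (j%:Z - N%:Z) - T (j%:Z - N%:Z - 1)) = T N%:Z - T (- N%:Z - 1).
Proof.
rewrite (eq_bigr (fun j : 'I__ => T (j.+1%:Z - N%:Z - 1) - T (j%:Z - N%:Z - 1))); last first.
  by move=> j _; congr (T _ - _); lia.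
rewrite -(big_mkord xpredT (fun j => T (j.+1%:Z - N%:Z - 1) - T (j%:Z - N%:Z - 1))).
rewrite (telescope_sumr (fun j => T (j%:Z - N%:Z - 1)))//.
by congr (T _ - T _); lia.
Qed.

Lemma im_resolvent_ge (d : R) (z : C) : complex.Im z <= normc (d%:C - z).
Proof.
apply: le_trans (abs_Im_le_normc _); case: z => a y /=.
by rewrite sub0r normrN ler_norm.
Qed.

(** Expand w in the eigenvectors.  By Green's formula the coefficient of w along psi_k is
    that of the finite-volume resolvent, up to a boundary term that involves only w just
    outside the box; the sum over k of the errors is bounded by Cauchy-Schwarz and by
    completeness. *)
Lemma finite_volume_resolvent (V : int -> R) (N : nat) (i : int) (w : int -> C) (z : C)
  (d : 'I_N.*2.+1 -> R) (psi : 'I_N.*2.+1 -> int -> C) :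
  finite_volume_data V d psi -> (`|i| <= N)%N -> 0 < complex.Im z ->
  (forall m, w (m + 1) + w (m - 1) + (V m)%:C * w m - z * w m = (i == m)%:R) ->
  normc (w i - \sum_k (normc (psi k i) ^+ 2)%:C / ((d k)%:C - z)) <=
    (normc (w (N%:Z + 1)) + normc (w (- N%:Z - 1))) / complex.Im z.
Proof.
move=> [Hpsi psi0 compl] iN y0 Hw.
pose c k := \sum_(j < N.*2.+1) psi k (j%:Z - N%:Z) * w (j%:Z - N%:Z).
pose B k := psi k N%:Z * w (N%:Z + 1) + psi k (- N%:Z) * w (- N%:Z - 1).
have jN (j : 'I_N.*2.+1) : (absz (j%:Z - N%:Z)%R <= N)%N by have := ltn_ord j; lia.
have dz k : (d k)%:C - z != 0.
  apply/eqP => /(congr1 (@complex.Im R)) /=; case: (z) y0 => a y /= y0.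
  by rewrite sub0r => /eqP; rewrite oppr_eq0 gt_eqF.
have cE k : c k = (psi k i - B k) / ((d k)%:C - z).
  apply: (mulIf (dz k)); rewrite divfK//.
  (* The Wronskian, whose increments are the summands of Green's formula. *)
pose T m := psi k m * w (m + 1) - psi k (m + 1) * w m.
  have -> : B k = \sum_(j < N.*2.+1) (T (j%:Z - N%:Z) - T (j%:Z - N%:Z - 1)).
    rewrite (box_telescope N T) /T (psi0 k (N%:Z + 1)); last by lia.
    rewrite (psi0 k (- N%:Z - 1)); last by lia.
    by rewrite !subrK !mul0r subr0 sub0r opprK.
  rewrite -(box_delta (psi k) iN) -sumrB /c mulr_suml; apply: eq_bigr => j _.
  rewrite -Hw; have := Hpsi k _ (jN j); set m := j%:Z - N%:Z => Hm.
  rewrite /T subrK.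
  have -> : psi k m * w m * ((d k)%:C - z) = ((d k)%:C * psi k m) * w m - z * (psi k m * w m) by ring.
  rewrite -Hm; ring.
have wE : w i = \sum_k (psi k i)^* * c k.
  under eq_bigr do rewrite /c mulr_sumr.
  rewrite exchange_big /= -(box_delta w iN); apply: eq_bigr => j _.
  rewrite -compl// mulrC mulr_suml; apply: eq_bigr => k _; ring.
have -> : w i - \sum_k (normc (psi k i) ^+ 2)%:C / ((d k)%:C - z) =
   - \sum_k (psi k i)^* * B k / ((d k)%:C - z).
  rewrite wE -sumrB -sumrN; apply: eq_bigr => k _; rewrite cE -conjc_mul_self; ring.
rewrite normcN; apply: le_trans (normc_sum _ _ _) _.
have one j : (`|j| <= N)%N -> \sum_k normc (psi k j) ^+ 2 = 1.
  move=> jN'; have := compl j j jN' jN'; rewrite eqxx.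
  under eq_bigr do rewrite conjc_mul_self.
  by rewrite -rmorph_sum => /(congr1 (@complex.Re R)).
set W1 := normc (w _); set W2 := normc (w _).
have W10 : 0 <= W1 by exact: normc_ge0. have W20 : 0 <= W2 by exact: normc_ge0.
apply: (@le_trans _ _ (\sum_k ((normc (psi k i) ^+ 2 + normc (psi k N%:Z) ^+ 2) / 2 * (W1 / complex.Im z)
   + (normc (psi k i) ^+ 2 + normc (psi k (- N%:Z)) ^+ 2) / 2 * (W2 / complex.Im z)))).
  apply: ler_sum => k _; rewrite !normcM normcV normc_conj.
  have nz := im_resolvent_ge (d k) z.
  have BB : normc (B k) <= normc (psi k N%:Z) * W1 + normc (psi k (- N%:Z)) * W2.
    by apply: le_trans (le_normcD _ _) _; rewrite !normcM.
  apply: (@le_trans _ _ (normc (psi k i) * (normc (psi k N%:Z) * W1 + normc (psi k (- N%:Z)) * W2) / complex.Im z)).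
    apply: ler_pM; rewrite ?mulr_ge0 ?invr_ge0 ?normc_ge0//.
      by rewrite ler_wpM2l ?normc_ge0.
    by rewrite lef_pV2 ?posrE// (lt_le_trans y0).
  rewrite !mulrA -mulrDl ler_pM2r ?invr_gt0//.
  move: (normc (psi k i)) (normc (psi k N%:Z)) (normc (psi k (- N%:Z))) => p q s.
  have := sqr_ge0 (p - q); have := sqr_ge0 (p - s); nra.
rewrite big_split /= -!mulr_suml !big_split /= !one ?absz_nat ?abszN ?absz_nat//.
rewrite mulrDl le_eqVlt; apply/orP; left; apply/eqP; field; by rewrite gt_eqF.
Qed.

End FiniteVolume.

(** * Square-summable sequences and spectral measures *)

Section SquareSummable.
Context {R : realType}.
Local Notation C := R[i].
Implicit Types (u w : int -> C).

(** Finite sums over duplicate-free lists are enough to handle the l2 norm, and avoid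
    manipulating unordered sums. *)
Definition partial_sqnorm (s : seq int) u : R := \sum_(n <- s) normc (u n) ^+ 2.

Lemma l2_sqnorm_ge0 u : (0 <= l2_sqnorm u)%E.
Proof. by apply: esum_ge0 => n _; rewrite lee_fin sqr_ge0. Qed.

Lemma l2_sqnorm_fin u : l2 u -> l2_sqnorm u \is a fin_num.
Proof. by move=> H; rewrite ge0_fin_numE ?l2_sqnorm_ge0. Qed.

Lemma partial_le_sqnorm s u : uniq s -> ((partial_sqnorm s u)%:E <= l2_sqnorm u)%E.
Proof.
move=> us; apply: esum_ge; exists [set` s].
  by split => //; exact: finite_seq.
by rewrite -fsbig_seq// sumEFin.
Qed.

Lemma l2_of_bound u M : (forall s, uniq s -> partial_sqnorm s u <= M) ->
  l2 u /\ (l2_sqnorm u <= M%:E)%E.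
Proof.
move=> H; have : (l2_sqnorm u <= M%:E)%E.
  apply: ge_ereal_sup => _ [X [finX _] <-].
  by rewrite fsbig_finite// sumEFin lee_fin; apply: H; exact: finmap.fset_uniq.
by move=> h; split=> //; apply: le_lt_trans h _; rewrite ltry.
Qed.

Lemma l2_norm_ge0 u : 0 <= l2_norm u. Proof. exact: sqrtr_ge0. Qed.

Lemma l2_norm_sqr u : l2_norm u ^+ 2 = fine (l2_sqnorm u).
Proof. by rewrite sqr_sqrtr// fine_ge0// l2_sqnorm_ge0. Qed.

Lemma l2_sqnormE u : l2 u -> l2_sqnorm u = (l2_norm u ^+ 2)%:E.
Proof. by move=> H; rewrite l2_norm_sqr fineK// l2_sqnorm_fin. Qed.

Lemma partial_le_norm s u : l2 u -> uniq s -> partial_sqnorm s u <= l2_norm u ^+ 2.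
Proof. by move=> lu us; rewrite -lee_fin -l2_sqnormE//; exact: partial_le_sqnorm. Qed.

Lemma l2_norm_le u M : 0 <= M -> (forall s, uniq s -> partial_sqnorm s u <= M ^+ 2) ->
  l2 u /\ l2_norm u <= M.
Proof.
move=> M0 /l2_of_bound[lu H]; split=> //.
rewrite -(@ler_pXn2r _ 2)// ?nnegrE ?l2_norm_ge0//.
by rewrite -lee_fin -l2_sqnormE.
Qed.

Lemma normc_le_l2 u n : l2 u -> normc (u n) <= l2_norm u.
Proof.
move=> lu; rewrite -(@ler_pXn2r _ 2)// ?nnegrE ?l2_norm_ge0 ?normc_ge0//.
by have := partial_le_norm (s := [:: n]) lu isT; rewrite /partial_sqnorm big_seq1.
Qed.

Lemma l2_small_at_infinity u : l2 u -> forall e, 0 < e ->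
  exists N0 : nat, forall n : int, (N0 <= `|n|)%N -> normc (u n) <= e.
Proof.
move=> lu e e0.
pose A := [set partial_sqnorm s u | s in [set s | uniq s]].
have hA : has_sup A.
  split; first by exists (partial_sqnorm [::] u), [::].
  by exists (l2_norm u ^+ 2) => _ [s us <-]; exact: partial_le_norm.
have [_ [s us <-] Hs] := sup_adherent (exprn_gt0 2 e0) hA.
exists (\sum_(m <- s) `|m|).+1 => n nN.
have ns : n \notin s.
  by apply/negP => ns; move: nN; rewrite (big_rem n)//= ltnNge leq_addr.
have : partial_sqnorm (n :: s) u <= sup A.
  by apply: ub_le_sup; [case: hA | exists (n :: s) => //=; rewrite ns].
rewrite /partial_sqnorm big_cons -/(partial_sqnorm s u) => h.
rewrite -(@ler_pXn2r _ 2)// ?nnegrE ?normc_ge0 ?(ltW e0)//.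
move: Hs h; move: (partial_sqnorm _ _) (sup _) (_ ^+ 2) (_ ^+ 2) => p q x y; lra.
Qed.

Lemma deltaE (i n : int) : delta R i n = (i == n)%:R.
Proof. by rewrite /delta eq_sym. Qed.

Lemma l2_delta (i : int) : l2 (delta R i).
Proof.
apply: (proj1 (l2_of_bound (M := 1) _)) => s us; rewrite /partial_sqnorm.
have [is_|nis] := boolP (i \in s).
  rewrite (big_rem i)//= big1_seq ?addr0.
    rewrite /delta eqxx -[1%:R]/(rc 1) normc_rc normr1 expr1n //.
  move=> n /andP[_]; rewrite mem_rem_uniq// inE => /andP[/negbTE ni _].
  by rewrite /delta ni normc0_eq expr0n.
rewrite big1_seq// => n /andP[_ ns].
rewrite /delta; case: eqP => [ni|_]; first by rewrite -ni ns in nis.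
by rewrite normc0_eq expr0n.
Qed.

Lemma l2_dot_delta (i : int) w : l2_dot (delta R i) w = w i.
Proof.
have E : forall N : nat, (`|i| <= N)%N -> l2_partial_dot (delta R i) w N = w i.
  move=> N iN; rewrite /l2_partial_dot -[RHS](box_delta w iN); apply: eq_bigr => j _.
  by rewrite deltaE mulrC; case: (i == _); rewrite ?rmorph1 ?rmorph0.
rewrite /l2_dot.
have H (f : C -> R) : limn (fun N => f (l2_partial_dot (delta R i) w N)) = f (w i).
  apply: cvg_lim => //; apply: cvg_near_cst.
  by exists `|i|%N => // N /= iN; rewrite E.
by rewrite !H; case: (w i).
Qed.

End SquareSummable.

Section SpectralMeasure.
Context {R : realType}.
Local Notation C := R[i].
Variables (v : R -> R) (b theta : R).
Let V (n : int) := v (n%:~R * b + theta).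
Let H := hamiltonian v b theta.

(** The Poisson kernel of the upper half-plane, up to the factor 1 / pi. *)
Definition poisson (x y t : R) : R := y / ((t - x) ^+ 2 + y ^+ 2).

Lemma im_resolvent (x y t : R) : 0 < y ->
  complex.Im ((t%:C - (x +i* y))^-1) = poisson x y t.
Proof.
move=> y0; rewrite /poisson.
have D0 : (t - x) ^+ 2 + y ^+ 2 != 0.
  by rewrite gt_eqF// ltr_wpDl ?sqr_ge0// exprn_gt0.
have -> : (t%:C - (x +i* y))^-1 = ((t - x) / ((t - x) ^+ 2 + y ^+ 2)) +i* (y / ((t - x) ^+ 2 + y ^+ 2)).
  have nz : t%:C - (x +i* y) != 0.
    by apply/eqP => /(congr1 (@complex.Im R)) /= /eqP; rewrite sub0r oppr_eq0 gt_eqF.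
  apply: (mulIf nz); rewrite mulVf//.
  apply/eqP; rewrite eq_complex /= sub0r; apply/andP; split; apply/eqP; field; exact: D0.
by [].
Qed.

(** The resolvent applied to delta_i is square-summable, so it is small at the two ends of
    a large box and [finite_volume_resolvent] applies; take imaginary parts. *)
Lemma poisson_limit (i : int) (mu : {finite_measure set (measurableTypeR R) -> \bar R}) :
  is_spectral_measure H (delta R i) mu ->
  forall x y e, 0 < y -> 0 < e -> exists N1 : nat, forall N, (N1 <= N)%N ->
  forall d psi, finite_volume_data (N := N) V d psi ->
  `|Rintegral mu setT (poisson x y) - \sum_k normc (psi k i) ^+ 2 * poisson x y (d k)| <= e.
Proof.
move=> Hmu x y e y0 e0.
have [S [[lS linS bS] HS] HI] := Hmu (x +i* y) y0.
set w := S (delta R i) in HI.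
have lw : l2 w by apply: lS; exact: l2_delta.
rewrite l2_dot_delta in HI.
have Hw m : w (m + 1) + w (m - 1) + (V m)%:C * w m - (x +i* y) * w m = (i == m)%:R.
  have [E _] := HS _ (l2_delta i).
  by have := congr1 (fun f : int -> C => f m) E; rewrite /= deltaE.
have [N0 HN0] := l2_small_at_infinity lw (divr_gt0 (mulr_gt0 e0 y0) (ltr0Sn R 1)).
exists (maxn `|i|%N N0) => N; rewrite geq_max => /andP[iN N0N] d psi D.
have := finite_volume_resolvent D iN (_ : 0 < complex.Im (x +i* y)) Hw.
move=> /(_ y0) /= B.
(* Each of the two boundary values of w is at most e y / 2. *)
have {}B : normc (w i - \sum_k (normc (psi k i) ^+ 2)%:C / ((d k)%:C - (x +i* y))) <= e.
  apply: le_trans B _; rewrite ler_pdivrMr//.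
  have b1 : (N0 <= absz (N%:Z + 1)%R)%N by clear -N0N; lia.
  have b2 : (N0 <= absz (- N%:Z - 1)%R)%N by clear -N0N; lia.
  apply: le_trans (lerD (HN0 _ b1) (HN0 _ b2)) _; lra.
have := le_trans (abs_Im_le_normc _) B.
have -> : complex.Im (w i - \sum_k (normc (psi k i) ^+ 2)%:C / ((d k)%:C - (x +i* y)))
   = Rintegral mu setT (poisson x y) - \sum_k normc (psi k i) ^+ 2 * poisson x y (d k).
  rewrite HI raddfB raddf_sum; congr (_ - _).
    rewrite /complex_integral [LHS](_ : _ = Rintegral mu setT
       (fun t => complex.Im ((t%:C - (x +i* y))^-1)))//.
    by apply: eq_Rintegral => t _; rewrite im_resolvent.
  apply: eq_bigr => k _; rewrite -im_resolvent//.
  move: ((d k)%:C - _) => z; case: (z^-1) => p q.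
  by rewrite [LHS](_ : _ = normc (psi k i) ^+ 2 * q + 0 * p)// mul0r addr0.
by [].
Qed.

End SpectralMeasure.

(** * Solutions and their weighted mass *)

Section Solutions.
Context {R : realType}.
Local Notation C := R[i].
Variable V : int -> R.

(** The pair of the values at n and n + 1. *)
Fixpoint walk (W : nat -> R) (E x y : R) (n : nat) : R * R :=
  if n is m.+1 then
    ((walk W E x y m).2, (E - W m.+1) * (walk W E x y m).2 - (walk W E x y m).1)
  else (x, y).

(** The solution with u(0) = x and u(1) = y.  The left half is a walk to the right for the
    reflected sequence j |-> u(1 - j), which exchanges the two initial values. *)
Definition sol (E x y : R) (n : int) : R :=
  match n with
  | Posz m => (walk (fun j => V j%:Z) E x y m).1
  | Negz m => (walk (fun j => V (1 - j%:Z)) E y x m.+1).2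
  end.

Lemma sol0 E x y : sol E x y 0 = x. Proof. by []. Qed.
Lemma sol1 E x y : sol E x y 1 = y. Proof. by []. Qed.

Lemma sol_rec E x y n : sol E x y (n + 1) + sol E x y (n - 1) = (E - V n) * sol E x y n.
Proof.
case: n => [[|m]|[|m]].
- have -> : 0%N%:Z + 1 = Posz 1 by []. have -> : 0%N%:Z - 1 = Negz 0 by [].
  by rewrite /sol /= (_ : 1 - 1%:Z = 0)// addrC subrK.
- have -> : m.+1%:Z + 1 = Posz m.+2 by lia. have -> : m.+1%:Z - 1 = Posz m by lia.
  by rewrite /sol /= subrK.
- have -> : Negz 0 + 1 = Posz 0 by []. have -> : Negz 0 - 1 = Negz 1 by [].
  by rewrite /sol /= (_ : 1 - 2%:Z = Negz 0)// addrC subrK.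
- have -> : Negz m.+1 + 1 = Negz m by lia. have -> : Negz m.+1 - 1 = Negz m.+2 by lia.
  rewrite [sol _ _ _ (Negz m.+2)]/sol [sol _ _ _ (Negz m.+1)]/sol.
  rewrite [sol _ _ _ _]/sol /= (_ : 1 - (m.+3)%:Z = Negz m.+1); last by lia.
  by rewrite addrC subrK.
Qed.

Lemma walk_linear W E x y n :
  (walk W E x y n).1 = x * (walk W E 1 0 n).1 + y * (walk W E 0 1 n).1 /\
  (walk W E x y n).2 = x * (walk W E 1 0 n).2 + y * (walk W E 0 1 n).2.
Proof.
elim: n => [|n [IH1 IH2]] /=; first by rewrite !mulr1 !mulr0 addr0 add0r.
by split=> //; rewrite IH1 IH2; ring.
Qed.

Lemma sol_linear E x y n : sol E x y n = x * sol E 1 0 n + y * sol E 0 1 n.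
Proof.
case: n => n; rewrite /sol; first by have [] := walk_linear (fun j => V j%:Z) E x y n.
by have [_ ->] := walk_linear (fun j => V (1 - j%:Z)) E y x n.+1; rewrite addrC.
Qed.

Lemma walk_continuous W x y n :
  continuous (fun E => (walk W E x y n).1) /\ continuous (fun E => (walk W E x y n).2).
Proof.
elim: n => [|n [IH1 IH2]] /=; first by split=> E; exact: cvg_cst.
split=> // E; apply: cvgB; last exact: IH1.
by apply: cvgM; [apply: cvgB; [exact: cvg_id | exact: cvg_cst] | exact: IH2].
Qed.

Lemma sol_continuous x y n : continuous (fun E => sol E x y n).
Proof.
by case: n => n; [have [] := walk_continuous (fun j => V j%:Z) x y n
  | have [_] := walk_continuous (fun j => V (1 - j%:Z)) y x n.+1].
Qed.

Lemma box_solution_zero (E : R) (N : nat) (w : int -> C) :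
  (forall m : int, (`|m| <= N)%N -> w (m + 1) + w (m - 1) + (V m)%:C * w m = E%:C * w m) ->
  w 0 = 0 -> w 1 = 0 -> forall n : int, (`|n| <= N)%N -> w n = 0.
Proof.
move=> rec w0 w1.
have up (m : nat) : (m <= N)%N -> w m%:Z = 0 /\ w (m%:Z + 1) = 0.
  elim: m => [|m IH] mN; first by rewrite add0r.
  have [h1 h2] := IH (ltnW mN).
  have e1 : m.+1%:Z = m%:Z + 1 by lia.
  have e2 : m%:Z + 1 - 1 = m%:Z by lia.
  split; first by rewrite e1.
  have := rec m.+1%:Z mN; rewrite e1 e2 h1 h2 !mulr0 !addr0; exact.
have dn (m : nat) : (m <= N)%N -> w (- m%:Z) = 0 /\ w (- m%:Z + 1) = 0.
  elim: m => [|m IH] mN; first by rewrite oppr0 add0r.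
  have [h1 h2] := IH (ltnW mN).
  have e1 : - m.+1%:Z = - m%:Z - 1 by lia.
  have e2 : - m.+1%:Z + 1 = - m%:Z by lia.
  have mN' : (absz (- m%:Z)%R <= N)%N by clear -mN; lia.
  rewrite e2; split=> //; rewrite e1.
  by have := rec (- m%:Z) mN'; rewrite h1 h2 !mulr0 add0r addr0.
case=> n nN; first by have [] := up n nN.
by rewrite NegzE; have [] := dn n.+1 nN.
Qed.

Lemma box_solutionE (E : R) (N : nat) (w : int -> C) :
  (forall m : int, (`|m| <= N)%N -> w (m + 1) + w (m - 1) + (V m)%:C * w m = E%:C * w m) ->
  forall n : int, (`|n| <= N)%N ->
  w n = w 0 * (sol E 1 0 n)%:C + w 1 * (sol E 0 1 n)%:C.
Proof.
move=> rec n nN; apply/eqP; rewrite -subr_eq0; apply/eqP.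
pose z n := w n - (w 0 * (sol E 1 0 n)%:C + w 1 * (sol E 0 1 n)%:C).
apply: (@box_solution_zero E N z _ _ _ n nN) => [m mN||]; rewrite /z ?sol0 ?sol1.
- have p x y : (sol E x y (m + 1))%:C = (E%:C - (V m)%:C) * (sol E x y m)%:C - (sol E x y (m - 1))%:C.
    by rewrite -rmorphB -rmorphM -rmorphB -sol_rec addrK.
  have q : w (m + 1) = E%:C * w m - (V m)%:C * w m - w (m - 1) by rewrite -rec//; ring.
  by rewrite !p q; ring.
- by rewrite rmorph1 rmorph0 mulr1 mulr0 addr0 subrr.
- by rewrite rmorph1 rmorph0 mulr1 mulr0 add0r subrr.
Qed.

End Solutions.

Section Weights.
Context {R : realType}.

Definition weight (n : int) : R := ((1 + (`|n|%N)%:R) * (2 + (`|n|%N)%:R))^-1.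

Lemma weight_gt0 n : 0 < weight n.
Proof. by rewrite invr_gt0 mulr_gt0// ltr_pwDl. Qed.

(** Its increments dominate the weights, which makes the bound on sums over any window
    independent of the position of the window. *)
Definition weight_primitive (n : int) : R :=
  match n with Posz m => 2 - (1 + m%:R)^-1 | Negz m => (3 + m%:R)^-1 end.

Lemma weight_primitive_bound n : 0 <= weight_primitive n <= 2.
Proof.
case: n => n; rewrite /weight_primitive; have n0 : 0 <= n%:R :> R by [].
  have h : 0 < (1 + n%:R : R)^-1 <= 1.
    by rewrite invr_gt0 ltr_pwDl//= invf_le1 ?lerDl// ltr_pwDl.
  by move: h; move: (_^-1) => x; lra.
have h : 0 < (3 + n%:R : R)^-1 <= 1.
  rewrite invr_gt0 ltr_pwDl//= invf_le1; [lra|by rewrite ltr_pwDl].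
by move: h; move: (_^-1) => x; lra.
Qed.

Lemma weight_le_diff n : weight n <= weight_primitive (n + 1) - weight_primitive n.
Proof.
case: n => n; rewrite /weight.
  have -> : n%:Z + 1 = Posz n.+1 by lia.
  rewrite /weight_primitive absz_nat -[n.+1%:R]natr1; move: (n%:R : R) (ler0n R n) => x x0.
  rewrite le_eqVlt; apply/orP; left; apply/eqP; field; lra.
rewrite (_ : absz (Negz n) = n.+1)//.
case: n => [|n].
  have -> : Negz 0 + 1 = 0 by [].
  rewrite -[weight_primitive 0]/(2 - (1 + 0%:R)^-1) -[weight_primitive _]/((3 + 0%:R)^-1).
  rewrite !mulr0n !addr0 invr1; have -> : ((1 + 1) * (2 + 1) : R)^-1 = 6^-1 by congr (_^-1); ring.
  lra.
have -> : Negz n.+1 + 1 = Negz n by lia.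
rewrite /weight_primitive -[n.+2%:R]natr1 -[n.+1%:R]natr1; move: (n%:R : R) (ler0n R n) => x x0.
by rewrite le_eqVlt; apply/orP; left; apply/eqP; field; lra.
Qed.

Lemma weight_window (x : int) (n : nat) : \sum_(j < n) weight (x + j%:Z) <= 2.
Proof.
suff H : \sum_(j < n) weight (x + j%:Z) <= weight_primitive (x + n%:Z) - weight_primitive x.
  apply: le_trans H _; have := weight_primitive_bound x.
  by have := weight_primitive_bound (x + n%:Z); move: (weight_primitive _) (weight_primitive _) => p q; lra.
elim: n => [|n IH]; first by rewrite big_ord0 addr0 subrr.
rewrite big_ord_recr /=; have := weight_le_diff (x + n%:Z).
have -> : x + n%:Z + 1 = x + n.+1%:Z by lia.
by move: IH; move: (weight _) (\sum_(_ < _) _) (weight_primitive _) (weight_primitive _) (weight_primitive _); intros; lra.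
Qed.

End Weights.

Section Mass.
Context {R : realType}.
Local Notation C := R[i].
Variable V : int -> R.

Definition mass (E : R) (M : nat) (x y : R) : R :=
  \sum_(j < M.*2.+1) weight (j%:Z - M%:Z) * sol V E x y (j%:Z - M%:Z) ^+ 2.

Definition coercive (E : R) (M : nat) (K : R) : Prop :=
  forall x y, K * (x ^+ 2 + y ^+ 2) <= mass E M x y.

Lemma mass_step E M x y : mass E M x y <= mass E M.+1 x y.
Proof.
rewrite [leRHS]/mass doubleS big_ord_recl big_ord_recr /=.
have -> : \sum_(i < M.*2.+1)  weight ((bump 0 i)%:Z - M.+1%:Z)
  * sol V E x y ((bump 0 i)%:Z - M.+1%:Z) ^+ 2 = mass E M x y.
  by apply: eq_bigr => j _; have -> : (bump 0 j)%:Z - M.+1%:Z = j%:Z - M%:Z by rewrite /bump; lia.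
have p n : 0 <= weight n * sol V E x y n ^+ 2.
  by rewrite mulr_ge0 ?sqr_ge0// ltW// weight_gt0.
apply: le_trans (_ : mass E M x y <= mass E M x y + weight ((bump 0 M.*2.+1)%:Z - M.+1%:Z)
  * sol V E x y ((bump 0 M.*2.+1)%:Z - M.+1%:Z) ^+ 2) _; first by rewrite lerDl.
by rewrite lerDr.
Qed.

Lemma mass_mono E M M' x y : (M <= M')%N -> mass E M x y <= mass E M' x y.
Proof.
move=> /subnK <-; elim: (M' - M)%N => [//|k IH].
by apply: le_trans IH _; exact: mass_step.
Qed.

Lemma mass_expand E M x y : mass E M x y = x ^+ 2 * mass E M 1 0 + y ^+ 2 * mass E M 0 1
  + x * y * (mass E M 1 1 - mass E M 1 0 - mass E M 0 1).
Proof.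
rewrite /mass -!sumrB !mulr_sumr -!big_split; apply: eq_bigr => j _ /=.
rewrite (sol_linear V E x y) (sol_linear V E 1 1).
by move: (weight _) (sol _ _ _ _ _) (sol _ _ _ _ _) => w p q; ring.
Qed.

Lemma mass_continuous M x y : continuous (fun E => mass E M x y).
Proof.
rewrite /mass; elim: (index_enum _) => [|j s IH] E.
  by under eq_fun do rewrite big_nil; exact: cvg_cst.
under eq_fun do rewrite big_cons; apply: cvgD; last exact: IH.
apply: cvgM; first exact: cvg_cst.
by under eq_fun do rewrite expr2; apply: cvgM; exact: sol_continuous.
Qed.

(** The mass is a quadratic form in (x, y) whose three coefficients are continuous in E. *)
Lemma mass_stable E M e : 0 < e -> exists2 rho, 0 < rho &
  forall E', `|E' - E| < rho -> forall x y, mass E M x y <= mass E' M x y + e * (x ^+ 2 + y ^+ 2).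
Proof.
move=> e0; pose f x y (E : R) := mass E M x y.
have key x y d : 0 < d -> exists2 rho, 0 < rho & forall E', `|E' - E| < rho ->
    `|mass E M x y - mass E' M x y| < d.
  move=> d0; have /cvgrPdist_lt /(_ d d0) := @mass_continuous M x y E.
  case=> rho /= rho0 H; exists rho => // E' h; apply: H => /=.
  by rewrite distrC.
have e6 : 0 < e / 6 by rewrite divr_gt0.
have [r1 r10 H1] := key 1 0 _ e6; have [r2 r20 H2] := key 0 1 _ e6.
have [r3 r30 H3] := key 1 1 _ e6.
exists (Num.min r1 (Num.min r2 r3)); first by rewrite !lt_min r10 r20.
move=> E'; rewrite !lt_min => /and3P[/H1 h1 /H2 h2 /H3 h3] x y.
rewrite (mass_expand E) (mass_expand E').
move: h1 h2 h3; move: (mass E _ _ _) (mass E _ _ _) (mass E _ _ _).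
move: (mass E' _ _ _) (mass E' _ _ _) (mass E' _ _ _) => a b c a' b' c'.
rewrite !ltr_norml => h1 h2 h3.
have [p [pE p1]] : exists p, c' = c + p /\ (- (e / 6) < p < e / 6) by exists (c' - c); split=> //; ring.
have [q [qE q1]] : exists p, b' = b + p /\ (- (e / 6) < p < e / 6) by exists (b' - b); split=> //; ring.
have [r [rE r1']] : exists p, a' = a + p /\ (- (e / 6) < p < e / 6) by exists (a' - a); split=> //; ring.
rewrite {}pE {}qE {}rE.
have s1 : 0 <= (e / 2 - (r - p - q)) * (x + y) ^+ 2 by rewrite mulr_ge0 ?sqr_ge0//; lra.
have s2 : 0 <= (e / 2 + (r - p - q)) * (x - y) ^+ 2 by rewrite mulr_ge0 ?sqr_ge0//; lra.
have s3 : 0 <= (e / 6 - p) * x ^+ 2 by rewrite mulr_ge0 ?sqr_ge0//; lra.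
have s4 : 0 <= (e / 6 - q) * y ^+ 2 by rewrite mulr_ge0 ?sqr_ge0//; lra.
have s5 : 0 <= e * x ^+ 2 by rewrite mulr_ge0 ?sqr_ge0//; lra.
have s6 : 0 <= e * y ^+ 2 by rewrite mulr_ge0 ?sqr_ge0//; lra.
move: s1 s2 s3 s4 s5 s6; rewrite !sqrrD !sqrrN !expr2; clear; lra.
Qed.

(** The sublevel sets are nested compact sets; a cluster point of minimizers lies in all
    of them. *)
Lemma nested_minimum (f : nat -> R -> R) (B : R) :
  (forall M, continuous (f M)) -> (forall M M' x, (M <= M')%N -> f M x <= f M' x) ->
  (forall M, exists2 x, -1 <= x <= 1 & f M x <= B) -> exists x, forall M, f M x <= B.
Proof.
move=> fc fm H.
pose g M := sval (cid2 (H M)).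
have g1 M : -1 <= g M <= 1 by rewrite /g; case: cid2.
have g2 M : f M (g M) <= B by rewrite /g; case: cid2.
have [|p [_ cp]] := segment_compact (a := -1 : R) (b := 1) (F := g @ \oo) _ _.
  by exists 0%N => // M _ /=; rewrite in_itv /= g1.
exists p => M; rewrite leNgt; apply/negP => fB.
have U : nbhs p [set x | B < f M x].
  by move/cvgrPdist_lt: (fc M p) => /(_ (f M p - B)); rewrite subr_gt0 => /(_ fB);
    apply: filterS => x /= h; have := le_lt_trans (ler_norm _) h; lra.
have W : (g @ \oo) [set x | f M x <= B].
  by exists M => // M' /= MM'; apply: le_trans (fm _ _ _ MM') (g2 M').
by have [x [/= h1 h2]] := cp _ _ W U; rewrite ltNge h1 in h2.
Qed.

(** The initial data that violate coercivity, scaled so that the larger coordinate is 1,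
    lie on two segments.  One of the two segments contains a violating datum for every M,
    since masses increase with M, and [nested_minimum] yields a common one. *)
Lemma not_coercive_bounded E K : 0 < K -> (forall M, ~ coercive E M K) ->
  exists x y, (x != 0 \/ y != 0) /\ forall M, mass E M x y <= 2 * K.
Proof.
move=> K0 H.
have hom M t x y : mass E M (t * x) (t * y) = t ^+ 2 * mass E M x y.
  by rewrite (mass_expand _ _ (t * x)) (mass_expand _ _ x); ring.
have N M : (exists2 x, -1 <= x <= 1 & mass E M 1 x <= 2 * K) \/
           (exists2 x, -1 <= x <= 1 & mass E M x 1 <= 2 * K).
  have : exists x y, mass E M x y < K * (x ^+ 2 + y ^+ 2).
    apply: contrapT => no; apply: (H M) => x y; rewrite leNgt; apply/negP => h.
    by apply: no; exists x, y.
  move=> [x [y xy]].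
  have [yx|xy'] := leP `|y| `|x|.
    have x0 : x != 0.
      apply/eqP => x0; move: yx xy; rewrite x0 normr0 normr_le0 => /eqP ->.
      by rewrite mass_expand !expr0n /= !mul0r !addr0 mulr0 ltxx.
    left; exists (y / x); first by rewrite -ler_norml normrM normfV ler_pdivrMr ?normr_gt0// mul1r.
    have := hom M x^-1 x y; rewrite mulVf// [_ * y]mulrC => ->.
    rewrite exprVn mulrC ler_pdivrMr ?exprn_even_gt0//.
    apply: le_trans (ltW xy) _; rewrite [2 * K]mulrC -mulrA ler_pM2l// mulrC.
    rewrite mulr_natr mulr2n lerD2l -(real_normK (num_real x)) -(real_normK (num_real y)).
    by rewrite ler_pXn2r ?nnegrE.
  have y0 : y != 0 by rewrite -normr_gt0; apply: le_lt_trans xy'.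
  right; exists (x / y).
    by rewrite -ler_norml normrM normfV ler_pdivrMr ?normr_gt0// mul1r ltW.
  have := hom M y^-1 x y; rewrite mulVf// [_ * x]mulrC => ->.
  rewrite exprVn mulrC ler_pdivrMr ?exprn_even_gt0//.
  apply: le_trans (ltW xy) _; rewrite [2 * K]mulrC -mulrA ler_pM2l// mulrC.
  rewrite mulr_natr mulr2n lerD2r -(real_normK (num_real x)) -(real_normK (num_real y)).
  by rewrite ler_pXn2r ?nnegrE// ltW.
have pc M p q r : continuous (fun x : R => p + x ^+ 2 * q + x * r).
  move=> x; apply: cvgD; first apply: cvgD; first exact: cvg_cst.
    by apply: cvgM; [exact: exprn_continuous | exact: cvg_cst].
  by apply: cvgM; [exact: cvg_id | exact: cvg_cst].
have [A|A] := pselect (forall M, exists2 x, -1 <= x <= 1 & mass E M 1 x <= 2 * K).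
  have [|M M' x MM|x Hx] := @nested_minimum (fun M x => mass E M 1 x) (2 * K) _ _ A.
  - move=> M; have -> : mass E M 1 = (fun x => mass E M 1 0 + x ^+ 2 * mass E M 0 1
       + x * (mass E M 1 1 - mass E M 1 0 - mass E M 0 1)); last exact: pc.
    by apply: funext => x; rewrite mass_expand expr1n !mul1r.
  - exact: mass_mono.
  - by exists 1, x; split; [left; exact: oner_neq0 | exact: Hx].
have [M0 HM0] : exists M, ~ exists2 x, -1 <= x <= 1 & mass E M 1 x <= 2 * K by exact/existsNP.
have A' M : exists2 x, -1 <= x <= 1 & mass E M x 1 <= 2 * K.
  have [[x x1 xM]|[x x1 xM]] := N (maxn M M0).
    exfalso; apply: HM0; exists x => //; apply: le_trans xM; apply: mass_mono; exact: leq_maxr.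
  by exists x => //; apply: le_trans xM; apply: mass_mono; exact: leq_maxl.
have [|M M' x MM|x Hx] := @nested_minimum (fun M x => mass E M x 1) (2 * K) _ _ A'.
- move=> M; have -> : (mass E M)^~ 1 = (fun x => mass E M 0 1 + x ^+ 2 * mass E M 1 0
     + x * (mass E M 1 1 - mass E M 1 0 - mass E M 0 1)); last exact: pc.
  by apply: funext => x; rewrite mass_expand; ring.
- exact: mass_mono.
- by exists x, 1; split; [right; exact: oner_neq0 | exact: Hx].
Qed.

Lemma mass_bound E K x y : 0 <= K -> (forall M, mass E M x y <= K) ->
  forall n : int, `|sol V E x y n| <= (1 + 2 * K) * (1 + (`|n|%N)%:R).
Proof.
move=> K0 H n; have lt : (absz (n + (`|n|)%N%:Z)%R < (`|n|).*2.+1)%N by lia.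
have := H `|n|%N; rewrite /mass (bigD1 (Ordinal lt))//=.
have -> : (absz (n + (`|n|)%N%:Z)%R)%:Z - (`|n|)%N%:Z = n by lia.
set s := \sum_(_ < _ | _) _; have s0 : 0 <= s.
  by apply: sumr_ge0 => j _; rewrite mulr_ge0 ?sqr_ge0// ltW// weight_gt0.
have {s0} : weight n * sol V E x y n ^+ 2 + s <= K -> weight n * sol V E x y n ^+ 2 <= K.
  by apply: le_trans; rewrite lerDl.
move=> h /h {h}; rewrite /weight mulrC ler_pdivrMr ?mulr_gt0 ?ltr_pwDl//.
move=> h; rewrite -(@ler_pXn2r _ 2) ?nnegrE//; last by rewrite mulr_ge0// addr_ge0// mulr_ge0.
rewrite real_normK ?num_real//; apply: le_trans h _.
move: (_%:R : R) (ler0n R `|n|%N) => t t0.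
rewrite exprMn; apply: le_trans (_ : (2 * K) * (1 + t) ^+ 2 <= _).
  rewrite [2 * K]mulrC -mulrA ler_wpM2l// expr2 mulrA [2 * _]mulrC -mulrA ler_wpM2l//; lra.
rewrite ler_wpM2r ?sqr_ge0//.
have : 0 <= K ^+ 2 by rewrite sqr_ge0. rewrite expr2 => K2.
rewrite expr2; lra.
Qed.

End Mass.

(** * Spectral measure of coercive energies *)

Section FiniteVolumeMass.
Context {R : realType}.
Local Notation C := R[i].
Variables (v : R -> R) (b theta : R).
Let V (n : int) := v (n%:~R * b + theta).

Lemma box_absz (M : nat) (j : 'I_M.*2.+1) : (absz (j%:Z - M%:Z)%R <= M)%N.
Proof. by have := ltn_ord j; lia. Qed.

Lemma normc_sqrE (z : C) : normc z ^+ 2 = complex.Re z ^+ 2 + complex.Im z ^+ 2.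
Proof. by case: z => x y; rewrite /normc sqr_sqrtr// addr_ge0 ?sqr_ge0. Qed.

(** In the box an eigenvector is a combination of two real solutions, with complex
    coefficients; coercivity applies to its real and imaginary parts. *)
Lemma eigenvector_mass (N M : nat) (d K : R) (w : int -> C) : (M <= N)%N ->
  (forall m : int, (`|m| <= N)%N -> w (m + 1) + w (m - 1) + (V m)%:C * w m = d%:C * w m) ->
  coercive V d M K ->
  K * (normc (w 0) ^+ 2 + normc (w 1) ^+ 2)
    <= \sum_(j < M.*2.+1) weight (j%:Z - M%:Z) * normc (w (j%:Z - M%:Z)) ^+ 2.
Proof.
move=> MN rec H; have E := box_solutionE rec.
rewrite !normc_sqrE addrACA mulrDr; apply: le_trans (lerD (H _ _) (H _ _)) _.
rewrite /mass -big_split; apply: ler_sum => j _ /=.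
rewrite -mulrDr (E (j%:Z - M%:Z)); last by apply: leq_trans MN; exact: box_absz.
rewrite normc_sqrE ler_pM2l ?weight_gt0// !(sol_linear V d (complex.Re _)) !(sol_linear V d (complex.Im _)).
move: (sol _ _ _ _ _) (sol _ _ _ _ _) => p q.
case: (w 0) => x0 y0; case: (w 1) => x1 y1 /=.
rewrite (_ : x0 * q - y0 * 0 + (x1 * p - y1 * 0) = x0 * q + x1 * p); last by ring.
by rewrite (_ : x0 * 0 + y0 * q + (x1 * 0 + y1 * p) = y0 * q + y1 * p)//; ring.
Qed.

(** Sum [eigenvector_mass] over k and exchange the sums: by completeness
    |psi_k n|^2 sums to 1 over k for each n in the box, and the weights sum to at most 2. *)
Lemma finite_volume_mass (N M : nat) (K : R) (d : 'I_N.*2.+1 -> R) psi :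
  finite_volume_data V d psi -> (M <= N)%N -> 0 < K ->
  \sum_(k | `[< coercive V (d k) M K >]) (normc (psi k 0) ^+ 2 + normc (psi k 1) ^+ 2) <= 2 / K.
Proof.
move=> [D1 D2 D3] MN K0; rewrite ler_pdivlMr// mulr_suml.
have unit n : (`|n| <= N)%N -> \sum_k normc (psi k n) ^+ 2 = 1.
  move=> nN; have := D3 n n nN nN; rewrite eqxx => /(congr1 (@complex.Re R)) /= <-.
  by rewrite raddf_sum; apply: eq_bigr => k _; rewrite conjc_mul_self.
apply: (@le_trans _ _ (\sum_k \sum_(j < M.*2.+1)
    weight (j%:Z - M%:Z) * normc (psi k (j%:Z - M%:Z)) ^+ 2)).
  rewrite big_mkcond; apply: ler_sum => k _; case: ifPn => [/asboolP h|_].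
    by rewrite mulrC; exact: (eigenvector_mass MN (D1 k) h).
  by apply: sumr_ge0 => j _; rewrite mulr_ge0 ?sqr_ge0// ltW// weight_gt0.
rewrite exchange_big /=.
rewrite (eq_bigr (fun j : 'I__ => weight (- M%:Z + j%:Z))); last first.
  move=> j _; rewrite -mulr_sumr unit ?mulr1 1?addrC//.
  by apply: leq_trans MN; rewrite addrC; exact: box_absz.
exact: weight_window.
Qed.

End FiniteVolumeMass.

Section PoissonGrid.
Context {R : realType}.

Lemma scaled_poissonE (s q t : R) : 0 < s ->
  s * poisson (q * s) s t = ((t / s - q) ^+ 2 + 1)^-1.
Proof.
move=> s0; rewrite /poisson.
have p : 0 < (t / s - q) ^+ 2 + 1 by rewrite ltr_wpDl ?sqr_ge0.
have -> : (t - q * s) ^+ 2 + s ^+ 2 = s ^+ 2 * ((t / s - q) ^+ 2 + 1) by field; lra.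
by move: p; move: (_ + 1) => x x0; field; lra.
Qed.

(** For x = q - floor t the distance from t to q is at least |x| - 1, and
    6 ((|x| - 1)^2 + 1) - (1 + |x|)(2 + |x|) = 5 (|x| - 1)(|x| - 2) is nonnegative because
    x is an integer. *)
Lemma lorentz_le_weight (t : R) (q : int) :
  ((t - q%:~R) ^+ 2 + 1)^-1 <= 6 * weight (q - Num.floor t).
Proof.
have /andP[h1 h2] := floor_itv t.
set m := Num.floor t in h1 h2 *.
pose f := t - m%:~R; have [f0 f1] : 0 <= f /\ f < 1.
  by rewrite /f subr_ge0 h1 ltrBlDr addrC -[1]/(1%:~R) -intrD.
have -> : t - q%:~R = f - (q - m)%:~R by rewrite /f rmorphB /=; ring.
move: (q - m) => x.
have p : 0 < (f - x%:~R) ^+ 2 + 1 by rewrite ltr_wpDl ?sqr_ge0.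
have wt : 0 < (1 + (`|x|%N)%:R) * (2 + (`|x|%N)%:R) :> R by rewrite mulr_gt0// ltr_pwDl.
rewrite /weight ler_pdivlMr// mulrC ler_pdivrMr//.
case: x p wt => [[|[|n]]|n] p wt.
- rewrite absz_nat mulr0z !mulr0n !addr0 subr0.
  have : 0 <= f ^+ 2 by rewrite sqr_ge0.
  by move: (f ^+ 2) => z; lra.
- rewrite absz_nat mulr1z mulr1n; have : 0 <= (f - 1) ^+ 2 by rewrite sqr_ge0.
  by move: ((f - 1) ^+ 2) => z; lra.
- rewrite absz_nat -pmulrn -[n.+2%:R]natr1 -[n.+1%:R]natr1; have := ler0n R n.
  move: (n%:R : R) => y y0.
  have h : (1 - (y + 1 + 1)) ^+ 2 <= (f - (y + 1 + 1)) ^+ 2.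
    by rewrite -sqrrN -[leRHS]sqrrN ler_pXn2r// ?nnegrE; lra.
  have y2 : 0 <= y * y by rewrite mulr_ge0.
  move: h; move: ((f - _) ^+ 2) => z; rewrite expr2 => h; clear -y0 y2 h; lra.
- rewrite (_ : absz (Negz n) = n.+1)// NegzE mulrNz -pmulrn -[n.+1%:R]natr1.
  move: (n%:R : R) (ler0n R n) => y y0.
  have h : (y + 1) ^+ 2 <= (f - - (y + 1)) ^+ 2 by rewrite ler_pXn2r// ?nnegrE; lra.
  have y2 : 0 <= y * y by rewrite mulr_ge0.
  move: h; move: ((f - - _) ^+ 2) => z; rewrite expr2 => h; clear -y0 y2 h; lra.
Qed.

Lemma lorentz_window (t : R) (x : int) (n : nat) (P : pred 'I_n) :
  \sum_(j < n | P j) ((t - (j%:Z + x)%:~R) ^+ 2 + 1)^-1 <= 12.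
Proof.
apply: le_trans (_ : \sum_(j < n) 6 * weight ((x - Num.floor t) + j%:Z) <= _).
  rewrite big_mkcond; apply: ler_sum => j _; case: ifPn => _.
    by apply: le_trans (lorentz_le_weight _ _) _; 
    by rewrite (_ : j%:Z + x - Num.floor t = x - Num.floor t + j%:Z) //; lia.
  by rewrite mulr_ge0// ltW// weight_gt0.
rewrite -mulr_sumr; have := weight_window (R := R) (x - Num.floor t) n.
by move: (\sum_(_ < _) _) => y; lra.
Qed.

Lemma poisson_bound (x y t : R) : 0 < y -> `|poisson x y t| <= y^-1.
Proof.
move=> y0; rewrite /poisson; have p : 0 < (t - x) ^+ 2 + y ^+ 2.
  by rewrite ltr_wpDl ?sqr_ge0// exprn_gt0.
rewrite ger0_norm; last by rewrite divr_ge0// ltW.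
rewrite ler_pdivrMr// mulrC ler_pdivlMr//.
by rewrite -expr2 lerDr sqr_ge0.
Qed.

Lemma poisson_continuous (x y : R) : 0 < y -> continuous (poisson x y).
Proof.
move=> y0 t; rewrite /poisson; apply: cvgM; first exact: cvg_cst.
apply: cvgV; first by rewrite gt_eqF// ltr_wpDl ?sqr_ge0// exprn_gt0.
apply: cvgD; last exact: cvg_cst.
by under eq_fun do rewrite expr2; apply: cvgM; apply: cvgB;
  by [exact: cvg_id | exact: cvg_cst].
Qed.

Lemma bounded_integrable (mu : {finite_measure set (measurableTypeR R) -> \bar R})
    (f : measurableTypeR R -> R) (B : R) :
  measurable_fun setT f -> (forall t, `|f t| <= B) -> mu.-integrable setT (EFin \o f).
Proof.
move=> mf fB; apply: measurable_bounded_integrable => //.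
  by have := fin_num_measure mu setT measurableT; rewrite ge0_fin_numE.
exists B; split; first exact: num_real.
by move=> x Bx t _; apply: le_trans (fB t) (ltW Bx).
Qed.

Lemma poisson_integrable (mu : {finite_measure set (measurableTypeR R) -> \bar R}) x y :
  0 < y -> mu.-integrable setT (EFin \o poisson x y).
Proof.
move=> y0; apply: bounded_integrable (fun t => poisson_bound x t y0).
apply: measurable_realfun.continuous_measurable_fun; exact: poisson_continuous.
Qed.

Lemma poisson_ge0 (x y t : R) : 0 < y -> 0 <= poisson x y t.
Proof. by move=> y0; rewrite /poisson divr_ge0 ?addr_ge0 ?sqr_ge0// ltW. Qed.

(** Off its center at distance d the scaled kernel has size (y / d)^2; summed over a grid
    of mesh y this is of order y. *)
Lemma poisson_far (x y t d : R) : 0 < y -> 0 < d -> d <= `|t - x| ->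
  y * poisson x y t <= (y / d) ^+ 2.
Proof.
move=> y0 d0 dt; rewrite /poisson mulrA -expr2 exprMn exprVn ler_wpM2l ?sqr_ge0//.
have d2 : 0 < d ^+ 2 by rewrite exprn_gt0.
have h : d ^+ 2 <= (t - x) ^+ 2.
  by rewrite -(real_normK (num_real (t - x))) ler_pXn2r ?nnegrE// ltW.
have y2 := sqr_ge0 y.
rewrite lef_pV2 ?posrE//; last by apply: lt_le_trans d2 _; apply: le_trans h _; rewrite lerDl.
by apply: le_trans h _; rewrite lerDl.
Qed.

(** A smooth substitute for the indicator of F: a sum of Poisson kernels of width s
    centered at the points of the grid s Z that are close to F.  The kernels are normalized to
    have height 1, and sum to a bounded function since their centers are s-separated; far
    from F the sum is of order s. *)
Lemma poisson_grid (F : set R) (m : nat) (eta e : R) : 0 < eta -> 0 < e ->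
  (forall E, F E -> `|E| <= m%:R) ->
  exists n (P : pred 'I_n) (q : 'I_n -> R) (s : R), 0 < s /\
  [/\ forall t, \sum_(j | P j) s * poisson (q j) s t <= 12,
      forall E, F E -> 1 / 2 <= \sum_(j | P j) s * poisson (q j) s E
    & forall t, (forall E, F E -> eta <= `|t - E|) ->
        \sum_(j | P j) s * poisson (q j) s t <= e].
Proof.
move=> eta0 e0 Fm.
have m0 : 0 <= m%:R :> R by [].
(* The first term of X makes the tails small, the second makes the mesh 1 / L at most eta / 2. *)
pose X : R := (2 * m%:R + 1) * 4 / (eta ^+ 2 * e) + 2 / eta.
have X1 : 0 < (2 * m%:R + 1) * 4 / (eta ^+ 2 * e).
  by rewrite divr_gt0// ?mulr_gt0// ?exprn_gt0// ltr_wpDl// mulr_ge0.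
have X2 : 0 < 2 / eta by rewrite divr_gt0.
have X0 : 0 < X by rewrite addr_gt0.
have LX := archi_boundP (ltW X0); set L := Num.bound X in LX.
have L0 : 0 < L%:R :> R by apply: lt_trans LX.
pose s : R := L%:R^-1; have s0 : 0 < s by rewrite invr_gt0.
have s1 : s <= eta / 2.
  rewrite -[eta / 2]invrK invf_div lef_pV2 ?posrE// ltW//.
  by apply: le_lt_trans LX; rewrite lerDr ltW.
have s2 : (2 * m%:R + 1) * 4 * s <= eta ^+ 2 * e.
  rewrite /s ler_pdivrMr// [leRHS]mulrC -ler_pdivrMr ?mulr_gt0 ?exprn_gt0// ltW//.
  by apply: le_lt_trans LX; rewrite lerDl ltW.
pose n := (m * L).*2.+1; pose q (j : nat) : int := j%:Z + - (m * L)%N%:Z.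
have ns : n%:R * s <= 2 * m%:R + 1.
  rewrite /s ler_pdivrMr// mulrDl mul1r /n -natr1 -muln2 natrM natrM lerD//.
    by move: (m%:R : R) (L%:R : R) => p r; lra.
  rewrite -[1]/(1%:R) ler_nat; by move: L0; rewrite ltr0n.
pose P (j : 'I_n) := `[< exists2 E, F E & Num.floor (E / s) = q j >].
pose Q (j : 'I_n) : R := (q j)%:~R * s.
exists n, P, Q, s; split=> //; split.
- move=> t; under eq_bigr do rewrite scaled_poissonE//.
  exact: lorentz_window.
- move=> E FE; pose z := Num.floor (E / s).
  have /andP[z1 z2] := floor_itv (E / s); rewrite -/z in z1 z2.
  have /andP[E1 E2] : - (m * L)%:R <= E / s <= (m * L)%:R.
    rewrite -ler_norml /s invrK normrM (ger0_norm (ltW L0)) natrM ler_pM2r//.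
    exact: Fm.
  have zlo : - (m * L)%N%:Z <= z.
    by rewrite -ltzD1 -(ltr_int R); apply: le_lt_trans z2; rewrite rmorphN.
  have zhi : z <= (m * L)%N%:Z.
    by rewrite -(ler_int R); apply: le_trans z1 _.
  have jn : (absz (z + (m * L)%N%:Z)%R < n)%N by rewrite /n; clear -zlo zhi; lia.
  have qj : q (Ordinal jn) = z by rewrite /q /=; clear -zlo; lia.
  rewrite (bigD1 (Ordinal jn))/=; last by apply/asboolP; exists E; rewrite ?qj.
  rewrite /Q qj scaled_poissonE//; set r := \sum_(_ < _ | _) _.
  have r0 : 0 <= r by apply: sumr_ge0 => j _; rewrite mulr_ge0 ?poisson_ge0// ltW.
  rewrite -[1 / 2]addr0 lerD// div1r lef_pV2 ?posrE ?ltr_wpDl ?sqr_ge0//.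
  have t1 : 0 <= E / s - z%:~R <= 1.
    by rewrite subr_ge0 z1 lerBlDr addrC -[1]/(1%:~R) -intrD ltW.
  have : (E / s - z%:~R) ^+ 2 <= 1 by case/andP: t1 => a c; rewrite exprn_ile1.
  move: (_ ^+ 2) => y; lra.
- move=> t far.
  have d0 : 0 < eta / 2 by rewrite divr_gt0.
  apply: (@le_trans _ _ (\sum_(j < n) (s / (eta / 2)) ^+ 2)).
    rewrite big_mkcond; apply: ler_sum => j _; case: ifPn => [/asboolP[E FE qE]|_]; last exact: sqr_ge0.
    apply: poisson_far => //.
    have /andP[] := floor_itv (E / s); rewrite qE ler_pdivlMr// ltr_pdivrMr// intrD mulrDl mul1r -/(Q j) => a1 a2.
    have := far E FE; have : `|E - Q j| <= s by rewrite ler_norml; apply/andP; split; lra.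
    have : `|t - E| <= `|t - Q j| + `|E - Q j|.
      by rewrite (distrC E); exact: ler_distD.
    by move: s1; move: `|_| `|_| `|_| => x y z; clear; lra.
  rewrite sumr_const card_ord -[_ *+ n]mulr_natl expr2 mulrA.
  apply: (@le_trans _ _ ((2 * m%:R + 1) / (eta / 2) * (s / (eta / 2)))).
    apply: ler_wpM2r; first by rewrite divr_ge0 ?ltW.
    by rewrite mulrA; apply: ler_wpM2r ns; rewrite invr_ge0 ltW.
  have -> : (2 * m%:R + 1) / (eta / 2) * (s / (eta / 2)) = (2 * m%:R + 1) * 4 * s / eta ^+ 2.
    by move: (m%:R : R) (s) => p r; field; rewrite gt_eqF.
  by rewrite ler_pdivrMr ?exprn_gt0// [e * _]mulrC.
Qed.

End PoissonGrid.

Section MeasureBound.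
Context {R : realType}.
Variables (v : R -> R) (b theta : R).
Let V (n : int) := v (n%:~R * b + theta).
Let H := hamiltonian v b theta.

Lemma common_threshold (n : nat) (Q : 'I_n -> nat -> Prop) :
  (forall j, exists N1, forall N, (N1 <= N)%N -> Q j N) ->
  exists N1, forall N, (N1 <= N)%N -> forall j, Q j N.
Proof.
move=> h; pose f j := sval (cid (h j)).
have fP j N : (f j <= N)%N -> Q j N by rewrite /f; case: cid => N1 /=; exact.
exists (\max_j f j) => N fN j; apply: fP; apply: leq_trans fN.
exact: leq_bigmax.
Qed.

(** With h the function of [poisson_grid], mu(F) / 2 is at most the integral of h, which is
    nearly the sum over k of |psi_k i|^2 h(d_k) in a large box; there h <= 12 and the
    eigenvalues near F have total mass at most 2 / K. *)
Lemma coercive_measure_bound (i : int) (mu : {finite_measure set (measurableTypeR R) -> \bar R})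
    (F : set (measurableTypeR R)) (M m : nat) (K eta : R) :
  i = 0 \/ i = 1 -> is_spectral_measure H (delta R i) mu ->
  measurable F -> 0 < K -> 0 < eta -> (forall E, F E -> `|E| <= m%:R) ->
  (forall E E', F E -> `|E' - E| < eta -> coercive V E' M K) ->
  fine (mu F) <= 48 / K.
Proof.
move=> i01 Hmu mF K0 eta0 Fm FK; apply/ler_addgt0Pr => e e0.
have e4 : 0 < e / 4 by rewrite divr_gt0.
have [n [P [q [s [s0 [h12 hF hfar]]]]]] := poisson_grid eta0 e4 Fm.
have n0 : 0 < n.+1%:R * s * 4 by rewrite !mulr_gt0.
have [N1 HN1] := common_threshold (fun j : 'I_n =>
  poisson_limit Hmu (q j) s0 (divr_gt0 e0 n0)).
(* The sites 0 and 1 and the window of coercivity must lie in the box. *)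
pose N := maxn N1 (maxn 1 M).
have [d [psi D]] := finite_volume V N.
have lim j := HN1 N (leq_maxl _ _) j d psi D.
have MN : (M <= N)%N by rewrite /N !leq_max leqnn !orbT.
have iN : (`|i| <= N)%N.
  by case: i01 => ->; rewrite // /N !leq_max leqnn /= orbT.
pose h t := \sum_(j | P j) s * poisson (q j) s t.
have h0 t : 0 <= h t by apply: sumr_ge0 => j _; rewrite mulr_ge0 ?poisson_ge0// ltW.
pose w k := normc (psi k i) ^+ 2.
have w0 k : 0 <= w k by exact: sqr_ge0.
have w1 : \sum_k w k = 1.
  have [_ _ D3] := D; have := D3 i i iN iN; rewrite eqxx => /(congr1 (@complex.Re R)) /= <-.
  by rewrite raddf_sum; apply: eq_bigr => k _; rewrite conjc_mul_self.
(* Eigenvalues far from F see only the tails of h, and the others carry little mass. *)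
have avg : \sum_k w k * h (d k) <= 24 / K + e / 4.
  apply: (@le_trans _ _ (\sum_k ((if `[< coercive V (d k) M K >] then 12 * w k else 0) + e / 4 * w k))).
    apply: ler_sum => k _; case: asboolP => [_|nc].
      by rewrite mulrC -mulrDl ler_wpM2r//; apply: le_trans (h12 _) _; rewrite lerDl ltW.
    rewrite add0r mulrC ler_wpM2r//; apply: hfar => E FE; rewrite leNgt; apply/negP => close.
    by apply: nc; exact: FK FE close.
  rewrite big_split /= -mulr_sumr w1 mulr1 lerD2r -big_mkcond -mulr_sumr.
  have : \sum_(k | `[< coercive V (d k) M K >]) w k <= 2 / K.
    apply: le_trans (finite_volume_mass D MN K0); apply: ler_sum => k _.
    by case: i01 => E; rewrite /w E ?lerDl ?lerDr sqr_ge0.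
  by move: (\sum_(_ | _) _) => x hx; rewrite (_ : 24 / K = 12 * (2 / K)); [rewrite ler_wpM2l | rewrite mulrA; congr (_ / _); ring].
have intj j : mu.-integrable setT (EFin \o (fun t => s * poisson (q j) s t)).
  have := integrableZl measurableT s (poisson_integrable mu (q j) s0).
  by [].
have inth : forall r : seq 'I_n, mu.-integrable setT (EFin \o (fun t => \sum_(j <- r | P j) s * poisson (q j) s t)) /\
   Rintegral mu setT (fun t => \sum_(j <- r | P j) s * poisson (q j) s t) =
   \sum_(j <- r | P j) s * Rintegral mu setT (poisson (q j) s).
  elim=> [|j r [IH1 IH2]].
    split.
      rewrite (_ : EFin \o _ = cst 0%E); first exact: integrable0.
      by apply: funext => t /=; rewrite big_nil.
    rewrite big_nil (_ : (fun _ => _) = cst 0); first by rewrite Rintegral_cst// mul0r.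
    by apply: funext => t; rewrite big_nil.
  rewrite big_cons; case: ifPn => Pj; last first.
    rewrite (_ : (fun t => _) = (fun t => \sum_(j <- r | P j) s * poisson (q j) s t))//.
    by apply: funext => t; rewrite big_cons (negbTE Pj).
  rewrite (_ : (fun t => _) = (fun t => s * poisson (q j) s t + \sum_(j <- r | P j) s * poisson (q j) s t)).
    split; first exact: integrableD (intj j) IH1.
    by rewrite RintegralD// IH2 RintegralZl//; exact: poisson_integrable.
  by apply: funext => t; rewrite big_cons Pj.
have [ih1 ih2] := inth (index_enum _).
have low : fine (mu F) / 2 <= Rintegral mu setT h.
  have -> : fine (mu F) / 2 = Rintegral mu setT (fun t => 1 / 2 * (\1_F t)).
    rewrite RintegralZl//; last exact: integrable_indic.
    by rewrite /Rintegral integral_indic// setIT div1r mulrC.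
  apply: le_Rintegral => //.
    exact: integrableZl (integrable_indic _ mF).
  move=> t _; rewrite indicE; case: (boolP (t \in F)) => [/set_mem Ft|_].
    by rewrite mulr1; exact: hF.
  by rewrite mulr0n mulr0; exact: h0.
have up : Rintegral mu setT h <= \sum_k w k * h (d k) + e / 4.
  rewrite ih2.
  apply: (@le_trans _ _ (\sum_(j | P j) (s * (\sum_k w k * poisson (q j) s (d k)) + s * (e / (n.+1%:R * s * 4))))).
    apply: ler_sum => j _; rewrite -mulrDr; apply: ler_wpM2l; first exact: ltW.
    by have := lim j; rewrite ler_norml => /andP[_]; rewrite lerBlDl addrC.
  rewrite big_split /= lerD//.
    rewrite (eq_bigr (fun j => \sum_k w k * (s * poisson (q j) s (d k)))); last first.
      by move=> j _; rewrite mulr_sumr; apply: eq_bigr => k _; rewrite mulrCA.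
    by rewrite exchange_big /=; apply: ler_sum => k _; rewrite mulr_sumr.
  apply: (@le_trans _ _ (\sum_(j < n) s * (e / (n.+1%:R * s * 4)))).
    rewrite big_mkcond; apply: ler_sum => j _; case: ifP => // _.
    by rewrite mulr_ge0// ?divr_ge0 ?ltW.
  rewrite sumr_const card_ord -[_ *+ n]mulr_natl.
  have -> : n%:R * (s * (e / (n.+1%:R * s * 4))) = n%:R / n.+1%:R * (e / 4).
    move: (n.+1%:R : R) (ltr0Sn R n) => p p0; move: (n%:R : R) => r; by field; rewrite !gt_eqF.
  rewrite -[leRHS]mul1r; apply: ler_wpM2r; first exact: ltW.
  by rewrite ler_pdivrMr// mul1r ler_nat.
have := le_trans low (le_trans up (lerD avg (lexx _))).
have -> : 48 / K = 2 * (24 / K) by rewrite mulrA; congr (_ / _); ring.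
move: (24 / K) (fine _) => x y; lra.
Qed.

End MeasureBound.

(** * Slowly growing solutions exist spectrally almost everywhere *)

Section GeneralizedEigenfunctions.
Context {R : realType}.
Variables (v : R -> R) (b theta : R).
Let V (n : int) := v (n%:~R * b + theta).
Let H := hamiltonian v b theta.

(** A neighbourhood of E of fixed size is required, so that [coercive_measure_bound]
    applies to the whole set. *)
Definition tame (m : nat) (K : R) : set (measurableTypeR R) :=
  [set E : R | `|E| <= m%:R /\ forall E' : R, `|E' - E| < m.+1%:R^-1 -> coercive V E' m K].

(** The energies that are coercive, with every constant K, on a large enough box: those
    for which every nonzero solution has an infinite weighted sum of squares. *)
Definition wild : set (measurableTypeR R) := \bigcap_k \bigcup_m tame m k.+1%:R.

Lemma tame_closed m K : closed (tame m K : set R).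
Proof.
have -> : (tame m K : set R) = [set E : R | E \in `[- m%:R, m%:R]] `&`
    ~` (\bigcup_(E' in [set E' | ~ coercive V E' m K]) ball (E' : R) (m.+1%:R^-1)).
  apply/seteqP; split => E /=; rewrite in_itv /= -ler_norml.
    move=> [h1 h2]; split=> // -[E' nc]; rewrite /ball /= => h; exact: nc (h2 _ h).
  move=> [h1 h2]; split=> // E' h; apply: contrapT => nc; apply: h2.
  by exists E'.
apply: closedI; first exact: itv_closed.
apply: open_closedC; apply: bigcup_open => E' _; exact: ball_open.
Qed.

Lemma tame_measurable m K : measurable (tame m K).
Proof. by apply: measurable_realfun.closed_measurable; exact: tame_closed. Qed.

Lemma wild_measurable : measurable wild.
Proof.
by apply: bigcapT_measurable => k; apply: bigcupT_measurable => m; exact: tame_measurable.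
Qed.

Lemma tame_nondecreasing K : {homo (fun m => tame m K) : m m' / (m <= m')%N >-> m `<=` m'}.
Proof.
move=> m m' mm E [h1 h2]; split; first by apply: le_trans h1 _; rewrite ler_nat.
move=> E' h x y; apply: le_trans (mass_mono V E' x y mm); apply: h2.
apply: lt_le_trans h _; rewrite lef_pV2 ?posrE// ler_nat ltnS //.
Qed.

Lemma wild_null (i : int) (mu : {finite_measure set (measurableTypeR R) -> \bar R}) :
  i = 0 \/ i = 1 -> is_spectral_measure H (delta R i) mu -> mu wild = 0%E.
Proof.
move=> i01 Hmu.
have fin A : measurable A -> mu A \is a fin_num by exact: fin_num_measure.
have B k : (mu (\bigcup_m tame m k.+1%:R) <= (48 / k.+1%:R)%:E)%E.
  have mT m := tame_measurable m k.+1%:R.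
  have mU : measurable (\bigcup_m tame m k.+1%:R) by exact: bigcupT_measurable.
  have cv : (mu \o (fun m => tame m k.+1%:R)) x @[x --> \oo] --> mu (\bigcup_m tame m k.+1%:R).
    apply: nondecreasing_cvg_mu => // m m' mm; rewrite subsetEset.
    exact: tame_nondecreasing.
  rewrite -(cvg_lim _ cv)//; apply: lime_le; first by apply/cvg_ex; eexists; exact: cv.
  near=> m; rewrite /= -(fineK (fin _ (mT m))) lee_fin.
  have e0 : 0 < m.+1%:R^-1 :> R by rewrite invr_gt0.
  apply: (@coercive_measure_bound _ v b theta i mu (tame m k.+1%:R) m m k.+1%:R (m.+1%:R^-1)) => //.
    by move=> E [].
  by move=> E E' [_ h]; exact: h.
have mw := wild_measurable.
apply/eqP; rewrite eq_le measure_ge0 andbT; apply/lee_addgt0Pr => e e0; rewrite add0e.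
pose k := Num.bound (48 / e).
have k48 : 48 / e < k%:R by apply: archi_boundP; rewrite divr_ge0 ?ltW.
apply: (@le_trans _ _ (mu (\bigcup_m tame m k.+1%:R))).
  apply: le_measure; rewrite ?inE//; last by move=> E h; exact: (h k).
  by apply: bigcupT_measurable => m; exact: tame_measurable.
apply: le_trans (B k) _; rewrite lee_fin ler_pdivrMr// mulrC -ler_pdivrMr//.
by apply: le_trans (ltW k48) _; rewrite ler_nat.
Unshelve. all: by end_near. Qed.

(** If some K admits no box, stability ([mass_stable]) shows that E itself is not coercive
    with constant 2 K on any box, and [not_coercive_bounded] gives a solution. *)
Lemma not_wild_solution (E : R) : ~ wild E -> exists (u : int -> R) (C : R),
  [/\ u 0 != 0 \/ u 1 != 0, forall n : int, u (n + 1) + u (n - 1) = (E - V n) * u n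
    & forall n : int, `|u n| <= C * (1 + (`|n|%N)%:R)].
Proof.
move=> nw; have [k Hk] : exists k : nat, forall m, ~ tame m k.+1%:R E.
  apply: contrapT => no; apply: nw => k _; apply: contrapT => nk; apply: no.
  by exists k => m t; apply: nk; exists m.
have K0 : 0 < k.+1%:R :> R by [].
have nc M : ~ coercive V E M (2 * k.+1%:R).
  move=> c; have [rho rho0 Hrho] := mass_stable V E M K0.
  have X0 : 0 <= rho^-1 + `|E| by rewrite addr_ge0// ltW// invr_gt0.
  pose m := maxn M (Num.bound (rho^-1 + `|E|)).
  have mX : rho^-1 + `|E| < m%:R.
    by apply: lt_le_trans (archi_boundP X0) _; rewrite ler_nat leq_maxr.
  apply: (Hk m); split.
    by apply: ltW; apply: le_lt_trans mX; rewrite lerDr ltW// invr_gt0.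
  move=> E' h x y; apply: le_trans (mass_mono V E' x y (leq_maxl _ _)).
  have h' : `|E' - E| < rho.
    apply: lt_le_trans h _; rewrite -[rho]invrK lef_pV2 ?posrE ?invr_gt0//.
    apply: ltW; apply: lt_trans (_ : rho^-1 < m%:R) _; last by rewrite ltr_nat.
    by apply: le_lt_trans mX; rewrite lerDl.
  have := c x y; have := Hrho E' h' x y.
  move: (mass _ _ _ _ _) (mass _ _ _ _ _) => p q; rewrite -mulrA.
  by move: (_ * (x ^+ 2 + y ^+ 2)) => r; lra.
have [x [y [xy Hxy]]] := not_coercive_bounded (mulr_gt0 (ltr0Sn R 1) K0) nc.
exists (sol V E x y), (1 + 2 * (2 * (2 * k.+1%:R))); split=> //; first exact: sol_rec.
by apply: mass_bound => //; rewrite !mulr_ge0.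
Qed.

End GeneralizedEigenfunctions.

(** * Stability of the resolvent *)

Section L2Operations.
Context {R : realType}.
Local Notation C := R[i].
Implicit Types (u w : int -> C).

Lemma normc_lincomb_sqr (a x y : C) :
  normc (a * x + y) ^+ 2 <= 2 * normc a ^+ 2 * normc x ^+ 2 + 2 * normc y ^+ 2.
Proof.
have h : normc (a * x + y) <= normc a * normc x + normc y.
  by rewrite -normcM; exact: le_normcD.
apply: le_trans (_ : (normc a * normc x + normc y) ^+ 2 <= _).
  by rewrite ler_pXn2r ?nnegrE ?addr_ge0 ?mulr_ge0 ?normc_ge0.
have : 0 <= (normc a * normc x - normc y) ^+ 2 by rewrite sqr_ge0.
rewrite -mulrA -exprMn; move: (normc a * _) (normc y) => p q; rewrite !expr2; lra.
Qed.

Lemma l2_lincomb (a : C) u w : l2 u -> l2 w ->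
  l2 (fun n => a * u n + w n) /\
  l2_norm (fun n => a * u n + w n) ^+ 2
    <= 2 * normc a ^+ 2 * l2_norm u ^+ 2 + 2 * l2_norm w ^+ 2.
Proof.
move=> lu lw; set B := leRHS.
have B0 : 0 <= B by apply: addr_ge0; [apply: mulr_ge0; first apply: mulr_ge0 | apply: mulr_ge0]; rewrite ?sqr_ge0.
have [l h] : l2 (fun n => a * u n + w n) /\ l2_norm (fun n => a * u n + w n) <= Num.sqrt B.
  apply: l2_norm_le; first exact: sqrtr_ge0.
  move=> s us; rewrite sqr_sqrtr//.
  apply: (@le_trans _ _ (2 * normc a ^+ 2 * partial_sqnorm s u + 2 * partial_sqnorm s w)).
    rewrite /partial_sqnorm !mulr_sumr -big_split; apply: ler_sum => n _.
    exact: normc_lincomb_sqr.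
  rewrite /B; apply: lerD; (apply: ler_wpM2l; last exact: partial_le_norm) => //.
  by apply: mulr_ge0; rewrite ?sqr_ge0.
split=> //; rewrite -[leRHS]sqr_sqrtr// ler_pXn2r ?nnegrE ?sqrtr_ge0//.
Qed.

Lemma l2_scale (a : C) u : l2 u ->
  l2 (fun n => a * u n) /\ l2_norm (fun n => a * u n) <= normc a * l2_norm u.
Proof.
move=> lu; apply: l2_norm_le; first by rewrite mulr_ge0 ?normc_ge0 ?l2_norm_ge0.
move=> s us; rewrite exprMn /partial_sqnorm.
under eq_bigr do rewrite normcM exprMn; rewrite -mulr_sumr.
by apply: ler_wpM2l; rewrite ?sqr_ge0//; exact: partial_le_norm.
Qed.

Lemma l2_shift (m : int) u : l2 u -> l2 (fun n => u (n + m)).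
Proof.
move=> lu; apply: (proj1 (l2_of_bound (M := l2_norm u ^+ 2) _)) => s us.
have -> : partial_sqnorm s (fun n => u (n + m)) = partial_sqnorm (map (fun n => n + m) s) u.
  by rewrite /partial_sqnorm big_map.
by apply: partial_le_norm => //; rewrite map_inj_uniq//; exact: addIr.
Qed.

Lemma l2_multiplier (f : int -> C) (M : R) u : 0 <= M -> (forall n, normc (f n) <= M) ->
  l2 u -> l2 (fun n => f n * u n).
Proof.
move=> M0 fM lu; apply: (proj1 (l2_norm_le (M := M * l2_norm u) _ _)).
  by rewrite mulr_ge0 ?l2_norm_ge0.
move=> s us; rewrite exprMn; apply: le_trans (_ : M ^+ 2 * partial_sqnorm s u <= _).
  rewrite mulr_sumr; apply: ler_sum => n _; rewrite normcM exprMn ler_wpM2r ?sqr_ge0//.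
  by rewrite ler_pXn2r ?nnegrE ?normc_ge0.
by apply: ler_wpM2l; rewrite ?sqr_ge0//; exact: partial_le_norm.
Qed.

Lemma l2_norm0_eq0 u : l2 u -> l2_norm u <= 0 -> forall n, u n = 0.
Proof.
move=> lu h n; apply: eq0_normc; apply/eqP; rewrite eq_le normc_ge0 andbT.
exact: le_trans (normc_le_l2 n lu) h.
Qed.

End L2Operations.

Section GeometricSequences.
Context {R : realType}.

Lemma geometric_steps_cvg (x : nat -> R) (B : R) :
  (forall k, `|x k.+1 - x k| <= B * 2^-1 ^+ k) -> cvgn x.
Proof.
move=> h; have B0 : 0 <= B by have := h 0%N; rewrite expr0 mulr1; apply: le_trans.
have : cvgn (series (telescope x)).
  apply: normed_cvg; apply: (series_le_cvg (v_ := geometric B 2^-1)) => //.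
  - by move=> k /=.
  - by move=> k; rewrite /geometric /= mulr_ge0// exprn_ge0// invr_ge0.
  - by apply: is_cvg_geometric_series; rewrite ger0_norm ?invr_ge0// invf_lt1// ltr1n.
move=> c; have -> : x = (fun k => x 0%N + series (telescope x) k).
  by apply: funext => k; exact: eq_sum_telescope.
by apply: is_cvgD => //; exact: is_cvg_cst.
Qed.

Lemma normc_sqr_cvg (z : nat -> R[i]) (w : R[i]) :
  (fun k => complex.Re (z k)) x @[x --> \oo] --> complex.Re w ->
  (fun k => complex.Im (z k)) x @[x --> \oo] --> complex.Im w ->
  (fun k => normc (z k) ^+ 2) x @[x --> \oo] --> normc w ^+ 2.
Proof.
move=> h1 h2; rewrite normc_sqrE !expr2; under eq_fun do rewrite normc_sqrE !expr2.
by apply: cvgD; exact: cvgM.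
Qed.

End GeometricSequences.

Section ResolventOpen.
Context {R : realType}.
Local Notation C := R[i].
Variables (v : R -> R) (b theta Mv : R).
Hypotheses (Mv0 : 0 <= Mv) (vM : forall x, `|v x| <= Mv).
Let H := hamiltonian v b theta.
Let V (n : int) := v (n%:~R * b + theta).

Lemma hamiltonian_l2 u : l2 u -> l2 (H u).
Proof.
move=> lu; rewrite /H /hamiltonian.
have l1 : l2 (fun n => 1 * u (n + 1) + u (n - 1)).
  by apply: (proj1 (l2_lincomb _ _ _)); exact: l2_shift.
have l3 : l2 (fun n => (V n)%:C * u n).
  by apply: (l2_multiplier Mv0 _ lu) => n; rewrite (normc_rc (V n)); exact: vM.
have := proj1 (l2_lincomb 1 l1 l3).
by congr (l2 _); apply: funext => n; rewrite !mul1r.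
Qed.

Lemma hamiltonian_lin (a : C) u w n :
  H (fun n => a * u n + w n) n = a * H u n + H w n.
Proof. by rewrite /H /hamiltonian; ring. Qed.

Variables (E E' M : R) (S : (int -> C) -> int -> C).
Hypotheses (Sl2 : forall u, l2 u -> l2 (S u)).
Hypothesis (Slin : forall (a : C) u w, l2 u -> l2 w ->
  S (fun n => a * u n + w n) = (fun n => a * S u n + S w n)).
Hypotheses (M0 : 0 <= M) (SM : forall u, l2 u -> l2_norm (S u) <= M * l2_norm u).
Hypothesis Sres : forall u, l2 u ->
  (fun n => H (S u) n - E%:C * S u n) = u /\ S (fun n => H u n - E%:C * u n) = u.
Hypothesis close : `|E' - E| * M <= 1 / 2.

Let eps : C := (E' - E)%:C.

Lemma normc_eps : normc eps = `|E' - E|. Proof. exact: normc_rc. Qed.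

(** Such an x satisfies x = S (eps x), hence |x| <= |x| / 2 in norm. *)
Lemma shifted_injective x : l2 x -> (forall n, H x n = E'%:C * x n) -> forall n, x n = 0.
Proof.
move=> lx Hx; apply: l2_norm0_eq0 => //.
have [_ SE] := Sres lx.
have e : (fun n => H x n - E%:C * x n) = (fun n => eps * x n).
  by apply: funext => n; rewrite Hx /eps rmorphB /= mulrBl.
rewrite e in SE; have [l3 h3] := l2_scale eps lx.
have := SM l3; rewrite SE normc_eps in h3 * => h.
have : l2_norm x <= (`|E' - E| * M) * l2_norm x.
  by apply: le_trans h _; rewrite [_ * M]mulrC -mulrA ler_wpM2l.
have := l2_norm_ge0 x; have : (`|E' - E| * M) * l2_norm x <= 1 / 2 * l2_norm x.
  by rewrite ler_wpM2r ?l2_norm_ge0.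
by move=> h1 h2 h4; have := le_trans h4 h1; lra.
Qed.

(** Partial sums of the Neumann series for the resolvent at E', written as the fixed
    point iteration w |-> S (eps w + u). *)
Fixpoint neumann (u : int -> C) (k : nat) : int -> C :=
  if k is k'.+1 then S (fun n => eps * neumann u k' n + u n) else fun=> 0.

Lemma l2_zero : l2 (fun=> 0 : C).
Proof.
apply: (proj1 (l2_of_bound (M := 0) _)) => s us; rewrite /partial_sqnorm big1// => n _.
by rewrite normc0_eq expr0n.
Qed.

Lemma l2_norm_zero : l2_norm (fun=> 0 : C) <= 0.
Proof.
apply: (proj2 (l2_norm_le _ _)) => // s us; rewrite /partial_sqnorm big1// => n _.
by rewrite normc0_eq expr0n.
Qed.

Lemma neumann_l2 u k : l2 u -> l2 (neumann u k).
Proof.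
move=> lu; elim: k => [|k IH]; first exact: l2_zero.
by apply: Sl2; exact: (proj1 (l2_lincomb _ IH lu)).
Qed.

(** The bound is stable under the iteration: |S (eps w + u)|^2 is at most
    2 M^2 |eps|^2 |w|^2 + 2 M^2 |u|^2, and M |eps| <= 1 / 2.  The squares let a linear
    combination be estimated one coordinate at a time. *)
Lemma neumann_bound u k : l2 u -> l2_norm (neumann u k) <= 2 * M * l2_norm u.
Proof.
move=> lu; have un0 := l2_norm_ge0 u.
have B0 : 0 <= 2 * M * l2_norm u by rewrite !mulr_ge0.
elim: k => [|k IH]; first by apply: le_trans l2_norm_zero _.
have lk := neumann_l2 k lu; have [l3 h3] := l2_lincomb eps lk lu.
rewrite -(@ler_pXn2r _ 2) ?nnegrE ?l2_norm_ge0//=.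
apply: (@le_trans _ _ ((M * l2_norm (fun n => eps * neumann u k n + u n)) ^+ 2)).
  by rewrite ler_pXn2r ?nnegrE ?l2_norm_ge0 ?mulr_ge0 ?l2_norm_ge0//; exact: SM.
rewrite exprMn; apply: (le_trans (ler_wpM2l (sqr_ge0 M) h3)).
rewrite normc_eps.
have f : `|E' - E| * M * l2_norm (neumann u k) <= M * l2_norm u.
  apply: le_trans (ler_wpM2r (l2_norm_ge0 _) close) _.
  by move: IH; rewrite -mulrA; move: (M * _) (l2_norm _) => p q; lra.
have {f} : (`|E' - E| * M * l2_norm (neumann u k)) ^+ 2 <= (M * l2_norm u) ^+ 2.
  by rewrite ler_pXn2r ?nnegrE ?mulr_ge0 ?l2_norm_ge0.
by move: (l2_norm (neumann _ _)) (l2_norm u) `|E' - E| M => p q r m; rewrite !exprMn !expr2; lra.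
Qed.

Lemma neumann_step u k : l2 u ->
  l2 (fun n => neumann u k.+1 n - neumann u k n) /\
  l2_norm (fun n => neumann u k.+1 n - neumann u k n)
    <= 2^-1 ^+ k * l2_norm (fun n => neumann u 1 n - neumann u 0 n).
Proof.
move=> lu; elim: k => [|k [IHl IHn]].
  split; last by rewrite expr0 mul1r.
  have := proj1 (l2_lincomb (-1) l2_zero (neumann_l2 1 lu)).
  by congr (l2 _); apply: funext => n; rewrite mulr0 add0r subr0.
have E1 : (fun n => neumann u k.+2 n - neumann u k.+1 n) =
    (fun n => eps * S (fun n => neumann u k.+1 n - neumann u k n) n).
  have l3 := proj1 (l2_lincomb eps (neumann_l2 k lu) lu).
  have := Slin eps IHl l3.
  have -> : (fun n => eps * (neumann u k.+1 n - neumann u k n) + (eps * neumann u k n + u n)) =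
     (fun n => eps * neumann u k.+1 n + u n) by apply: funext => n; ring.
  move=> h; apply: funext => n.
  rewrite -[neumann u k.+2 n]/(S (fun n => eps * neumann u k.+1 n + u n) n) h.
  exact: addrK.
have [l4 h4] := l2_scale eps (Sl2 IHl).
rewrite E1; split=> //; apply: le_trans h4 _; rewrite normc_eps.
apply: le_trans (ler_wpM2l (normr_ge0 _) (SM IHl)) _; rewrite exprS -mulrA [leLHS]mulrA.
apply: le_trans (ler_wpM2r (l2_norm_ge0 _) close) _.
by rewrite div1r ler_wpM2l ?invr_ge0.
Qed.

Lemma neumann_step_pt u k n : l2 u ->
  normc (neumann u k.+1 n - neumann u k n)
    <= l2_norm (fun n => neumann u 1 n - neumann u 0 n) * 2^-1 ^+ k.
Proof.
move=> lu; have [l h] := neumann_step k lu; rewrite mulrC; apply: le_trans h.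
exact: (normc_le_l2 n l).
Qed.

Lemma neumann_cvg_Re u n : l2 u -> cvgn (fun k => complex.Re (neumann u k n)).
Proof.
move=> lu; apply: (geometric_steps_cvg (B := l2_norm (fun n => neumann u 1 n - neumann u 0 n))) => k.
by apply: le_trans (neumann_step_pt k n lu); rewrite -raddfB; exact: abs_Re_le_normc.
Qed.

Lemma neumann_cvg_Im u n : l2 u -> cvgn (fun k => complex.Im (neumann u k n)).
Proof.
move=> lu; apply: (geometric_steps_cvg (B := l2_norm (fun n => neumann u 1 n - neumann u 0 n))) => k.
by apply: le_trans (neumann_step_pt k n lu); rewrite -raddfB; exact: abs_Im_le_normc.
Qed.

(** The pointwise limit.  It suffices, since the bound on the norm passes to the limit on
    finite sets and H involves finitely many coordinates. *)
Definition neumann_sum (u : int -> C) (n : int) : C :=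
  limn (fun k => complex.Re (neumann u k n)) +i* limn (fun k => complex.Im (neumann u k n)).

Lemma neumann_sum_l2 u : l2 u ->
  l2 (neumann_sum u) /\ l2_norm (neumann_sum u) <= 2 * M * l2_norm u.
Proof.
move=> lu; apply: l2_norm_le => [|s us]; first by rewrite !mulr_ge0 ?l2_norm_ge0.
have cv : (fun k => partial_sqnorm s (neumann u k)) x @[x --> \oo] --> partial_sqnorm s (neumann_sum u).
  rewrite /partial_sqnorm; elim: s {us} => [|n s IH].
    by rewrite big_nil; under eq_fun do rewrite big_nil; exact: cvg_cst.
  rewrite big_cons; under eq_fun do rewrite big_cons.
  apply: cvgD => //; apply: normc_sqr_cvg; first exact: neumann_cvg_Re.
  exact: neumann_cvg_Im.
apply: (cvgr_to_le cv); near=> k.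
apply: (le_trans (partial_le_norm (neumann_l2 k lu) us)).
by rewrite ler_pXn2r ?nnegrE ?l2_norm_ge0 ?mulr_ge0 ?l2_norm_ge0//; exact: neumann_bound.
Unshelve. all: by end_near. Qed.

Lemma hamiltonian_part (f : C -> R) (w : int -> C) n :
  (forall x y, f (x + y) = f x + f y) -> (forall (r : R) z, f (r%:C * z) = r * f z) ->
  f (H w n) = f (w (n + 1)) + f (w (n - 1)) + V n * f (w n).
Proof. by move=> fD fZ; rewrite /H /hamiltonian !fD fZ. Qed.

Lemma ReZ (r : R) (z : C) : complex.Re (r%:C * z) = r * complex.Re z.
Proof. by case: z => x y /=; rewrite mul0r subr0. Qed.

Lemma ImZ (r : R) (z : C) : complex.Im (r%:C * z) = r * complex.Im z.
Proof. by case: z => x y /=; rewrite mul0r addr0. Qed.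

Lemma neumann_rec u k n : l2 u ->
  H (neumann u k.+1) n = E%:C * neumann u k.+1 n + eps * neumann u k n + u n.
Proof.
move=> lu; have [e _] := Sres (proj1 (l2_lincomb eps (neumann_l2 k lu) lu)).
have := congr1 (fun f : int -> C => f n) e => /= {}e.
by rewrite -addrA -e addrC subrK.
Qed.

(** Used with f the real part and the imaginary part; H and E act on each of them separately,
    the potential being real. *)
Lemma neumann_limit (f : C -> R) u n : l2 u ->
  (forall x y, f (x + y) = f x + f y) -> (forall (r : R) z, f (r%:C * z) = r * f z) ->
  (forall m, (fun k => f (neumann u k m)) x @[x --> \oo] --> f (neumann_sum u m)) ->
  f (H (neumann_sum u) n) = E' * f (neumann_sum u n) + f (u n).
Proof.
move=> lu fD fZ cv.
have cv1 m : (fun k => f (neumann u k.+1 m)) x @[x --> \oo] --> f (neumann_sum u m).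
  by rewrite (cvg_shiftS (fun k => f (neumann u k m))); exact: cv.
have lhs : (fun k => f (H (neumann u k.+1) n)) x @[x --> \oo] --> f (H (neumann_sum u) n).
  rewrite hamiltonian_part//; under eq_fun do rewrite hamiltonian_part//.
  by apply: cvgD; [apply: cvgD; exact: cv1 | apply: cvgM; [exact: cvg_cst | exact: cv1]].
have rhs : (fun k => f (H (neumann u k.+1) n)) x @[x --> \oo] --> E' * f (neumann_sum u n) + f (u n).
  under eq_fun do rewrite neumann_rec// !fD !fZ.
  have -> : E' * f (neumann_sum u n) = E * f (neumann_sum u n) + (E' - E) * f (neumann_sum u n) by ring.
  apply: cvgD; last exact: cvg_cst.
  by apply: cvgD; (apply: cvgM; first exact: cvg_cst); [exact: cv1 | exact: cv].
exact: (cvg_unique _ lhs rhs).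
Qed.

Lemma neumann_sum_eq u n : l2 u ->
  H (neumann_sum u) n - E'%:C * neumann_sum u n = u n.
Proof.
move=> lu.
have hr := neumann_limit n lu (raddfD (@complex.Re R)) ReZ (fun m => neumann_cvg_Re (n := m) lu).
have hi := neumann_limit n lu (raddfD (@complex.Im R)) ImZ (fun m => neumann_cvg_Im (n := m) lu).
apply/eqP; rewrite subr_eq; apply/eqP.
move: hr hi; case: (H _ n) (neumann_sum u n) (u n) => p1 p2 [q1 q2] [w1 w2] /= -> ->.
by apply/eqP; rewrite eq_complex /=; apply/andP; split; apply/eqP; ring.
Qed.

Lemma neumann_resolvent : is_resolvent H E'%:C neumann_sum.
Proof.
have uniq x y : l2 x -> l2 y -> (forall n, H x n - E'%:C * x n = H y n - E'%:C * y n) -> x = y.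
  move=> lx ly e; have [l3 _] := l2_lincomb (-1) ly lx.
  have z := shifted_injective l3 _; apply: funext => n.
  have := z _ n; rewrite mulN1r addrC => h; apply/eqP; rewrite -subr_eq0; apply/eqP; apply: h => m.
  rewrite hamiltonian_lin mulN1r; have := e m; move: (H x m) (H y m) => p q pq.
  have -> : p = q - E'%:C * y m + E'%:C * x m by rewrite -pq subrK.
  by ring.
split; first split.
- by move=> u lu; have [] := neumann_sum_l2 lu.
- move=> a u w lu lw; have [l3 _] := l2_lincomb a lu lw.
  have [lu' _] := neumann_sum_l2 lu; have [lw' _] := neumann_sum_l2 lw.
  apply: uniq; first by have [] := neumann_sum_l2 l3.
    by have [] := l2_lincomb a lu' lw'.
  move=> n; rewrite neumann_sum_eq// hamiltonian_lin -(neumann_sum_eq n lu) -(neumann_sum_eq n lw).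
  by move: (H _ _) (H _ _) => p q; ring.
- by exists (2 * M) => u lu; have [] := neumann_sum_l2 lu.
move=> u lu; split; first by apply: funext => n; exact: neumann_sum_eq.
have l3 : l2 (fun n => H u n - E'%:C * u n).
  have := proj1 (l2_lincomb (- E'%:C) lu (hamiltonian_l2 lu)).
  by congr (l2 _); apply: funext => n; rewrite mulNr addrC.
apply: uniq => //; first by have [] := neumann_sum_l2 l3.
by move=> n; rewrite neumann_sum_eq.
Qed.

End ResolventOpen.

Section SpectrumClosed.
Context {R : realType}.
Variables (v : R -> R) (b theta Mv : R).
Hypotheses (Mv0 : 0 <= Mv) (vM : forall x, `|v x| <= Mv).

Lemma spectrum_closed : closed [set E : R | spectrum (hamiltonian v b theta) E%:C].
Proof.
rewrite -openC openE => E /= /contrapT[S [[Sl2 Slin [M0 SM0]] Sres]].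
have [M M1 SM] : exists2 M, 0 < M & forall u, l2 u -> l2_norm (S u) <= M * l2_norm u.
  exists (1 + `|M0|); first by rewrite ltr_pwDl.
  move=> u lu; apply: le_trans (SM0 u lu) _; rewrite ler_wpM2r ?l2_norm_ge0//.
  by apply: le_trans (ler_norm _) _; rewrite lerDr.
exists ((2 * M)^-1) => /=; first by rewrite invr_gt0 mulr_gt0.
move=> E' /= h; apply; exists (neumann_sum E E' S).
apply: (neumann_resolvent Mv0 vM Sl2 Slin (ltW M1) SM Sres).
rewrite distrC -ler_pdivlMr// mul1r -invfM; exact: ltW.
Qed.

End SpectrumClosed.

(** * Measurability, and countability of eigenvalues *)

Section MeasurableLimit.
Context {R : realType}.

Lemma sublevel_measurable (g : R -> R) (a : R) : continuous g ->
  measurable ([set E | g E <= a] : set (measurableTypeR R)).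
Proof.
move=> cg; have := measurable_realfun.continuous_measurable_fun cg.
move=> /(_ measurableT `]-oo, a]%classic (measurable_itv _)); rewrite setTI.
by congr measurable; apply/seteqP; split => E /=; rewrite in_itv.
Qed.

(** Since the limit of a divergent sequence is 0 by convention, positivity of the limit
    means that the sequence is Cauchy and is eventually bounded below by some 1 / (k + 1). *)
Lemma positive_limit_measurable (f : nat -> R -> R) : (forall n, continuous (f n)) ->
  measurable ([set E | 0 < limn (fun n => f n E)] : set (measurableTypeR R)).
Proof.
move=> cf.
have cB m n : continuous (fun E => `|f m E - f n E|).
  by move=> E; apply: cvg_norm; apply: cvgB; exact: cf.
pose cauchy : set (measurableTypeR R) :=
  \bigcap_k \bigcup_N \bigcap_m [set E | `|f (N + m)%N E - f N E| <= k.+1%:R^-1].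
pose above : set (measurableTypeR R) :=
  \bigcup_k \bigcup_N \bigcap_m [set E | - f (N + m)%N E <= - k.+1%:R^-1].
have -> : ([set E | 0 < limn (fun n => f n E)] : set (measurableTypeR R)) = cauchy `&` above.
  apply/seteqP; split => E /=.
    move=> l0; have cv : cvgn (fun n => f n E).
      by apply: contrapT => /dvgP H; move: l0; rewrite H ltxx.
    split.
      move=> k _; have k0 : 0 < k.+1%:R^-1 / 2 :> R by rewrite divr_gt0 ?invr_gt0.
      have /cvgrPdist_le /(_ _ k0) [N _ HN] := cv.
      exists N => // m _ /=.
      have := HN N (leqnn _); have := HN (N + m)%N (leq_addr _ _) => /= h1 h2.
      rewrite [X in _ <= X](_ : _ = k.+1%:R^-1 / 2 + k.+1%:R^-1 / 2); last by rewrite -splitr.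
      apply: le_trans (ler_distD (limn (fun n => f n E)) _ _) _.
      by apply: lerD => //; rewrite distrC.
    have l2 : 0 < limn (fun n => f n E) / 2 by rewrite divr_gt0.
    have /cvgrPdist_le /(_ _ l2) [N _ HN] := cv.
    exists (Num.bound (limn (fun n => f n E) / 2)^-1) => //; exists N => // m _ /=.
    have := HN (N + m)%N (leq_addr _ _) => /=; rewrite ler_distl => /andP[_ h].
    rewrite lerN2; apply: (@le_trans _ _ (limn (fun n => f n E) / 2)).
      rewrite -[leRHS]invrK lef_pV2 ?posrE ?invr_gt0//; apply: ltW.
      apply: lt_trans (archi_boundP _) _; first by rewrite invr_ge0 ltW.
      by rewrite ltr_nat.
    by move: h; move: (limn _) (f _ _) => p q; lra.
  move=> [c [k _ [N _ a]]].
  have cv : cvgn (fun n => f n E).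
    apply/cauchy_cvgP; apply: cauchy_exP => e e0.
    pose j := Num.bound e^-1; have je : j.+1%:R^-1 < e.
      rewrite -[e]invrK ltf_pV2 ?posrE ?invr_gt0//.
      by apply: lt_trans (archi_boundP _) _; [rewrite invr_ge0 ltW | rewrite ltr_nat].
    have [N' _ HN'] := c j I; exists (f N' E); exists N' => // n /= nN.
    have := HN' (n - N')%N I; rewrite /= subnKC// => h.
    by rewrite /ball /= distrC; apply: le_lt_trans h je.
  apply: lt_le_trans (_ : k.+1%:R^-1 <= _); first by rewrite invr_gt0.
  apply: limr_ge => //; exists N => // n /= nN.
  by have := a (n - N)%N I; rewrite /= subnKC// lerN2.
apply: measurableI.
  apply: bigcapT_measurable => k; apply: bigcupT_measurable => N; apply: bigcapT_measurable => m.
  exact: sublevel_measurable.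
apply: bigcupT_measurable => k; apply: bigcupT_measurable => N; apply: bigcapT_measurable => m.
by apply: sublevel_measurable => E; apply: cvgN; exact: cf.
Qed.

End MeasurableLimit.

Section LyapunovMeasurable.
Context {R : realType}.
Variables (v : R -> R) (b theta Mv Lv : R).
Hypotheses (Mv0 : 0 <= Mv) (vM : forall x, `|v x| <= Mv).
Hypotheses (Lv0 : 0 <= Lv) (vL : forall x y, `|v x - v y| <= Lv * `|x - y|).

Lemma lyap_seq_continuous n : continuous (fun E => lyap_seq v b E n).
Proof.
move=> E; have M0 : 0 <= `|E| + 1 by rewrite addr_ge0.
have [K K0 HK] := lyap_seq_lipschitz b Mv0 vM Lv0 vL n M0.
apply/cvgrPdist_le => e e0.
have K1 : 0 < K + 1 by rewrite ltr_wpDl.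
exists (Num.min 1 (e / (K + 1))) => /=; first by rewrite lt_min ltr01 divr_gt0.
move=> E' /=; rewrite lt_min => /andP[h1 h2].
apply: le_trans (HK E E' _ _) _.
- by rewrite lerDl.
- have -> : E' = E - (E - E') by ring.
  by apply: le_trans (ler_normB _ _) _; rewrite lerD2l ltW.
apply: (@le_trans _ _ ((K + 1) * `|E - E'|)); first by rewrite ler_wpM2r// lerDl.
by rewrite mulrC -ler_pdivlMr// ltW.
Qed.

Lemma positive_lyapunov_spectrum_measurable :
  measurable (positive_lyapunov_spectrum v b theta).
Proof.
apply: (@measurableI _ (measurableTypeR R) [set E : R | spectrum (hamiltonian v b theta) E%:C]
  [set E : R | 0 < lyapunov v b E%:C]).
  by apply: measurable_realfun.closed_measurable; exact: spectrum_closed Mv0 vM.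
have -> : ([set E : R | 0 < lyapunov v b E%:C] : set (measurableTypeR R)) =
    [set E | 0 < limn (fun n => lyap_seq v b E n)].
  by apply/seteqP; split => E /=; rewrite (lyapunovE v b E).
by apply: positive_limit_measurable => n; exact: lyap_seq_continuous.
Qed.

End LyapunovMeasurable.

Section Countability.
Context {R : realType}.

(** Bessel's inequality at a single coordinate for an almost orthogonal family: expand the
    square of the distance from the basis vector at i0 to its projection. *)
Lemma bessel (I : finType) (n : nat) (f : 'I_n -> I -> R) (i0 : I) :
  (forall j, \sum_x f j x ^+ 2 <= 1) ->
  (forall j k, j != k -> `|\sum_x f j x * f k x| * n%:R ^+ 2 <= 1) ->
  \sum_j f j i0 ^+ 2 <= 2.
Proof.
move=> norm1 orth; set s := \sum_j _.
pose g x := \sum_j f j i0 * f j x.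
have gi : g i0 = s by apply: eq_bigr => j _; rewrite expr2.
have pos : 0 <= \sum_x ((x == i0)%:R - g x) ^+ 2 by apply: sumr_ge0 => x _; exact: sqr_ge0.
have : \sum_x ((x == i0)%:R - g x) ^+ 2 = 1 - 2 * s + \sum_x g x ^+ 2.
  rewrite (eq_bigr (fun x => (x == i0)%:R * (1 - 2 * g x) + g x ^+ 2)); last first.
    by move=> x _; case: (x == i0) => /=; rewrite ?mulr1n ?mulr0n; ring.
  rewrite big_split /= (bigD1 i0)//= eqxx mul1r big1 ?addr0 ?gi// => x /negbTE ->.
  by rewrite mul0r.
have c1 j : `|f j i0| <= 1.
  have : f j i0 ^+ 2 <= 1.
    apply: le_trans (norm1 j); rewrite (bigD1 i0)//= lerDl.
    by apply: sumr_ge0 => x _; exact: sqr_ge0.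
  by rewrite -(real_normK (num_real _)) -[X in _ <= X](expr1n _ 2) ler_pXn2r ?nnegrE.
have : \sum_x g x ^+ 2 <= s + 1.
  have -> : \sum_x g x ^+ 2 = \sum_j \sum_k f j i0 * f k i0 * \sum_x f j x * f k x.
    under eq_bigr do rewrite expr2 /g big_distrlr /=.
    rewrite exchange_big; apply: eq_bigr => j _; rewrite exchange_big; apply: eq_bigr => k _ /=.
    by rewrite mulr_sumr; apply: eq_bigr => x _; ring.
  case: n f i0 norm1 orth @s @g gi pos c1 => [|n] f i0 norm1 orth s g gi pos c1.
    by rewrite big_ord0 /s big_ord0 add0r.
  have n0 : 0 < n.+1%:R ^+ 2 :> R by rewrite exprn_gt0.
  apply: (@le_trans _ _ (\sum_j (f j i0 ^+ 2 + \sum_(k < n.+1) (n.+1%:R ^+ 2)^-1))).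
    apply: ler_sum => j _; rewrite (bigD1 j)//= -expr2.
    apply: lerD.
      rewrite -[leRHS]mulr1; apply: ler_wpM2l; first exact: sqr_ge0.
      by under eq_bigr do rewrite -expr2.
    rewrite [leRHS](bigD1 j)//=; apply: ler_wpDl; first by rewrite invr_ge0 ltW.
    apply: ler_sum => k kj; apply: le_trans (ler_norm _) _; rewrite !normrM.
    rewrite -[leRHS]mul1r; apply: ler_pM; rewrite ?mulr_ge0//.
      by rewrite -[leRHS]mul1r; apply: ler_pM.
    by rewrite -div1r ler_pdivlMr//; apply: orth; rewrite eq_sym.
  rewrite big_split /= lerD2l !sumr_const card_ord -mulrnA -[_ *+ (_ * _)]mulr_natl natrM -expr2.
  by rewrite divff ?gt_eqF.
by move=> h1 h2; rewrite h2 in pos; lra.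
Qed.

Variable V : int -> R.

Definition vanishing (u : int -> R) : Prop :=
  forall e, 0 < e -> exists N : nat, forall n : int, (N <= `|n|)%N -> `|u n| <= e.

Definition box_dot (N : nat) (u w : int -> R) : R :=
  \sum_(j < N.*2.+1) u (j%:Z - N%:Z) * w (j%:Z - N%:Z).

Definition is_solution (E : R) (u : int -> R) : Prop :=
  forall n, u (n + 1) + u (n - 1) = (E - V n) * u n.

Lemma wronskian (E E' : R) (u w : int -> R) (N : nat) :
  is_solution E u -> is_solution E' w ->
  (E - E') * box_dot N u w =
    (u (N%:Z + 1) * w N%:Z - u N%:Z * w (N%:Z + 1))
    - (u (- N%:Z) * w (- N%:Z - 1) - u (- N%:Z - 1) * w (- N%:Z)).
Proof.
move=> su sw; pose T n := u (n + 1) * w n - u n * w (n + 1).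
have := box_telescope N T; rewrite /T subrK => <-.
rewrite /box_dot mulr_sumr; apply: eq_bigr => j _; move: (j%:Z - N%:Z) => n.
rewrite subrK.
have -> : u (n + 1) = (E - V n) * u n - u (n - 1) by rewrite -su addrK.
have -> : w (n + 1) = (E' - V n) * w n - w (n - 1) by rewrite -sw addrK.
by ring.
Qed.

(** By [wronskian] the scalar product on a box is a boundary term divided by E - E'. *)
Lemma asymptotically_orthogonal (E E' : R) (u w : int -> R) (e : R) : E != E' -> 0 < e ->
  is_solution E u -> is_solution E' w -> vanishing u -> vanishing w ->
  exists N0, forall N, (N0 <= N)%N -> `|box_dot N u w| * e <= 1.
Proof.
move=> EE e0 su sw vu vw.
have d0 : 0 < `|E - E'| by rewrite normr_gt0 subr_eq0.
(* The boundary term consists of four products, each at most t. *)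
pose t := Num.min 1 (`|E - E'| / e / 4).
have t0 : 0 < t by rewrite lt_min ltr01 !divr_gt0.
have [t1 t2] : t <= 1 /\ t <= `|E - E'| / e / 4 by rewrite /t !ge_min !lexx orbT.
have [N1 H1] := vu _ t0; have [N2 H2] := vw _ t0.
exists (maxn N1 N2) => N; rewrite geq_max => /andP[n1 n2].
have := wronskian N su sw => /(congr1 Num.norm); rewrite normrM => h.
have aux (p q : int) : (N <= `|p|)%N -> (N <= `|q|)%N -> `|u p * w q| <= t.
  move=> pN qN; rewrite normrM -[leRHS]mulr1; apply: ler_pM => //.
    by apply: H1; exact: leq_trans pN.
  by apply: le_trans t1; apply: H2; exact: leq_trans qN.
have a1 : (N <= absz (N%:Z + 1)%R)%N by clear; lia.
have a2 : (N <= absz (N%:Z)%R)%N by clear; lia.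
have a3 : (N <= absz (- N%:Z)%R)%N by clear; lia.
have a4 : (N <= absz (- N%:Z - 1)%R)%N by clear; lia.
have : `|E - E'| * `|box_dot N u w| <= 4 * t.
  rewrite h; apply: le_trans (ler_normB _ _) _.
  have := aux _ _ a1 a2; have := aux _ _ a2 a1; have := aux _ _ a3 a4; have := aux _ _ a4 a3.
  have := ler_normB (u (N%:Z + 1) * w N%:Z) (u N%:Z * w (N%:Z + 1)).
  have := ler_normB (u (- N%:Z) * w (- N%:Z - 1)) (u (- N%:Z - 1) * w (- N%:Z)).
  by move: `|_| `|_| `|_| `|_| `|_| `|_| => *; lra.
move=> h2; rewrite -(ler_pM2l d0) mulrA mulr1 -ler_pdivlMr//.
by apply: le_trans h2 _; move: t2; move: (_ / e) => z; lra.
Qed.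

(** Bounding the values at 0 and 1 from below stratifies the eigenvalues into finite sets;
    the scalar products are taken on boxes to avoid infinite sums. *)
Definition eigenvalue_level (p : nat) : set R := [set E | exists u : int -> R,
  [/\ is_solution E u, vanishing u, forall N, box_dot N u u <= 1
    & p.+1%:R^-1 <= u 0 ^+ 2 + u 1 ^+ 2]].

(** Restrict n such solutions to a box so large that they are almost orthogonal.  [bessel]
    at the coordinates 0 and 1 bounds n / (p + 1) by 4. *)
Lemma eigenvalue_level_finite p : finite_set (eigenvalue_level p).
Proof.
apply: contrapT => /(infinite_set_fset (4 * p.+1).+1)[B BD sB].
set s := finmap.enum_fset B in sB; pose n := size s.
have us : uniq s by exact: finmap.fset_uniq.
have sD E : E \in s -> eigenvalue_level p E by exact: BD.
pose P (E : R) (u : int -> R) := [/\ is_solution E u, vanishing u,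
  forall N, box_dot N u u <= 1 & p.+1%:R^-1 <= u 0 ^+ 2 + u 1 ^+ 2].
have ex E : exists u, eigenvalue_level p E -> P E u.
  have [[u Hu]|no] := pselect (eigenvalue_level p E); first by exists u.
  by exists (fun=> 0) => /no.
pose U E := sval (cid (ex E)).
have HU E : eigenvalue_level p E -> P E (U E) by rewrite /U; case: cid.
pose e (j : 'I_n) := nth 0 s j.
have eD j : P (e j) (U (e j)) by apply: HU; apply: sD; rewrite mem_nth.
have n0 : 0 < n%:R ^+ 2 :> R by rewrite exprn_gt0// ltr0n; apply: leq_trans sB.
have pair (j k : 'I_n) : exists N1, forall N, (N1 <= N)%N -> j != k ->
    `|box_dot N (U (e j)) (U (e k))| * n%:R ^+ 2 <= 1.
  have [jk|jk] := eqVneq j k; first by exists 0%N.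
  have ejk : e j != e k by rewrite nth_uniq.
  have [su vu _ _] := eD j; have [sw vw _ _] := eD k.
  have [N1 H1] := asymptotically_orthogonal ejk n0 su sw vu vw.
  by exists N1 => N /H1.
have [N0 HN0] := common_threshold (fun j => common_threshold (pair j)).
pose N := maxn N0 1; have orth := HN0 N (leq_maxl _ _).
have i0P : (N < N.*2.+1)%N by clear; lia.
have i1P : (N.+1 < N.*2.+1)%N by rewrite /N; clear; lia.
have B0 := bessel (f := fun j (x : 'I_N.*2.+1) => U (e j) (x%:Z - N%:Z)) (Ordinal i0P).
have B1 := bessel (f := fun j (x : 'I_N.*2.+1) => U (e j) (x%:Z - N%:Z)) (Ordinal i1P).
have norm1 j : \sum_(x < N.*2.+1) U (e j) (x%:Z - N%:Z) ^+ 2 <= 1.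
  have [_ _ h _] := eD j; apply: le_trans (h N); rewrite /box_dot.
  by apply: ler_sum => x _; rewrite expr2.
have {}B0 := B0 norm1 orth; have {}B1 := B1 norm1 orth.
have : \sum_(j < n) p.+1%:R^-1 <= 4 :> R.
  apply: (@le_trans _ _ (\sum_j (U (e j) 0 ^+ 2 + U (e j) 1 ^+ 2))).
    by apply: ler_sum => j _; have [] := eD j.
  rewrite big_split /=; move: B0 B1 => /=.
  have -> : N%:Z - N%:Z = 0 by rewrite subrr.
  have -> : N.+1%:Z - N%:Z = 1 by clear; lia.
  by move: (\sum_(_ < _) _) (\sum_(_ < _) _) => x y; lra.
rewrite sumr_const card_ord -[_ *+ n]mulr_natl ler_pdivrMr// -natrM ler_nat => h.
by have := leq_ltn_trans h sB; rewrite ltnn.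
Qed.

(** A geometric tail is dominated by a multiple of [weight], whose sum over any box is
    bounded; normalize accordingly. *)
Lemma decaying_eigenvalue_level (E K kappa : R) (u : int -> R) :
  0 < kappa -> is_solution E u -> u 0 != 0 \/ u 1 != 0 ->
  (forall n : int, `|u n| <= K * expR (- (kappa * (`|n|%N)%:R))) ->
  exists p, eigenvalue_level p E.
Proof.
move=> k0 su un0 dec.
have K0 : 0 <= K by have := dec 0; rewrite mulr0 oppr0 expR0 mulr1; apply: le_trans.
pose t := Num.min 1 kappa.
have t0 : 0 < t by rewrite lt_min ltr01.
have [t1 t2] : t <= 1 /\ t <= kappa by rewrite /t !ge_min !lexx orbT.
have u2 n : u n ^+ 2 <= K ^+ 2 * (2 / t ^+ 2) * weight n.
  have h := dec n; set x : R := (`|n|%N)%:R in h; have x0 : 0 <= x by [].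
  have e1 : t * (1 + x) <= expR (kappa * x).
    apply: le_trans (expR_ge1Dx _); have : t * x <= kappa * x by rewrite ler_wpM2r.
    by rewrite mulrDr mulr1; move: (t * x) (kappa * x) => y z; lra.
  have tx : 0 < t * (1 + x) by rewrite mulr_gt0// ltr_pwDl.
  have h' : `|u n| <= K * (t * (1 + x))^-1.
    apply: le_trans h _; rewrite expRN; apply: ler_wpM2l => //.
    by rewrite lef_pV2 ?posrE// expR_gt0.
  rewrite -(real_normK (num_real (u n))).
  apply: le_trans (_ : (K * (t * (1 + x))^-1) ^+ 2 <= _).
    by rewrite ler_pXn2r ?nnegrE ?mulr_ge0 ?invr_ge0 ?(ltW tx).
  rewrite exprMn -mulrA; apply: ler_wpM2l; first exact: sqr_ge0.
  rewrite exprVn exprMn invfM [2 / _]mulrC -mulrA; apply: ler_wpM2l.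
    by rewrite invr_ge0 sqr_ge0.
  rewrite /weight -/x -[leLHS]invrK -[leRHS]invrK lef_pV2 ?posrE; last 2 first.
  - by rewrite !invr_gt0 exprn_gt0// ltr_pwDl.
  - by rewrite invr_gt0 divr_gt0// mulr_gt0// ltr_pwDl.
  rewrite invrK invfM invrK expr2 mulrCA; apply: ler_wpM2l; first by rewrite addr_ge0.
  lra.
pose S := K ^+ 2 * (2 / t ^+ 2) * 2 + 1.
have C0 : 0 <= K ^+ 2 * (2 / t ^+ 2) by rewrite mulr_ge0 ?sqr_ge0// divr_ge0 ?sqr_ge0.
have S0 : 0 < S by rewrite ltr_wpDl// mulr_ge0.
have SS N : box_dot N u u <= S.
  apply: (@le_trans _ _ (K ^+ 2 * (2 / t ^+ 2) * \sum_(j < N.*2.+1) weight (- N%:Z + j%:Z))).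
    rewrite mulr_sumr; apply: ler_sum => j _; rewrite -expr2 [- N%:Z + _]addrC; exact: u2.
  apply: (@le_trans _ _ (K ^+ 2 * (2 / t ^+ 2) * 2)); last by rewrite /S lerDl.
  by apply: ler_wpM2l => //; exact: weight_window.
pose r := (Num.sqrt S)^-1; have r0 : 0 < r by rewrite invr_gt0 sqrtr_gt0.
have r2 : r ^+ 2 = S^-1 by rewrite exprVn sqr_sqrtr// ltW.
have pos : 0 < (r * u 0) ^+ 2 + (r * u 1) ^+ 2.
  rewrite !exprMn -mulrDr mulr_gt0 ?exprn_gt0//.
  by case: un0 => h; [rewrite ltr_pwDl | rewrite ltr_wpDl]; rewrite ?sqr_ge0// lt_neqAle sqr_ge0 eq_sym sqrf_eq0 h.
exists (Num.bound ((r * u 0) ^+ 2 + (r * u 1) ^+ 2)^-1), (fun n => r * u n); split.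
- by move=> n; rewrite -mulrDr su; ring.
- move=> e e0.
  have X0 : 0 <= r * K * kappa^-1 / e.
    by apply: divr_ge0; [apply: divr_ge0; [apply: mulr_ge0|]|]; rewrite // ltW.
  pose N := Num.bound (r * K * kappa^-1 / e).
  exists N => n nN; rewrite normrM (gtr0_norm r0).
  apply: le_trans (ler_wpM2l (ltW r0) (dec n)) _.
  have x0 : r * K * kappa^-1 / e < (`|n|%N)%:R :> R.
    by apply: lt_le_trans (archi_boundP X0) _; rewrite ler_nat.
  move: (_%:R : R) x0 => x x0.
  have x1 : 0 < x by apply: le_lt_trans x0.
  have ex : kappa * x <= expR (kappa * x).
    by apply: le_trans (expR_ge1Dx _); rewrite lerDr.
  rewrite mulrA expRN ler_pdivrMr ?expR_gt0//.
  apply: (@le_trans _ _ (e * (kappa * x))); last by apply: ler_wpM2l => //; exact: ltW.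
  move: x0; rewrite ltr_pdivrMr// ltr_pdivrMr// => h; apply: ltW.
  by rewrite (_ : e * (kappa * x) = x * e * kappa)//; ring.
- move=> N; have -> : box_dot N (fun n => r * u n) (fun n => r * u n) = r ^+ 2 * box_dot N u u.
    by rewrite /box_dot mulr_sumr; apply: eq_bigr => j _; ring.
  by rewrite r2 mulrC ler_pdivrMr// mul1r.
- rewrite -[leRHS]invrK lef_pV2 ?posrE ?invr_gt0//; apply: ltW.
  by apply: lt_trans (archi_boundP _) _; [rewrite invr_ge0 ltW | rewrite ltr_nat].
Qed.

End Countability.

(** * Localization *)

Section Localization.
Context {R : realType}.
Local Notation C := R[i].
Variables (alpha lambda c r b theta : R).
Hypotheses (am : -1 < alpha) (a1 : alpha < 1).
Hypothesis D : diophantine c r b.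
Hypothesis nres : ~ resonant r b theta.
Let v := potential alpha lambda.
Let V (n : int) := v (n%:~R * b + theta).
Let H := hamiltonian v b theta.

(** An energy of the set that is not wild has a slowly growing solution, which decays by
    [solution_decay], so the energy is one of countably many eigenvalues; wild energies
    form a null set. *)
Lemma pure_point_restriction (mu0 mu1 : {finite_measure set (measurableTypeR R) -> \bar R}) :
  is_spectral_measure H (delta R 0) mu0 -> is_spectral_measure H (delta R 1) mu1 ->
  exists mS : measurable (positive_lyapunov_spectrum v b theta),
     pure_point (mrestr (half_sum mu0 mu1) mS).
Proof.
move=> h0 h1.
have [Mv Mv0 vM] := potential_bounded lambda am a1.
have [Lv Lv0 vL] := potential_lipschitz lambda am a1.
have mS := positive_lyapunov_spectrum_measurable b theta Mv0 vM Lv0 vL.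
exists mS; pose P : set (measurableTypeR R) := \bigcup_p eigenvalue_level V p.
have cP : countable P.
  by apply: bigcup_countable => // p _; apply: finite_set_countable; exact: eigenvalue_level_finite.
exists P; split=> //.
have mP : measurable P by apply: countable_measurable => // t; exact: measurable_set1.
have mA : measurable (~` P `&` positive_lyapunov_spectrum v b theta).
  by apply: measurableI => //; exact: measurableC.
have sub : ~` P `&` positive_lyapunov_spectrum v b theta `<=` wild v b theta.
  move=> E [nP [_ L0]]; apply: contrapT => nw; apply: nP.
  have [u [Cu [un0 su pu]]] := not_wild_solution nw.
  have [K [kappa [K0 k0 dec]]] := solution_decay am a1 D L0 nres su pu.
  by have [p Hp] := decaying_eigenvalue_level k0 su un0 dec; exists p.
have null mu i : i = 0 \/ i = 1 -> is_spectral_measure H (delta R i) mu ->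
    mu (~` P `&` positive_lyapunov_spectrum v b theta) = 0%E.
  move=> i01 hmu; apply/eqP; rewrite eq_le measure_ge0 andbT.
  rewrite -(wild_null i01 hmu); apply: le_measure; rewrite ?inE//.
  exact: wild_measurable.
transitivity ((2^-1)%:E *
  measure_add mu0 mu1 (~` P `&` positive_lyapunov_spectrum v b theta))%E; first by [].
transitivity ((2^-1)%:E * (0 + 0) : \bar R)%E; last by rewrite adde0 mule0.
congr (_ * _)%E; rewrite measure_addE; congr (_ + _)%E.
  by apply: (null mu0 0) => //; left.
by apply: (null mu1 1) => //; right.
Qed.

(** The real and imaginary parts of an eigenfunction are bounded real solutions. *)
Lemma eigenfunction_decay (E : R) (u : int -> C) :
  0 < lyapunov v b E%:C -> is_eigenfunction H E%:C u -> decays_exponentially u.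
Proof.
move=> L0 [lu _ Hu].
have rec n : u (n + 1) + u (n - 1) = (E - V n)%:C * u n.
  by have := Hu n; rewrite /H /hamiltonian -/(V n) rmorphB mulrBl => <-; rewrite addrK.
have bound n : normc (u n) <= l2_norm u * (1 + (`|n|%N)%:R).
  by apply: le_trans (normc_le_l2 n lu) _; rewrite ler_peMr ?l2_norm_ge0// lerDl.
have [Kr [kr [Kr0 kr0 Hr]]] : exists K kappa : R, [/\ 0 <= K, 0 < kappa &
    forall n : int, `|complex.Re (u n)| <= K * expR (- (kappa * (`|n|%N)%:R))].
  apply: (solution_decay am a1 D L0 nres (u := fun n => complex.Re (u n)) (Cu := l2_norm u)).
    by move=> n; rewrite -raddfD rec; exact: ReZ.
  by move=> n; apply: le_trans (bound n); exact: abs_Re_le_normc.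
have [Ki [ki [Ki0 ki0 Hi]]] : exists K kappa : R, [/\ 0 <= K, 0 < kappa &
    forall n : int, `|complex.Im (u n)| <= K * expR (- (kappa * (`|n|%N)%:R))].
  apply: (solution_decay am a1 D L0 nres (u := fun n => complex.Im (u n)) (Cu := l2_norm u)).
    by move=> n; rewrite -raddfD rec; exact: ImZ.
  by move=> n; apply: le_trans (bound n); exact: abs_Im_le_normc.
pose k := Num.min kr ki; have [k1 k2] : k <= kr /\ k <= ki by rewrite /k !ge_min !lexx orbT.
exists (Kr + Ki + 1), k; split; first by rewrite ltr_wpDl// addr_ge0.
  by rewrite lt_min kr0.
move=> n; have x0 : 0 <= (`|n|%N)%:R :> R by [].
move: (Hr n) (Hi n); move: (_%:R : R) x0 => x x0 hr hi.
have e1 : expR (- (kr * x)) <= expR (- (k * x)) by rewrite ler_expR lerN2 ler_wpM2r.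
have e2 : expR (- (ki * x)) <= expR (- (k * x)) by rewrite ler_expR lerN2 ler_wpM2r.
have hn : normc (u n) <= `|complex.Re (u n)| + `|complex.Im (u n)|.
  rewrite -(@ler_pXn2r _ 2) ?nnegrE ?addr_ge0 ?normc_ge0// normc_sqrE.
  rewrite -(real_normK (num_real (complex.Re _))) -(real_normK (num_real (complex.Im _))).
  by rewrite sqrrD lerD2r lerDl mulrn_wge0// mulr_ge0.
apply: le_trans hn _; rewrite !mulrDl mul1r.
apply: ler_wpDr; first exact: expR_ge0.
by apply: lerD; [apply: le_trans hr _ | apply: le_trans hi _]; exact: ler_wpM2l.
Qed.

End Localization.

Theorem theorem1p6 (R : realType) (alpha lambda c r b theta : R)
    (mu0 mu1 : {finite_measure set (measurableTypeR R) -> \bar R}) :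
  -1 < alpha -> alpha < 1 ->
  diophantine c r b -> ~ resonant r b theta ->
  let v := potential alpha lambda in
  let H := hamiltonian v b theta in
  is_spectral_measure H (delta R 0) mu0 ->
  is_spectral_measure H (delta R 1) mu1 ->
  (exists mS : measurable (positive_lyapunov_spectrum v b theta),
     pure_point (mrestr (half_sum mu0 mu1) mS)) /\
  (forall (E : R) (u : int -> R[i]),
     positive_lyapunov_spectrum v b theta E ->
     is_eigenfunction H E%:C u -> decays_exponentially u).
Proof.
move=> am a1 D nres v H h0 h1; split.
  exact: (pure_point_restriction am a1 D nres h0 h1).
by move=> E u [_ L0]; exact: (eigenfunction_decay am a1 D nres L0).
Qed.
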